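(* Consider the three color urn process $(\boldsymbol{C}_n)_{n\ge0}$ with replacement matrix $$R=\begin{pmatrix} r_{11}&r_{12}&r_{13}\\0&r_{22}&r_{23}\\0&0&1\end{pmatrix}$$ having nonnegative entries and each row sum equal to one. Assume that $0<r_{22}<r_{11}$ and $r_{12}>0$. Let $\boldsymbol{\xi}_2=(r_{12},\,r_{22}-r_{11},\,0)'$ and let $V_1$ be the almost sure limit of $\boldsymbol{C}_{n1}/n^{r_{11}}$. Then, as $n\to\infty$: (i) If $r_{22}<r_{11}/2$, then $$\frac{\boldsymbol{C}_n\boldsymbol{\xi}_2}{\sqrt{n^{r_{11}}}}\Rightarrow N\left(0,\ \frac{r_{12}r_{22}^2(r_{12}+r_{11}-r_{22})}{r_{11}-2r_{22}}\,V_1\right).$$ (ii) If $r_{22}=r_{11}/2$, then $$\frac{\boldsymbol{C}_n\boldsymbol{\xi}_2}{\sqrt{n^{r_{11}}\log n}}\Rightarrow N\left(0,\ r_{12}r_{22}^2(r_{12}+r_{11}-r_{22})\,V_1\right).$$ (iii) If $r_{22}>r_{11}/2$, then $\boldsymbol{C}_n\boldsymbol{\xi}_2/n^{r_{22}}$ converges almost surely and in $L^2$ to a nondegenerate random variable.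
   Context: **Urn process.** The urn has balls of three colors. The initial counts form a non-random row vector $\boldsymbol{C}_0=(\boldsymbol{C}_{01},\boldsymbol{C}_{02},\boldsymbol{C}_{03})$ with strictly positive real entries summing to one. $\boldsymbol{C}_n=(\boldsymbol{C}_{n1},\boldsymbol{C}_{n2},\boldsymbol{C}_{n3})$ is the row vector of counts after the $n$-th trial. At the $n$-th trial ($n=1,2,\dots$), given the past, color $i$ is drawn with probability $\boldsymbol{C}_{n-1,i}/n$; the drawn ball is returned, and if color $i$ was drawn then, for each $j$, $r_{ij}$ balls of color $j$ are added, i.e. $\boldsymbol{C}_n=\boldsymbol{C}_{n-1}+(\text{the } i\text{-th row of } R)$. (So the total count after $n$ trials is $n+1$.) The vector $\boldsymbol{\xi}_2$ is a right eigenvector of $R$ for the eigenvalue $r_{22}$. It is known that, since $r_{11}>0$ (and the hypotheses force $r_{11}<1$), $\boldsymbol{C}_{n1}/n^{r_{11}}$ converges almost surely and in $L^2$ to a nondegenerate random variable, denoted $V_1$. $\Rightarrow$ denotes convergence in distribution. $V_1$ is a nonnegative random variable, and for a constant $c>0$ the limit law $N(0,cV_1)$ is interpreted as a variance mixture of normal distributions: the law of $\sqrt{cV_1}\,Z$ with $Z$ standard normal independent of $V_1$. ''Nondegenerate'' means not almost surely constant. *)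

(* Defs.v *)
From HB Require Import structures.
From mathcomp Require Import all_boot all_order all_algebra.
From mathcomp Require Import all_classical all_reals all_analysis.
From mathcomp Require Import measurable_realfun.
Import Order.TTheory GRing.Theory Num.Theory.
Import numFieldNormedType.Exports.

Set Implicit Arguments.
Unset Strict Implicit.
Unset Printing Implicit Defensive.

Local Open Scope classical_set_scope.
Local Open Scope ring_scope.

Definition replacement_matrix (R : realType) (r11 r12 r13 r22 r23 : R) :
    'M[R]_3 :=
  \matrix_(i < 3, j < 3)
    nth 0 (nth [::] [:: [:: r11; r12; r13];
                        [:: 0;   r22; r23];
                        [:: 0;   0;   1  ]] i) j.

Definition xi2 (R : realType) (r11 r12 r22 : R) : 'cV[R]_3 :=
  \col_(i < 3) nth 0 [:: r12; r22 - r11; 0] i.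

(* [draw k] is the color drawn at trial [k], for [k >= 1] ([draw 0] is never
   used). Since the initial composition is not random, the sigma-algebra of the
   past of trial [n.+1] is the one generated by the colors of trials 1 to n. *)
Definition past (T : Type) (draw : nat -> T -> 'I_3) (n : nat) : set (set T) :=
  <<s [set A | exists k i, (0 < k <= n)%N /\ A = [set w | draw k w = i]] >>.

(* The last field says that [C n w 0 i / n.+1] is the conditional probability
   of drawing color [i] at trial [n.+1] given the past; its measurability with
   respect to [past draw n] follows from the first two fields. *)
Record urn_process d (T : measurableType d) (R : realType)
    (P : probability T R) (c0 : 'rV[R]_3) (Rm : 'M[R]_3)
    (draw : nat -> T -> 'I_3) (C : nat -> T -> 'rV[R]_3) : Prop := UrnProcess {
  urn_init : forall w, C 0%N w = c0 ;
  urn_step : forall n w, C n.+1 w = C n w + row (draw n.+1 w) Rm ;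
  urn_draw_measurable : forall n i, measurable [set w | draw n.+1 w = i] ;
  urn_draw_prob : forall n i (A : set T), past draw n A ->
    P (A `&` [set w | draw n.+1 w = i]) =
    (\int[P]_(w in A) (C n w 0 i / n.+1%:R)%:E)%E
}.

Definition cvg_in_distribution d (T : measurableType d) (R : realType)
    (P : probability T R) (X : nat -> T -> R) (mu : set R -> \bar R) : Prop :=
  forall f : R -> R, continuous f -> bounded_fun f ->
    (\int[P]_w (f (X n w))%:E)%E @[n --> \oo] --> (\int[mu]_x (f x)%:E)%E.

Definition mixture_rv d (T : measurableType d) (R : realType)
    (P : probability T R) (c : R) (V : {RV P >-> R}) :
    T * measurableTypeR R -> R :=
  fun wz => Num.sqrt (c * V wz.1) * wz.2.

Lemma measurable_mixture_rv d (T : measurableType d) (R : realType)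
    (P : probability T R) (c : R) (V : {RV P >-> R}) :
  measurable_fun setT (mixture_rv c V).
Proof.
apply: measurable_funM; last exact: measurable_snd.
apply: measurableT_comp.
  apply: continuous_measurable_fun; exact: sqrt_continuous.
apply: measurable_funM => //.
exact: measurableT_comp (measurable_funPT V) measurable_fst.
Qed.

HB.instance Definition _ d (T : measurableType d) (R : realType)
    (P : probability T R) (c : R) (V : {RV P >-> R}) :=
  isMeasurableFun.Build _ _ _ _ (mixture_rv c V) (measurable_mixture_rv c V).

(* N(0, c V): the law of [sqrt (c V) * Z] on the product of the probability
   space of [V] with (R, N(0, 1)), where [Z], the second coordinate, is standard
   normal and independent of [V]. *)
Definition normal_mixture d (T : measurableType d) (R : realType)
    (P : probability T R) (c : R) (V : {RV P >-> R}) : set R -> \bar R :=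
  pushforward (P \x normal_prob 0 1)%E (mixture_rv c V).

Definition as_cvg d (T : measurableType d) (R : realType)
    (P : probability T R) (X : nat -> T -> R) (Y : T -> R) : Prop :=
  {ae P, forall w, X n w @[n --> \oo] --> Y w}.

Definition L2_cvg d (T : measurableType d) (R : realType)
    (P : probability T R) (X : nat -> T -> R) (Y : T -> R) : Prop :=
  ('N[P]_2%:E[(fun w => (X n w - Y w)%:E)])%E @[n --> \oo] --> 0%E.

Definition nondegenerate_rv d (T : measurableType d) (R : realType)
    (P : probability T R) (Y : T -> R) : Prop :=
  ~ exists c : R, {ae P, forall w, Y w = c}.

(* Main.v *)
(* With eigenvalues r11 and r22, the variables N = C_n1 / a_n(r11) and
   M = (C_n xi2) / a_n(r22), where a_n(x) = prod_(j <= n) (1 + x / j) ~ k n^x,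
   are martingales. The conditional variance of the increment of M is u_n (N - o(1))
   in L^1 for an explicit deterministic u_n, and N converges in L^2 to a multiple
   of V1. Hence, given the first m draws, M behaves like a martingale whose variance
   is u_n times the known number N_m: replacing E cos(a M + p) step by step by its
   Gaussian value costs an error which vanishes as n and then m go to infinity, and
   this yields E cos(t X_n + p) -> E [cos p exp(- t^2 c V1 / 2)] for the normalised
   statistic X_n. Trigonometric polynomials in a sine approximate bounded continuous
   functions uniformly on compact sets, so together with a second moment bound this
   is convergence in distribution; the variance comes from the asymptotics of
   sum u_k. When r22 > r11 / 2 the sum of the u_k converges, so M is bounded in L^2
   and converges almost surely by the maximal inequality, and in L^2 by Fatou; its
   variance is at least that of its first increment, which is positive.

   Since each draw takes three values, all expectations are finite sums over paths
   of draws, and only the limits involve the measure P. *)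

Require Import Defs.
From HB Require Import structures.
From mathcomp Require Import all_boot all_order all_algebra.
From mathcomp Require Import all_classical all_reals all_analysis.
From mathcomp Require Import measurable_realfun ring lra.
Import Order.TTheory GRing.Theory Num.Theory.
Import numFieldNormedType.Exports.
Local Open Scope classical_set_scope.
Local Open Scope ring_scope.
Set Implicit Arguments.
Unset Strict Implicit.
Unset Printing Implicit Defensive.

(** * Real sequences *)

(** The limiting variance is random, so the increments cannot be compared with Gaussian ones of a
    deterministic variance. Freezing N at time m makes the variance known given the past; the price
    is the fluctuation of N after time m, at most a_m(r11)^(-1/2) in L^1 however many draws follow.
    This error does not vanish as n grows, which dictates the order of the two limits. There is an
    apparent circularity: the conditional variance of M is u_n N up to a correction involving M
    itself, and this correction is shown to be small by a second moment bound for M, which in turn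
    needs the expected conditional variance. It is broken because the linear part of the correction
    is a multiple of the martingale M, so that its expectation is explicit, while the quadratic part
    has a favourable sign. The phase p carries the real and the imaginary part of the characteristic
    function at once, and everything stays real. The constant k in a_n(r11) ~ k n^r11 cancels: N
    tends to V1 / k, while the normalised sums of the u_n carry the factor k. *)

Section real_sequences.
Context {R : realType}.
Implicit Types (x y : R) (u e b : nat -> R).

(** Young's inequality for the product of (1 + y)^x and 1, with the conjugate exponents 1/x and 1/(1
    - x). *)
Lemma bernoulli_powR y x : -1 < y -> 0 < x < 1 -> (1 + y) `^ x <= 1 + x * y.
Proof.
move=> y1 /andP[x0 x1].
have y0 : 0 < 1 + y by lra.
have := @conjugate_powR R ((1 + y) `^ x) 1 x^-1 (1 - x)^-1.
rewrite powR1 mulr1 !invrK -powRrM mulfV ?gt_eqF// (powRr1 (ltW y0)).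
move=> /(_ (powR_ge0 _ _) ler01); rewrite !invr_gt0 subr_gt0 x0 x1.
move=> /(_ isT isT); rewrite addrC subrK => /(_ erefl) /le_trans; apply; lra.
Qed.

(* The expectation of a linear statistic of the composition along a right
   eigenvector for the eigenvalue [x] is multiplied by [growth x n] in [n] trials. *)
Definition growth x (n : nat) : R := \prod_(j < n) (1 + x / j.+1%:R).

Lemma growth0 x : growth x 0 = 1.
Proof. by rewrite /growth big_ord0. Qed.

Lemma growthS x n : growth x n.+1 = growth x n * (1 + x / n.+1%:R).
Proof. by rewrite /growth big_ord_recr. Qed.

Lemma growth_ge1 x n : 0 <= x -> 1 <= growth x n.
Proof.
move=> x0; elim: n => [|n IH]; first by rewrite growth0.
rewrite growthS; apply: mulr_ege1 => //.
by rewrite lerDl divr_ge0.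
Qed.

Lemma growth_gt0 x n : 0 <= x -> 0 < growth x n.
Proof. by move=> x0; apply: (lt_le_trans ltr01); exact: growth_ge1. Qed.

Lemma growth_le x n : 0 <= x -> growth x n <= growth x n.+1.
Proof.
move=> x0; rewrite growthS ler_peMr ?lerDl ?divr_ge0//.
exact/ltW/growth_gt0.
Qed.

(** Bernoulli's inequality bounds (1 + 1/j)^x by 1 + x/j, and the product of the 1 + 1/j
    telescopes. *)
Lemma growth_lb x n : 0 < x < 1 -> n.+1%:R `^ x <= growth x n.
Proof.
move=> x01; have [x0 x1] := andP x01.
elim: n => [|n IH]; first by rewrite powR1 growth0.
rewrite growthS.
have n0 : (0 : R) < n.+1%:R by [].
have -> : n.+2%:R = n.+1%:R * (1 + n.+1%:R^-1) :> R.
  by rewrite mulrDr mulr1 mulfV ?gt_eqF// -natr1.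
rewrite powRM//.
apply: ler_pM => //; rewrite ?powR_ge0//.
by apply: bernoulli_powR => //; rewrite (lt_trans (ltrN10 _))// invr_gt0.
Qed.

(** Bernoulli's inequality at y = -1/(n+2), followed by (1 + z)(1 - z) <= 1 with z = x/(n+2).
    Together with [growth_lb] it yields the power asymptotics by monotone convergence. *)
Lemma growth_powR_nincr x : 0 < x < 1 ->
  nonincreasing_seq (fun n => growth x n.+1 / n.+1%:R `^ x).
Proof.
move=> x01; have [x0 x1] := andP x01.
apply/nonincreasing_seqP => n.
rewrite growthS -mulrA; apply: ler_wpM2l; first exact/ltW/growth_gt0/ltW.
rewrite ler_pdivrMr ?powR_gt0//.
have n0 : (0 : R) < n.+2%:R by [].
have E : n.+1%:R = n.+2%:R * (1 - n.+2%:R^-1) :> R.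
  by rewrite mulrBr mulr1 mulfV ?gt_eqF// -[n.+2%:R]natr1 addrK.
have q1 : (n.+2%:R : R)^-1 < 1 by rewrite invf_lt1// ltr1n.
rewrite [in leRHS]mulrC ler_pdivlMr ?powR_gt0// E.
rewrite powRM ?subr_ge0 ?(ltW q1)// mulrCA ler_piMr ?powR_ge0//.
have B := @bernoulli_powR (- n.+2%:R^-1) x _ x01.
have {}B : (1 - n.+2%:R^-1) `^ x <= 1 - x / n.+2%:R.
  by apply: le_trans (B _) _; [rewrite ltrN2|rewrite mulrN].
apply: (@le_trans _ _ ((1 + x / n.+2%:R) * (1 - x / n.+2%:R))).
  by rewrite ler_wpM2l// addr_ge0// divr_ge0// ltW.
by rewrite mulrC -subr_sqr expr1n lerBlDl lerDr sqr_ge0.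
Qed.

(** The limit is 1/Gamma(1 + x), with Euler's function; later only its positivity matters. *)
Lemma growth_cvg x : 0 < x < 1 ->
  exists2 k : R, 0 < k & growth x n / n%:R `^ x @[n --> \oo] --> k.
Proof.
move=> x01; have [x0 x1] := andP x01.
have lb n : 1 <= growth x n.+1 / n.+1%:R `^ x.
  rewrite ler_pdivlMr ?powR_gt0// mul1r.
  exact: le_trans (growth_lb _ x01) (growth_le _ (ltW x0)).
have cv : cvgn (fun n => growth x n.+1 / n.+1%:R `^ x).
  apply: nonincreasing_is_cvgn; first exact: growth_powR_nincr.
  by exists 1 => _ [n _ <-].
exists (limn (fun n => growth x n.+1 / n.+1%:R `^ x)).
  apply: (@lt_le_trans _ _ 1) => //; apply: limr_ge => //.
  exact: nearW.
by rewrite -(cvg_shiftS (fun n => growth x n / n%:R `^ x)); exact: cv.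
Qed.

Lemma growth_le_nat x n : 0 <= x <= 1 -> growth x n <= n.+1%:R.
Proof.
move=> /andP[x0 x1]; elim: n => [|n IH]; first by rewrite growth0.
rewrite growthS.
have -> : n.+2%:R = n.+1%:R * (1 + 1 / n.+1%:R) :> R.
  by rewrite mulrDr mulr1 mulrC divfK ?pnatr_eq0// natr1.
apply: ler_pM; rewrite ?addr_ge0 ?divr_ge0//; first exact/ltW/growth_gt0.
by rewrite lerD2l ler_pM2r// invr_gt0.
Qed.

Lemma growth_le_param x y n : 0 <= x <= y -> growth x n <= growth y n.
Proof.
move=> /andP[x0 xy]; rewrite /growth; apply: ler_prod => i _.
by rewrite addr_ge0 ?divr_ge0//= lerD2l ler_pM2r ?invr_gt0.
Qed.

(** Beyond a fixed index [e] is at most a small [d], so the tail contributes at most [d * B]; the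
    finite head is a constant that [b] sends to 0. The 1 added to [B] and [S] in the denominators
    covers the case where they vanish. *)
Lemma toeplitz u e b (B : R) : (forall n, 0 <= u n) -> (forall n, 0 <= b n) ->
  b n @[n --> \oo] --> 0 -> (forall n, b n * \sum_(k < n) u k <= B) ->
  e n @[n --> \oo] --> 0 -> b n * \sum_(k < n) u k * e k @[n --> \oo] --> 0.
Proof.
move=> u0 b0 bc bB ec.
have B0 : 0 <= B by apply: le_trans (bB 0%N); rewrite big_ord0 mulr0.
apply/cvgrPdist_le => /= eps eps0.
pose d := eps / (2 * (B + 1)).
have d0 : 0 < d by rewrite divr_gt0// mulr_gt0//; lra.
have /cvgrPdist_le/(_ _ d0)[N _ HN] := ec.
pose S := \sum_(k < N) u k * `|e k|.
have S0 : 0 <= S by apply: sumr_ge0 => k _; rewrite mulr_ge0.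
have main m : \sum_(k < (N + m)%N) u k * `|e k| <= S + d * \sum_(k < (N + m)%N) u k.
  elim: m => [|m IH].
    by rewrite addn0 lerDl mulr_ge0 ?(ltW d0)// sumr_ge0.
  rewrite addnS !big_ord_recr/= mulrDr addrA lerD// mulrC ler_wpM2r//.
  by have := HN (N + m)%N (leq_addr _ _); rewrite sub0r normrN.
have e1 : 0 < eps / (2 * (S + 1)) by rewrite divr_gt0// mulr_gt0//; lra.
have /cvgrPdist_le/(_ _ e1)[N2 _ HN2] := bc.
exists (maxn N N2) => // n /=; rewrite geq_max => /andP[nN nN2].
rewrite sub0r normrN normrM (ger0_norm (b0 _)).
apply: le_trans (_ : b n * \sum_(k < n) u k * `|e k| <= _).
  rewrite ler_wpM2l//; apply: le_trans (ler_norm_sum _ _ _) _.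
  by apply: ler_sum => k _; rewrite normrM ger0_norm.
rewrite -(subnKC nN).
apply: le_trans (ler_wpM2l (b0 _) (main _)) _.
rewrite subnKC// mulrDr mulrCA.
have Q c : 0 <= c -> eps / (2 * (c + 1)) * c <= eps / 2.
  move=> c0; rewrite -subr_ge0.
  have -> : eps / 2 - eps / (2 * (c + 1)) * c = eps / (2 * (c + 1)).
    by field; rewrite gt_eqF//; lra.
  by apply: divr_ge0; [exact: ltW|lra].
have h1 : b n * S <= eps / 2.
  have := HN2 n nN2; rewrite /= sub0r normrN ger0_norm// => h.
  exact: le_trans (ler_wpM2r S0 h) (Q _ S0).
have h2 : d * (b n * \sum_(k < n) u k) <= eps / 2.
  exact: le_trans (ler_wpM2l (ltW d0) (bB n)) (Q _ B0).
lra.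
Qed.

End real_sequences.

(** * Approximation by trigonometric polynomials *)

Section bernstein.
Context {R : realType}.
Implicit Types (t c : R) (f g : nat -> R).

(** The expectation of [f] under the binomial law with parameters [n] and [t], by conditioning on
    one trial. Without binomial coefficients, positivity, linearity and moments all follow by
    induction. *)
Fixpoint bernstein t (n : nat) f : R :=
  if n is m.+1 then t * bernstein t m (f \o succn) + (1 - t) * bernstein t m f
  else f 0%N.

Lemma bernstein_le t n f g : 0 <= t <= 1 ->
  (forall k, (k <= n)%N -> f k <= g k) -> bernstein t n f <= bernstein t n g.
Proof.
move=> /andP[t0 t1]; elim: n f g => [|n IH] f g fg /=; first exact: fg.
apply: lerD; apply: ler_wpM2l; rewrite ?subr_ge0//; apply: IH => k kn.
  exact: fg.
by apply: fg; rewrite ltnW.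
Qed.

Lemma bernsteinD t n f g :
  bernstein t n (fun k => f k + g k) = bernstein t n f + bernstein t n g.
Proof.
elim: n f g => [//|n IH] f g /=.
by rewrite -[_ \o succn]/(fun k => (f \o succn) k + (g \o succn) k) !IH; ring.
Qed.

Lemma bernsteinZ t n c f : bernstein t n (fun k => c * f k) = c * bernstein t n f.
Proof.
elim: n f => [//|n IH] f /=.
by rewrite -[_ \o succn]/(fun k => c * (f \o succn) k) !IH; ring.
Qed.

Lemma bernstein_cst t n c : bernstein t n (fun=> c) = c.
Proof.
elim: n => [//|n IH] /=.
by rewrite -[_ \o succn]/(fun=> c) IH; ring.
Qed.

Lemma bernstein_norm t n f : 0 <= t <= 1 ->
  `|bernstein t n f| <= bernstein t n (fun k => `|f k|).
Proof.
move=> t01; rewrite ler_norml -mulN1r -bernsteinZ.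
by apply/andP; split; apply: bernstein_le => // k _; have := ler_norm (f k); have := ler_norm (- f k); rewrite normrN; lra.
Qed.

(** Binomial variance plus squared bias. The centre is arbitrary because the recursion moves it to
    [c - 1]. *)
Lemma bernstein_sqr t n c :
  bernstein t n (fun k => (k%:R - c) ^+ 2) = n%:R * t * (1 - t) + (n%:R * t - c) ^+ 2.
Proof.
elim: n c => [|n IH] c /=; first by ring.
have -> : (fun k : nat => (k%:R - c) ^+ 2) \o succn = (fun k => (k%:R - (c - 1)) ^+ 2).
  by apply/funext => k /=; rewrite -natr1; ring.
by rewrite !IH -natr1; ring.
Qed.

(** Only one point is confined to the segment, so that [bernstein_approx] may compare [t] with every
    k/n, including those beyond 1. *)
Lemma uniform_continuity_itv (h : R -> R) (a b e : R) : continuous h -> 0 < e ->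
  exists2 d : R, 0 < d & forall x y, a <= x <= b -> `|x - y| <= d -> `|h x - h y| <= e.
Proof.
move=> ch e0.
have /compact_near_coveringP cK := @segment_compact R a b.
have e2 : 0 < e / 2 by rewrite divr_gt0.
have [x xab|] := cK R (0^'+) (fun d x => forall y, `|x - y| <= d -> `|h x - h y| <= e) _.
  have /cvgrPdist_le/(_ _ e2) [d /= d0 Hd] := ch x.
  near=> x' d' => y /= xy.
  have d'd : d' < d / 2 by near: d'; apply: nbhs_right_lt; rewrite divr_gt0.
  have xx' : `|x - x'| < d / 2.
    near: x'; have : 0 < d / 2 by rewrite divr_gt0.
    by move=> d2; exists (d / 2).
  have h1 : `|h x - h x'| <= e / 2 by apply: Hd => /=; lra.
  have h2 : `|h x - h y| <= e / 2.
    apply: Hd => /=; rewrite -(subrKA x' x).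
    by apply: le_lt_trans (ler_normD _ _) _; lra.
  rewrite -(subrKA (h x) (h x')); apply: le_trans (ler_normD _ _) _.
  by rewrite (distrC (h x')); lra.
move=> d' /= d'0 Hd; exists (d' / 2); first by rewrite divr_gt0.
move=> x y xab; apply: Hd => //=; rewrite ?divr_gt0// ?sub0r ?normrN ?gtr0_norm ?divr_gt0//.
by lra.
Unshelve. all: by end_near. Qed.

(** Bernstein's proof of the Weierstrass theorem: the error at k/n is at most e/2 plus a multiple of
    the squared distance to [t], and the mean of that square is t(1 - t)/n. *)
Lemma bernstein_approx (h : R -> R) (B e : R) : continuous h ->
  (forall x, `|h x| <= B) -> 0 < e ->
  exists n, forall t, 0 <= t <= 1 ->
    `|bernstein t n (fun k => h (k%:R / n%:R)) - h t| <= e.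
Proof.
move=> ch hB e0.
have B0 : 0 <= B by apply: le_trans (hB 0).
have e2 : 0 < e / 2 by rewrite divr_gt0.
have [d d0 Hd] := @uniform_continuity_itv h 0 1 _ ch e2.
(* With this factor the quadratic term exceeds the trivial bound 2B as soon as the distance exceeds
   [d]. *)
pose K := 2 * B / d ^+ 2.
have K0 : 0 <= K by rewrite divr_ge0 ?sqr_ge0// mulr_ge0.
have [n n0 Kn] : exists2 n, (0 < n)%N & K / n%:R <= e / 2.
  exists (Num.truncn (K / (e / 2))).+1 => //.
  rewrite ler_pdivrMr// mulrC -ler_pdivrMr//.
  exact/ltW/truncnS_gt.
exists n => t t01; have [t0 t1] := andP t01.
have nR : (0 : R) < n%:R by rewrite ltr0n.
have key k : `|h (k%:R / n%:R) - h t| <= e / 2 + K / n%:R ^+ 2 * (k%:R - n%:R * t) ^+ 2.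
  have Esq : K / n%:R ^+ 2 * (k%:R - n%:R * t) ^+ 2 = K * (k%:R / n%:R - t) ^+ 2.
    by field; rewrite gt_eqF.
  rewrite Esq distrC; have [le|gt] := lerP `|t - k%:R / n%:R| d.
    by apply: le_trans (Hd _ _ t01 le) _; rewrite lerDl mulr_ge0// sqr_ge0.
  apply: le_trans (_ : 2 * B <= _).
    by apply: le_trans (ler_normB _ _) _; rewrite mulr2n mulrDl mul1r lerD.
  apply: le_trans (_ : K * (k%:R / n%:R - t) ^+ 2 <= _); last by rewrite lerDr ltW.
  rewrite /K mulrAC ler_pdivlMr ?exprn_gt0// ler_wpM2l ?mulr_ge0//.
  by rewrite -(real_normK (num_real (_ / _ - _))) distrC lerXn2r ?nnegrE// ltW.
have lin g : bernstein t n g - h t = bernstein t n (fun k => g k - h t).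
  by rewrite bernsteinD bernstein_cst.
rewrite lin; apply: le_trans (bernstein_norm _ _ t01) _.
apply: le_trans (bernstein_le t01 (fun k _ => key k)) _.
rewrite bernsteinD bernstein_cst bernsteinZ bernstein_sqr subrr expr0n/= addr0.
have -> : K / n%:R ^+ 2 * (n%:R * t * (1 - t)) = K / n%:R * (t * (1 - t)).
  by field; rewrite gt_eqF.
have : K / n%:R * (t * (1 - t)) <= K / n%:R.
  by rewrite ler_piMr ?divr_ge0//; nra.
lra.
Qed.

End bernstein.

Section trigonometric_polynomials.
Context {R : realType}.
Implicit Types (f g T : R -> R).

(** Frequencies are arbitrary reals and the phase makes sines available, so the class is closed
    under products by the product-to-sum formula, and limits of expectations over it reduce to those
    of cos(tX + p). *)
Inductive trig_poly : (R -> R) -> Prop :=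
| trig_poly_cos a t p : trig_poly (fun x => a * cos (t * x + p))
| trig_polyD f g : trig_poly f -> trig_poly g -> trig_poly (fun x => f x + g x).

Lemma trig_poly_cst a : trig_poly (fun=> a).
Proof.
rewrite (_ : (fun=> a) = (fun x => a * cos (0 * x + 0))).
  exact: trig_poly_cos.
by apply/funext => x; rewrite mul0r addr0 cos0 mulr1.
Qed.

Lemma trig_polyM f g : trig_poly f -> trig_poly g -> trig_poly (fun x => f x * g x).
Proof.
move=> Tf; elim: Tf g => {f} [a t p|f1 f2 _ IH1 _ IH2] g Tg.
  elim: Tg => {g} [b s q|g1 g2 _ IH1 _ IH2].
    rewrite (_ : (fun _ => _) = (fun x =>
        (a * b / 2) * cos ((t + s) * x + (p + q)) +
        (a * b / 2) * cos ((t - s) * x + (p - q)))).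
      by apply: trig_polyD; exact: trig_poly_cos.
    apply/funext => x.
    rewrite (_ : (t + s) * x + (p + q) = (t * x + p) + (s * x + q)); last by ring.
    rewrite (_ : (t - s) * x + (p - q) = (t * x + p) - (s * x + q)); last by ring.
    by move: (t * x + p) (s * x + q) => u v; rewrite cosD cosB; field.
  rewrite (_ : (fun _ => _) = (fun x => a * cos (t * x + p) * g1 x +
      a * cos (t * x + p) * g2 x)); first exact: trig_polyD.
  by apply/funext => x; rewrite mulrDr.
rewrite (_ : (fun _ => _) = (fun x => f1 x * g x + f2 x * g x)).
  by apply: trig_polyD; [exact: IH1|exact: IH2].
by apply/funext => x; rewrite mulrDl.
Qed.

Lemma trig_poly_bernstein n (c : nat -> R) T :
  trig_poly T -> trig_poly (fun x => bernstein (T x) n c).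
Proof.
move=> tT; elim: n c => [|n IH] c /=; first exact: trig_poly_cst.
apply: trig_polyD; apply: trig_polyM => //.
apply: trig_polyD; first exact: trig_poly_cst.
rewrite (_ : (fun x => - T x) = (fun x => -1 * T x)).
  by apply: trig_polyM => //; exact: trig_poly_cst.
by apply/funext => x; rewrite mulN1r.
Qed.

(* On [-L, L] the variable x is a continuous function of sin (pi x / 4 L), so it
   suffices to approximate uniformly by polynomials in this sine; they inherit
   the bound B on the whole line. *)
Lemma trig_poly_approx f (B L e : R) : continuous f -> (forall x, `|f x| <= B) ->
  0 < L -> 0 < e -> exists T, [/\ trig_poly T,
    forall x, `|x| <= L -> `|T x - f x| <= e & forall x, `|T x| <= B].
Proof.
move=> cf fB L0 e0.
pose th : R := pi / (4 * L).
have pi0 := @pi_gt0 R.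
have th0 : 0 < th by rewrite divr_gt0// mulr_gt0.
pose s : R := sin (pi / 4).
have p4 : 0 < (pi / 4 : R) < pi / 2 by apply/andP; split; lra.
have s0 : 0 < s by apply: sin_gt0_pi; rewrite ?in_itv/=; lra.
have s1 : s < 1.
  by rewrite -sin_pihalf ltr_sin ?in_itv/=; lra.
(* [cl] clamps to [-s, s] with s < 1. Hence [asin] is evaluated only where it is continuous, and [h]
   below is continuous on the whole line and inherits the bound of [f]. *)
pose cl y : R := (`|y + s| - `|y - s|) / 2.
have cl_in y : -1 < cl y < 1.
  by rewrite /cl; case: (ger0P (y + s)); case: (ger0P (y - s)); lra.
have cl_id y : -s <= y <= s -> cl y = y.
  move=> ys; rewrite /cl ger0_norm; last by lra.
  by rewrite ler0_norm; lra.
have ccl : continuous cl.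
  move=> y; rewrite /cl; apply: cvgM; last exact: cvg_cst.
  apply: cvgB; apply: cvg_norm; last by apply: cvgB; [exact: cvg_id|exact: cvg_cst].
  by apply: cvgD; [exact: cvg_id|exact: cvg_cst].
pose h u := f (asin (cl (2 * u - 1)) / th).
have ch : continuous h.
  move=> u; rewrite /h.
  apply: (cvg_comp (fun u => asin (cl (2 * u - 1)) / th) f); last exact: cf.
  apply: cvgM; last exact: cvg_cst.
  apply: (cvg_comp (fun u => cl (2 * u - 1)) asin); last exact: continuous_asin.
  apply: (cvg_comp (fun u => 2 * u - 1) cl); last exact: ccl.
  apply: cvgB; last exact: cvg_cst.
  by apply: cvgM; [exact: cvg_cst|exact: cvg_id].
have [n Hn] := bernstein_approx ch (fun x => fB _) e0.
(* The phase turns the cosine into a sine, so [t] is a trigonometric polynomial with values in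
   [0, 1]. *)
pose t x : R := (1 + cos (th * x + - (pi / 2))) / 2.
have tE x : t x = (1 + sin (th * x)) / 2 by rewrite /t cosBpihalf.
have t01 x : 0 <= t x <= 1.
  by rewrite tE; have := sin_geN1 (th * x); have := sin_le1 (th * x); lra.
exists (fun x => bernstein (t x) n (fun k => h (k%:R / n%:R))); split.
- apply: trig_poly_bernstein.
  rewrite (_ : t = (fun x => 2^-1 + 2^-1 * cos (th * x + - (pi / 2)))).
    by apply: trig_polyD; [exact: trig_poly_cst|exact: trig_poly_cos].
  by apply/funext => x; rewrite /t; field.
- move=> x xL; have := Hn (t x) (t01 x).
  suff -> : h (t x) = f x by [].
  rewrite /h tE (_ : 2 * _ - 1 = sin (th * x)); last by field.
  have thx : - (pi / 4) <= th * x <= pi / 4.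
    rewrite -ler_norml normrM gtr0_norm// mulrC -ler_pdivlMr//.
    rewrite (_ : _ / th = L)//; rewrite /th; move: pi0.
    by move: (@pi R) => p p0; field; rewrite !gt_eqF.
  rewrite cl_id; last first.
    rewrite /s -sinN; apply/andP; split.
      by rewrite leNgt ltr_sin ?in_itv/=; lra.
    by rewrite leNgt ltr_sin ?in_itv/=; lra.
  rewrite sinK; last by rewrite in_itv/=; lra.
  by congr f; rewrite mulrC mulKf ?gt_eqF.
- move=> x; apply: le_trans (bernstein_norm _ _ (t01 x)) _.
  rewrite -[leRHS](bernstein_cst (t x) n); apply: bernstein_le => // k _.
  exact: fB.
Qed.

End trigonometric_polynomials.

(** * Characteristic functions and convergence in distribution *)

Section normal_characteristic_function.
Context {R : realType}.
Local Notation mu := (@lebesgue_measure R).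
Local Notation N01 := (@normal_prob R 0 1).

Lemma integral_normal_prob01 (f : R -> R) : measurable_fun setT f ->
  bounded_fun f ->
  (\int[N01]_x (f x)%:E = \int[mu]_x (f x * normal_pdf 0 1 x)%:E)%E.
Proof.
move=> mf bf.
have dom := normal_prob_dominates (0 : R) 1.
have intf : N01.-integrable setT (EFin \o f).
  apply: measurable_bounded_integrable => //.
  by apply: le_lt_trans (probability_le1 _ _) _; rewrite ?ltry.
rewrite -(Radon_Nikodym_change_of_variables dom measurableT intf).
apply: ae_eq_integral => //=.
- apply: emeasurable_funM => //; first exact/measurable_EFinP.
- apply/measurable_EFinP; apply: measurable_funM => //.
  exact: measurable_normal_pdf.
- under [in X in ae_eq _ _ _ X]eq_fun do rewrite EFinM.
  apply: ae_eqe_mul2l => /=.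
  rewrite Radon_NikodymE//=.
  case: cid => /= h [h1 h2 h3].
  apply: integral_ae_eq => //=.
  + by apply/measurable_EFinP; exact: measurable_normal_pdf.
  + by move=> E _ mE; rewrite -h3.
Qed.

Let e (z : R) := expR (- (z ^+ 2 / 2)).

Let normal_pdf01E z : normal_pdf 0 1 z = normal_peak 1 * e z.
Proof.
rewrite normal_pdfE ?oner_eq0// /normal_fun subr0 expr1n.
by rewrite /e mulNr.
Qed.

Let peak_gt0 : 0 < normal_peak (1 : R).
Proof. by apply: normal_peak_gt0; rewrite oner_eq0. Qed.

Let me : measurable_fun setT e.
Proof.
apply: measurableT_comp => //; apply: measurableT_comp => //.
by apply: measurable_funM => //; exact: measurable_funX.
Qed.

Let int_e : mu.-integrable setT (EFin \o e).
Proof.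
have := @integrableZl _ _ _ mu _ measurableT (normal_peak 1)^-1 _ (integrable_normal_pdf (0 : R) 1).
apply: eq_integrable => // z _ /=.
by rewrite normal_pdf01E -EFinM mulrA mulVf ?mul1r// gt_eqF.
Qed.

(** From (|z|/2 - 1)^2 >= 0 one gets |z| <= 1 + z^2/4 <= exp(z^2/4). The bound on the right is, up
    to a constant, the normal density of variance 2, which makes |z| exp(-z^2/2) integrable. *)
Let norm_e_le z : `|z| * e z <= expR (- (z ^+ 2 / 4)).
Proof.
have -> : e z = expR (- (z ^+ 2 / 4)) * expR (- (z ^+ 2 / 4)).
  by rewrite -expRD /e; congr expR; field.
rewrite mulrA ler_piMl ?expR_ge0// expRN ler_pdivrMr ?expR_gt0// mul1r.
apply: le_trans (expR_ge1Dx _).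
rewrite -(real_normK (num_real z)).
have := sqr_ge0 (`|z| / 2 - 1); nra.
Qed.

Let int_ze : mu.-integrable setT (EFin \o (fun z => `|z| * e z)).
Proof.
have s2 : Num.sqrt 2 != 0 :> R by rewrite sqrtr_eq0 -ltNge.
have := @integrableZl _ _ _ mu _ measurableT (normal_peak (Num.sqrt 2))^-1 _
  (integrable_normal_pdf (0 : R) (Num.sqrt 2)).
rewrite (_ : (fun _ => _) = EFin \o normal_fun 0 (Num.sqrt 2)); last first.
  apply/funext => z; rewrite /= -EFinM normal_pdfE// mulrA mulVf ?mul1r//.
  by rewrite gt_eqF// normal_peak_gt0.
apply: le_integrable => //=.
  by apply/measurable_EFinP; apply: measurable_funM => //; exact: measurableT_comp.
move=> z _; rewrite lee_fin.
rewrite [leRHS]ger0_norm ?expR_ge0// ger0_norm ?mulr_ge0 ?expR_ge0//.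
apply: le_trans (norm_e_le _) _; rewrite /normal_fun ler_expR subr0 sqr_sqrtr//.
by rewrite mulNr lerN2 -[2 *+ 2]mulrnA.
Qed.

Let d_e (z : R) : is_derive z 1 e (- z * e z).
Proof.
rewrite /e; apply: is_derive_eq; rewrite /GRing.scale /=; by field.
Qed.

Let ce : continuous e.
Proof.
move=> z; apply: differentiable_continuous; apply/derivable1_diffP.
by have := d_e z; case.
Qed.

Let bounded_int (f : R -> R) : measurable_fun setT f -> (forall x, `|f x| <= 1) ->
  mu.-integrable setT (EFin \o (fun z => f z * e z)).
Proof.
move=> mf f1; apply: le_integrable int_e => //.
  by apply/measurable_EFinP; exact: measurable_funM.
move=> z _; rewrite /= lee_fin normrM ler_piMl//.
Qed.

Let bounded_intz (f : R -> R) : measurable_fun setT f -> (forall x, `|f x| <= 1) ->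
  mu.-integrable setT (EFin \o (fun z => z * f z * e z)).
Proof.
move=> mf f1; apply: le_integrable int_ze => //.
  by apply/measurable_EFinP; apply: measurable_funM => //; exact: measurable_funM.
move=> z _; rewrite /= lee_fin !normrM normr_id ler_wpM2r// ler_piMr//.
Qed.

Let mcos t p : measurable_fun setT (fun z : R => cos (t * z + p)).
Proof.
apply: measurableT_comp; first by apply: continuous_measurable_fun; exact: continuous_cos.
by apply: measurable_funD => //; exact: measurable_funM.
Qed.

Let msin t p : measurable_fun setT (fun z : R => sin (t * z + p)).
Proof.
apply: measurableT_comp; first by apply: continuous_measurable_fun; exact: continuous_sin.
by apply: measurable_funD => //; exact: measurable_funM.
Qed.

(* The two sides differ by the integral of the derivative of [e z * sin (t * z + p)]. *)
Let ibp t p : \int[mu]_z (z * sin (t * z + p) * e z) =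
  t * \int[mu]_z (cos (t * z + p) * e z).
Proof.
pose F z := e z * sin (t * z + p).
pose f z := t * (cos (t * z + p) * e z) - z * sin (t * z + p) * e z.
have dF (z : R) : is_derive z 1 F (f z).
  have dez := d_e z.
  apply: is_derive_eq; rewrite /GRing.scale /= /f.
  by ring.
have icos := bounded_int (mcos t p) (fun x => cos_max _).
have isin := bounded_intz (msin t p) (fun x => sin_max _).
have itcos : mu.-integrable setT (EFin \o (fun z => t * (cos (t * z + p) * e z))).
  by rewrite (_ : _ \o _ = (fun z => t%:E * (EFin \o (fun z => cos (t * z + p)%R * e z)%R) z)%E) //; exact: integrableZl.
have intf : mu.-integrable setT (EFin \o f).
  exact: (integrableB _ itcos isin).
have mf : measurable_fun setT f by apply/measurable_EFinP; case/integrableP: intf.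
suff : \int[mu]_z f z = 0.
  rewrite /f RintegralB// RintegralZl// => /eqP; rewrite subr_eq0 => /eqP.
  by move=> <-.
have cf : continuous f.
  move=> z; rewrite /f.
  have clin : (fun z : R => t * z + p) @ z --> t * z + p.
    by apply: cvgD; [apply: cvgM; [exact: cvg_cst|exact: cvg_id]|exact: cvg_cst].
  apply: cvgB; apply: cvgM; rewrite ?ce//.
  - exact: cvg_cst.
  - apply: cvgM; last exact: ce.
    by apply: (cvg_comp _ cos clin); exact: continuous_cos.
  - apply: cvgM; first exact: cvg_id.
    by apply: (cvg_comp _ sin clin); exact: continuous_sin.
  - exact: ce.
(* The integral over the line is the limit of those over symmetric segments by dominated
   convergence. On each segment the fundamental theorem leaves boundary terms, of absolute value at
   most 1/(n+1) because |z| exp(-z^2/2) <= 1. *)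
pose I (n : nat) := `[- n.+1%:R, n.+1%:R]%classic : set R.
have FTC n : (\int[mu]_(z in I n) (f z)%:E)%E = (F n.+1%:R - F (- n.+1%:R))%:E.
  have cF : continuous F.
    move=> z; apply: differentiable_continuous; apply/derivable1_diffP.
    by have := dF z; case.
  rewrite (@continuous_FTC2 _ f F)//.
  - by rewrite (lt_trans (_ : _ < 0))// oppr_lt0.
  - exact: continuous_subspaceT.
  - split.
    + by move=> z _; have := dF z; case.
    + by apply: cvg_at_right_filter; exact: cF.
    + by apply: cvg_at_left_filter; exact: cF.
  - by move=> z _; rewrite derive1E; have := dF z; case.
have Fcvg : F n.+1%:R - F (- n.+1%:R) @[n --> \oo] --> 0.
  have bnd (z : R) : 0 < `|z| -> `|F z| <= `|z|^-1.
    move=> z0; rewrite /F normrM -[leRHS]mulr1; apply: ler_pM => //; last exact: sin_max.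
    rewrite ger0_norm ?expR_ge0// -[leRHS]mul1r ler_pdivlMr// mulrC.
    apply: le_trans (norm_e_le _) _.
    by rewrite -expR0 ler_expR oppr_le0 divr_ge0// sqr_ge0.
  have sq (u : nat -> R) : (forall n, `|u n| <= n.+1%:R^-1) -> u n @[n --> \oo] --> 0.
    move=> hu; apply: norm_cvg0.
    apply: (@squeeze_cvgr _ _ _ _ (cst 0) _ _ _ _ _ cvg_harmonic).
      by apply: nearW => n; rewrite normr_ge0 /=; exact: hu.
    exact: cvg_cst.
  rewrite -[X in _ --> X](subrr 0); apply: cvgB; apply: sq => n.
    by apply: le_trans (bnd _ _) _; rewrite ger0_norm.
  by apply: le_trans (bnd _ _) _; rewrite normrN ger0_norm.
have [] := @dominated_convergence _ _ _ mu setT measurableT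
  (fun n => (EFin \o f) \_ (I n)) (EFin \o f) (abse \o (EFin \o f)).
- move=> n; apply/(measurable_restrictT _ _).1 => //.
    exact: measurable_itv.
  exact/measurable_funTS/measurable_EFinP.
- exact/measurable_EFinP.
- apply: aeW => z _; apply: cvg_near_cst.
  exists (Num.truncn `|z|) => // n /= zn.
  rewrite patchE mem_set// /I/= in_itv/= -ler_norml.
  apply: le_trans (ltW (truncnS_gt _)) _; by rewrite ler_nat ltnS.
- exact: integrable_abse.
- apply: aeW => z n _; rewrite patchE; case: ifP => //.
  by rewrite abse0 abse_ge0.
move=> _ _.
under eq_fun do rewrite -integral_mkcond FTC.
move=> h1; have h2 : (F n.+1%:R - F (- n.+1%:R))%:E @[n --> \oo] --> 0%E.
  by apply: cvg_EFin => //; exact: nearW.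
by have := cvg_unique _ h1 h2; rewrite /Rintegral => ->.
Qed.

(** As a function of the frequency the unnormalised integral [H] satisfies H'(s) = -s H(s), by
    differentiation under the integral and integration by parts; hence H(s) exp(s^2/2) is
    constant. *)
Lemma normal_characteristic t p :
  (\int[N01]_z (cos (t * z + p))%:E)%E = (expR (- (t ^+ 2 / 2)) * cos p)%:E.
Proof.
rewrite integral_normal_prob01; last 2 first.
- exact: mcos.
- by exists 1; split => // x x1 y _; apply: le_trans (cos_max _) (ltW x1).
have icos t' := bounded_int (mcos t' p) (fun x => cos_max _).
pose H t := \int[mu]_z (cos (t * z + p) * e z).
have dH (s : R) : is_derive s 1 H (- s * H s).
  have dc (x y : R) : is_derive x 1 (fun x => cos (x * y + p) * e y)
      (- (y * sin (x * y + p) * e y)).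
    apply: is_derive_eq; rewrite /GRing.scale /=.
    by ring.
  have sI : `](s - 1), (s + 1)[%classic s.
    by rewrite /= in_itv/=; lra.
  have intf (x : R) : `](s - 1), (s + 1)[%classic x ->
      mu.-integrable setT (EFin \o (fun y => cos (x * y + p) * e y)).
    by move=> _; exact: icos.
  have dcd (x y : R) : `](s - 1), (s + 1)[%classic x -> [set: R] y ->
      derivable (fun x : R => cos (x * y + p) * e y) x 1.
    by move=> _ _; have := dc x y; case.
  have ub (x y : R) : `](s - 1), (s + 1)[%classic x -> [set: R] y ->
      `|partial1of2 (fun x y : R => cos (x * y + p) * e y) x y| <= `|y| * e y.
    move=> _ _; rewrite partial1of2E; have := dc x y; case=> _ ->.
    rewrite normrN !normrM [`|e y|]ger0_norm ?expR_ge0// ler_wpM2r ?expR_ge0//.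
    by rewrite ler_piMr// sin_max.
  have G0 (y : R) : 0 <= `|y| * e y by rewrite mulr_ge0// expR_ge0.
  have D1 := derivable_under_integral measurableT sI intf dcd G0 int_ze ub.
  have D2 := differentiation_under_integral measurableT sI intf dcd G0 int_ze ub.
  apply: DeriveDef; first exact: D1.
  rewrite -derive1E [LHS]D2.
  under eq_Rintegral => y _.
    rewrite partial1of2E; have := dc s y; case=> _ ->.
    rewrite -mulN1r; over.
  rewrite RintegralZl//; last by apply: bounded_intz; [exact: msin|move=> x; exact: sin_max].
  by rewrite ibp mulN1r mulNr.
pose G s := H s * expR (s ^+ 2 / 2).
have dG (s : R) : is_derive s 1 G 0.
  have dHs := dH s.
  apply: is_derive_eq; rewrite /GRing.scale /=.
  by field.
have int1 : normal_peak 1 * \int[mu]_z e z = 1.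
  rewrite -RintegralZl//; under eq_Rintegral do rewrite -normal_pdf01E.
  by rewrite /Rintegral integral_normal_pdf.
have H0 : H 0 = cos p * \int[mu]_z e z.
  by rewrite -RintegralZl//; apply: eq_Rintegral => z _; rewrite mul0r add0r.
have Gt : H t * expR (t ^+ 2 / 2) = H 0.
  have := is_derive_0_is_cst t 0 dG; rewrite /G => ->.
  by rewrite expr0n/= mul0r expR0 mulr1.
have Ht : normal_peak 1 * H t = expR (- (t ^+ 2 / 2)) * cos p.
  apply: (mulIf (_ : expR (t ^+ 2 / 2) != 0)); first by rewrite gt_eqF// expR_gt0.
  rewrite -mulrA Gt H0 mulrCA int1 mulrAC -expRD addNr expR0 mul1r.
  by rewrite mulr1.
rewrite -Ht -RintegralZl; [|by []|exact: icos].
rewrite /Rintegral fineK; last first.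
  apply: integrable_fin_num => //.
  by have := integrableZl measurableT (normal_peak 1) (icos t).
by apply: eq_integral => z _; rewrite normal_pdf01E mulrCA.
Qed.

End normal_characteristic_function.

Section convergence_in_distribution.
Context {R : realType}.

Lemma bounded_integrable d (T : measurableType d) (P : probability T R) (f : T -> R) (B : R) :
  measurable_fun setT f -> (forall x, `|f x| <= B) -> P.-integrable setT (EFin \o f).
Proof.
move=> mf fB; apply: measurable_bounded_integrable => //.
  by apply: le_lt_trans (probability_le1 _ _) _; rewrite ?ltry.
by exists B; split => [|x Bx y _]; [exact: num_real|exact: le_trans (fB _) (ltW Bx)].
Qed.

Lemma trig_poly_bounded (f : R -> R) : trig_poly f ->
  measurable_fun setT f /\ exists B, forall x, `|f x| <= B.
Proof.
elim=> {f} [a t p|f g _ [mf [B1 fB]] _ [mg [B2 gB]]]; split.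
- apply: measurable_funM => //; apply: measurableT_comp.
    by apply: continuous_measurable_fun; exact: continuous_cos.
  by apply: measurable_funD => //; exact: measurable_funM.
- exists `|a| => x; rewrite normrM ler_piMr//; exact: cos_max.
- exact: measurable_funD.
- by exists (B1 + B2) => x; apply: le_trans (ler_normD _ _) _; exact: lerD.
Qed.

Lemma trig_poly_cvg d (T : measurableType d) (P : probability T R)
    d' (T' : measurableType d') (P' : probability T' R)
    (X : nat -> T -> R) (X' : T' -> R) (f : R -> R) :
  (forall n, measurable_fun setT (X n)) -> measurable_fun setT X' ->
  (forall t p, \int[P]_w cos (t * X n w + p) @[n --> \oo] -->
    \int[P']_w cos (t * X' w + p)) ->
  trig_poly f -> \int[P]_w f (X n w) @[n --> \oo] --> \int[P']_w f (X' w).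
Proof.
move=> mX mX' H.
have icos d1 (T1 : measurableType d1) (Q : probability T1 R) (Z : T1 -> R) t p :
    measurable_fun setT Z -> Q.-integrable setT (EFin \o (fun w => cos (t * Z w + p))).
  move=> mZ; apply: (@bounded_integrable _ _ _ _ 1).
    apply: (measurableT_comp (f := cos)).
      by apply: continuous_measurable_fun; exact: continuous_cos.
    by apply: measurable_funD => //; exact: measurable_funM.
  by move=> x; exact: cos_max.
have itp d1 (T1 : measurableType d1) (Q : probability T1 R) (Z : T1 -> R) (g : R -> R) :
    measurable_fun setT Z -> trig_poly g -> Q.-integrable setT (EFin \o (fun w => g (Z w))).
  move=> mZ /trig_poly_bounded[mg [B gB]].
  by apply: (@bounded_integrable _ _ _ _ B) => //; exact: measurableT_comp.
elim=> {f} [a t p|f g tf IHf tg IHg].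
  rewrite RintegralZl//; last exact: icos.
  rewrite (_ : (fun n => _) = (fun n => a * \int[P]_w cos (t * X n w + p))).
    by apply: cvgM; [exact: cvg_cst|exact: H].
  by apply/funext => n; rewrite RintegralZl//; exact: icos.
rewrite RintegralD//; [|exact: itp..].
rewrite (_ : (fun n => _) =
  (fun n => \int[P]_w f (X n w) + \int[P]_w g (X n w))); first exact: cvgD.
by apply/funext => n; rewrite RintegralD//; exact: itp.
Qed.

(* The second moment bound supplies the tightness that reduces continuous test
   functions to trigonometric polynomials. *)
Lemma cvg_in_distribution_cos d (T : measurableType d) (P : probability T R)
    d' (T' : measurableType d') (P' : probability T' R)
    (X : nat -> T -> R) (X' : T' -> R) (K : R) :
  (forall n, measurable_fun setT (X n)) -> measurable_fun setT X' ->
  (forall t p, \int[P]_w cos (t * X n w + p) @[n --> \oo] -->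
    \int[P']_w cos (t * X' w + p)) ->
  (\forall n \near \oo, (\int[P]_w (X n w ^+ 2)%:E <= K%:E)%E) ->
  cvg_in_distribution P X (pushforward P' (X' : T' -> measurableTypeR R)).
Proof.
move=> mX mX' H XK f cf bf.
have [B B0 fB] : exists2 B : R, 0 < B & forall x, `|f x| <= B.
  have [M [_ HM]] := bf; exists (`|M| + 1); first by rewrite ltr_pwDr.
  by move=> x; apply: HM => //; apply: le_lt_trans (ler_norm M) _; rewrite ltrDl.
have mf : measurable_fun setT f by exact: continuous_measurable_fun.
have ifX d1 (T1 : measurableType d1) (Q : probability T1 R) (Z : T1 -> R) (g : R -> R) :
    measurable_fun setT Z -> measurable_fun setT g -> (forall x, `|g x| <= B) ->
    Q.-integrable setT (EFin \o (fun w => g (Z w))).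
  move=> mZ mg gB; apply: (@bounded_integrable _ _ _ _ B) => //.
  exact: measurableT_comp.
rewrite integral_pushforward//; last 2 first.
- exact/measurable_EFinP.
- by rewrite preimage_setT; exact: ifX.
rewrite preimage_setT -[X in _ --> X]fineK; last first.
  by apply: integrable_fin_num => //; exact: ifX.
have -> : (fun n => (\int[P]_w (f (X n w))%:E)%E) =
          (fun n => (\int[P]_w f (X n w))%:E).
  apply/funext => n; rewrite /Rintegral fineK//.
  by apply: integrable_fin_num => //; exact: ifX.
apply: cvg_EFin; first exact: nearW.
rewrite -[X in _ --> X]/(\int[P']_w f (X' w)).
have K0 : 0 <= K.
  have [n Hn] := filter_ex XK; rewrite -lee_fin; apply: le_trans Hn.
  by apply: integral_ge0 => w _; rewrite lee_fin sqr_ge0.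
have hk (k : nat) : 0 < k.+1%:R^-1 :> R by rewrite invr_gt0.
have hL (k : nat) : 0 < k.+1%:R :> R by [].
(* Radius and accuracy are tied: [Tk k] is within 1/(k+1) of [f] on [-(k+1), k+1] and bounded by [B]
   everywhere. *)
have /choice[Tk HT] := fun k => trig_poly_approx cf fB (hL k) (hk k).
have mTk k : measurable_fun setT (Tk k) by have [/trig_poly_bounded[]] := HT k.
have TkB k x : `|Tk k x| <= B by have [_ _ /(_ x)] := HT k.
(* For the limit variable the approximation error vanishes by dominated convergence: [Tk k] tends to
   [f] pointwise under the common bound [B]. *)
have Tk' : \int[P']_w Tk k (X' w) @[k --> \oo] --> \int[P']_w f (X' w).
  apply: fine_cvg; rewrite fineK; last by apply: integrable_fin_num => //; exact: ifX.
  have [] := @dominated_convergence _ _ _ P' setT measurableT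
    (fun k w => (Tk k (X' w))%:E) (fun w => (f (X' w))%:E) (cst B%:E) => //.
  - by move=> n; apply/measurable_EFinP; exact: measurableT_comp.
  - by apply/measurable_EFinP; exact: measurableT_comp.
  - apply: aeW => w _; apply: cvg_EFin; first exact: nearW.
    apply/cvgrPdist_le => /= e e0.
    exists (maxn (Num.truncn `|X' w|) (Num.truncn e^-1)) => // k /=.
    rewrite geq_max => /andP[k1 k2]; rewrite distrC.
    have [_ /(_ (X' w)) h _] := HT k.
    apply: le_trans (h _) _.
      by apply: le_trans (ltW (truncnS_gt _)) _; rewrite ler_nat ltnS.
    rewrite -[leRHS]invrK lef_pV2 ?posrE ?invr_gt0//.
    by apply: le_trans (ltW (truncnS_gt _)) _; rewrite ler_nat ltnS.
  - exact: finite_measure_integrable_cst.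
  - by apply: aeW => w n _ /=; rewrite lee_fin.
apply/cvgrPdist_le => /= e e0.
have e4 : 0 < e / 4 by rewrite divr_gt0.
have /cvgrPdist_le/(_ _ e4)[N1 _ HN1] := Tk'.
(* The three arguments bring the error on the limit side, the error on the interval and the
   Chebyshev term below e/4 each. *)
pose k := maxn N1 (maxn (Num.truncn (e / 4)^-1) (Num.truncn (2 * B * K / (e / 4)))).
have kN1 : (N1 <= k)%N by rewrite leq_maxl.
have ke : k.+1%:R^-1 <= e / 4.
  rewrite -[leRHS]invrK lef_pV2 ?posrE ?invr_gt0//.
  apply: le_trans (ltW (truncnS_gt _)) _; rewrite ler_nat ltnS.
  by rewrite leq_max leq_maxl orbT.
have kK : 2 * B * K / k.+1%:R ^+ 2 <= e / 4.
  rewrite ler_pdivrMr ?exprn_gt0// [leRHS]mulrC -ler_pdivrMr//.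
  apply: le_trans (_ : k.+1%:R <= _); last first.
    by rewrite expr2 ler_peMr// ler1n.
  apply: le_trans (ltW (truncnS_gt _)) _; rewrite ler_nat ltnS.
  by rewrite leq_max leq_maxr orbT.
have [tk hT _] := HT k.
have /cvgrPdist_le/(_ _ e4) cvk := trig_poly_cvg mX mX' H tk.
near=> n.
have h1 : `|\int[P']_w f (X' w) - \int[P']_w Tk k (X' w)| <= e / 4 by exact: HN1.
have h2 : `|\int[P']_w Tk k (X' w) - \int[P]_w Tk k (X n w)| <= e / 4.
  by near: n; exact: cvk.
have hX2 : (\int[P]_w (X n w ^+ 2)%:E <= K%:E)%E by near: n.
have iX2 : P.-integrable setT (EFin \o (fun w => X n w ^+ 2)).
  apply/integrableP; split.
    by apply/measurable_EFinP; exact: measurable_funX.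
  under eq_integral => w _ do rewrite /= ger0_norm ?sqr_ge0//.
  by apply: le_lt_trans hX2 _; rewrite ltry.
have h3 : `|\int[P]_w Tk k (X n w) - \int[P]_w f (X n w)| <= e / 2.
  rewrite -RintegralB//; [|exact: ifX..].
  have idiff : P.-integrable setT (EFin \o (fun w => Tk k (X n w) - f (X n w))).
    exact: (integrableB _ (ifX _ _ P _ _ (mX n) (mTk k) (TkB k)) (ifX _ _ P _ _ (mX n) mf fB)).
  apply: le_trans (le_normr_Rintegral _ _) _ => //.
  (* Where |X| <= k+1 the first summand bounds the error; elsewhere the trivial bound 2B is at most
     the second summand, as in Chebyshev's inequality. *)
  pose g w := k.+1%:R^-1 + 2 * B / k.+1%:R ^+ 2 * X n w ^+ 2.
  have ig2 : P.-integrable setT (EFin \o (fun w => 2 * B / k.+1%:R ^+ 2 * X n w ^+ 2)).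
    exact: (integrableZl measurableT (2 * B / k.+1%:R ^+ 2) iX2).
  have ig1 : P.-integrable setT (EFin \o (fun w => k.+1%:R^-1)).
    exact: finite_measure_integrable_cst.
  have ig : P.-integrable setT (EFin \o g) by exact: (integrableD _ ig1 ig2).
  apply: le_trans (_ : \int[P]_w g w <= _).
    apply: le_Rintegral => //.
      exact: (integrable_norm idiff).
    move=> w _; rewrite /g.
    have c0 : 0 <= 2 * B / k.+1%:R ^+ 2 * X n w ^+ 2.
      by rewrite mulr_ge0 ?sqr_ge0// divr_ge0 ?sqr_ge0// mulr_ge0// ltW.
    have [le|gt] := lerP `|X n w| k.+1%:R.
      by apply: le_trans (hT _ le) _; rewrite lerDl.
    apply: le_trans (_ : 2 * B <= _).
      apply: le_trans (ler_normB _ _) _; rewrite mulr2n mulrDl mul1r.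
      by apply: lerD; [exact: TkB|exact: fB].
    apply: le_trans (_ : 2 * B / k.+1%:R ^+ 2 * X n w ^+ 2 <= _); last first.
      by rewrite lerDr// invr_ge0.
    rewrite mulrAC ler_pdivlMr ?exprn_gt0// ler_wpM2l ?mulr_ge0//; first exact: ltW.
    by rewrite -(real_normK (num_real (X n w))) lerXn2r ?nnegrE// ltW.
  rewrite RintegralD// RintegralZl// Rintegral_cst//.
  rewrite (_ : fine _ = 1); last by rewrite -[RHS]/(fine 1%E); congr fine; exact: probability_setT.
  rewrite mulr1.
  have hX2' : \int[P]_w (X n w ^+ 2) <= K.
    rewrite -lee_fin /Rintegral fineK//.
    exact: integrable_fin_num.
  have : 2 * B / k.+1%:R ^+ 2 * \int[P]_w (X n w ^+ 2) <= e / 4.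
    apply: le_trans kK; rewrite mulrAC ler_pM2r ?invr_gt0 ?exprn_gt0//.
    by rewrite ler_pM2l// mulr_gt0.
  move=> h; apply: le_trans (lerD ke h) _; lra.
have h4 := ler_distD (\int[P']_w Tk k (X' w)) (\int[P']_w f (X' w)) (\int[P]_w f (X n w)).
have h5 := ler_distD (\int[P]_w Tk k (X n w)) (\int[P']_w Tk k (X' w)) (\int[P]_w f (X n w)).
lra.
Unshelve. all: by end_near. Qed.

End convergence_in_distribution.

(** * Expectations over paths of draws *)

Section path_expectation.
Context {R : realType} {I : finType}.
Variable q : seq I -> I -> R.
Hypothesis q_ge0 : forall s i, 0 <= q s i.
Hypothesis q_sum1 : forall s, \sum_i q s i = 1.
Implicit Types (g h M : seq I -> R) (s u : seq I) (c : R).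

Definition step g s : R := \sum_i q s i * g (i :: s).

(* A path lists its draws from the latest to the earliest; [path_exp n s g] is
   the conditional expectation of [g] after [n] further draws, given the past [s]. *)
Fixpoint path_exp (n : nat) s g : R :=
  if n is m.+1 then path_exp m s (step g) else g s.

Lemma path_exp_le n s g h : (forall u, size u = n -> g (u ++ s) <= h (u ++ s)) ->
  path_exp n s g <= path_exp n s h.
Proof.
elim: n g h => [|n IH] g h gh /=; first exact: (gh [::]).
apply: IH => u un; apply: ler_sum => i _; apply: ler_wpM2l => //.
by apply: (gh (i :: u)); rewrite /= un.
Qed.

Lemma eq_path_exp n s g h : (forall u, size u = n -> g (u ++ s) = h (u ++ s)) ->
  path_exp n s g = path_exp n s h.
Proof.
move=> gh; apply/eqP; rewrite eq_le.
by apply/andP; split; apply: path_exp_le => u /gh ->.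
Qed.

Lemma path_expD n s g h :
  path_exp n s (fun s => g s + h s) = path_exp n s g + path_exp n s h.
Proof.
elim: n g h => [//|n IH] g h /=; rewrite -IH; apply: eq_path_exp => u _.
by rewrite /step -big_split/=; apply: eq_bigr => i _; rewrite mulrDr.
Qed.

Lemma path_expZ n s c g : path_exp n s (fun s => c * g s) = c * path_exp n s g.
Proof.
elim: n g => [//|n IH] g /=; rewrite -IH; apply: eq_path_exp => u _.
by rewrite /step mulr_sumr; apply: eq_bigr => i _; rewrite mulrCA.
Qed.

Lemma path_expB n s g h :
  path_exp n s (fun s => g s - h s) = path_exp n s g - path_exp n s h.
Proof.
rewrite -[- path_exp _ _ h]mulN1r -path_expZ -path_expD.
by apply: eq_path_exp => u _; rewrite mulN1r.
Qed.

Lemma step_cst c s : step (fun=> c) s = c.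
Proof. by rewrite /step -mulr_suml q_sum1 mul1r. Qed.

Lemma path_exp_cst n s c : path_exp n s (fun=> c) = c.
Proof.
elim: n => [//|n IH] /=; rewrite -[RHS]IH; apply: eq_path_exp => u _.
exact: step_cst.
Qed.

Lemma path_exp_bigsum n s m (f : 'I_m -> seq I -> R) :
  path_exp n s (fun s => \sum_(k < m) f k s) = \sum_(k < m) path_exp n s (f k).
Proof.
elim: m f => [|m IH] f.
  rewrite big_ord0 -[RHS](path_exp_cst n s); apply: eq_path_exp => u _.
  by rewrite big_ord0.
rewrite big_ord_recl -IH -path_expD; apply: eq_path_exp => u _.
by rewrite big_ord_recl.
Qed.

Lemma path_exp_ge0 n s g : (forall u, size u = n -> 0 <= g (u ++ s)) ->
  0 <= path_exp n s g.
Proof. by move=> g0; rewrite -(path_exp_cst n s 0); exact: path_exp_le. Qed.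

Lemma path_exp_norm n s g : `|path_exp n s g| <= path_exp n s (fun s => `|g s|).
Proof.
rewrite ler_norml -mulN1r -path_expZ; apply/andP; split; apply: path_exp_le => u _.
  by rewrite mulN1r lerNl -normrN ler_norm.
exact: ler_norm.
Qed.

(** The tower property: the [m] earlier draws are the outer expectation. *)
Lemma path_exp_cat m n s g :
  path_exp (m + n) s g = path_exp m s (fun s => path_exp n s g).
Proof. by elim: n g => [|n IH] g; rewrite ?addn0// addnS /= IH. Qed.

(** The recursion of [path_exp] peels off the last draw; the induction for the maximal inequality
    conditions on the first one. *)
Lemma path_exp_cons n s g : path_exp n.+1 s g = step (fun s => path_exp n s g) s.
Proof. by rewrite -add1n path_exp_cat. Qed.

(** A Cauchy-Schwarz bound, obtained from |x| <= c/2 + x^2/(2c), that is, from (|x| - c)^2 >= 0. *)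
Lemma path_exp_norm_le n s g c : 0 < c -> path_exp n s (fun s => g s ^+ 2) <= c ^+ 2 ->
  path_exp n s (fun s => `|g s|) <= c.
Proof.
move=> c0 gc.
have ptw x : `|x| <= c / 2 + (2 * c)^-1 * x ^+ 2.
  rewrite -subr_ge0 -(real_normK (num_real x)).
  have -> : c / 2 + (2 * c)^-1 * `|x| ^+ 2 - `|x| = (2 * c)^-1 * (`|x| - c) ^+ 2.
    by field; rewrite gt_eqF.
  by rewrite mulr_ge0 ?sqr_ge0// invr_ge0 mulr_ge0// ltW.
apply: le_trans (_ : path_exp n s (fun s => c / 2 + (2 * c)^-1 * g s ^+ 2) <= _).
  by apply: path_exp_le => u _.
rewrite path_expD path_exp_cst path_expZ.
apply: le_trans (_ : c / 2 + (2 * c)^-1 * c ^+ 2 <= _).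
  by rewrite lerD2l ler_wpM2l// invr_ge0 mulr_ge0// ltW.
have -> : c / 2 + (2 * c)^-1 * c ^+ 2 = c by field; rewrite gt_eqF.
by [].
Qed.

Definition cond_var M s : R := \sum_i q s i * (M (i :: s) - M s) ^+ 2.

Lemma cond_var_ge0 M s : 0 <= cond_var M s.
Proof. by apply: sumr_ge0 => i _; rewrite mulr_ge0// sqr_ge0. Qed.

Lemma path_exp_martingale n s M : step M =1 M -> path_exp n s M = M s.
Proof.
move=> mM; elim: n => [//|n IH] /=; rewrite -[RHS]IH.
by apply: eq_path_exp => u _.
Qed.

(** Orthogonality of martingale increments. The centre is free: 0 gives second moments, the starting
    value gives deviations, and an arbitrary constant serves the nondegeneracy argument. *)
Lemma path_exp_sqr n s M c : step M =1 M ->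
  path_exp n s (fun s => (M s - c) ^+ 2) =
  (M s - c) ^+ 2 + \sum_(k < n) path_exp k s (cond_var M).
Proof.
move=> mM; elim: n => [|n IH]; first by rewrite /= big_ord0 addr0.
rewrite big_ord_recr/= addrA -IH -path_expD; apply: eq_path_exp => u _.
set s' := u ++ s; rewrite /step /cond_var.
have -> : (M s' - c) ^+ 2 = \sum_i q s' i * (M s' - c) ^+ 2.
  by rewrite -mulr_suml q_sum1 mul1r.
have m0 : \sum_i q s' i * (2 * (M s' - c) * (M (i :: s') - M s')) = 0.
  transitivity (2 * (M s' - c) * (step M s' - \sum_i q s' i * M s')).
    rewrite /step -sumrB mulr_sumr; apply: eq_bigr => i _; ring.
  by rewrite -mulr_suml q_sum1 mul1r mM subrr mulr0.
apply: etrans (addr0 _); rewrite -[X in _ = _ + X]m0 -!big_split/=; apply: eq_bigr => i _; ring.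
Qed.

(** Kolmogorov's inequality by induction on the number of draws. If the start is already at distance
    [e] from [c], the second moment is at least [e ^+ 2], as it only increases along the martingale;
    otherwise condition on the first draw. [drop j s] is the path [j] draws earlier. *)
Lemma maximal_inequality n s M c (e : R) : step M =1 M -> 0 < e ->
  path_exp n s (fun s => [exists j : 'I_n.+1, e <= `|M (drop j s) - c|]%:R) <=
  path_exp n s (fun s => (M s - c) ^+ 2) / e ^+ 2.
Proof.
move=> mM e0; elim: n s => [|n IH] s.
  rewrite /=; case: existsP => [[j]|_]; last first.
    by rewrite divr_ge0 ?sqr_ge0.
  rewrite ord1 drop0 => le1; rewrite ler_pdivlMr ?exprn_gt0// mul1r.
  by rewrite -(real_normK (num_real (M s - c))) lerXn2r ?nnegrE// ltW.
have [le1|gt1] := lerP e `|M s - c|.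
  apply: le_trans (_ : 1 <= _).
    rewrite -[leRHS](path_exp_cst n.+1 s); apply: path_exp_le => u _.
    by case: existsP; rewrite ?ler01.
  rewrite ler_pdivlMr ?exprn_gt0// mul1r path_exp_sqr//.
  apply: le_trans (_ : (M s - c) ^+ 2 <= _).
    by rewrite -(real_normK (num_real (M s - c))) lerXn2r ?nnegrE// ltW.
  rewrite lerDl sumr_ge0// => k _; apply: path_exp_ge0 => u _; exact: cond_var_ge0.
rewrite !path_exp_cons /step mulr_suml; apply: ler_sum => i _.
rewrite -mulrA ler_wpM2l//; apply: le_trans (IH (i :: s)).
apply: path_exp_le => u un; rewrite ler_nat.
case: existsP => [[j hj]|_//].
suff -> : [exists j0 : 'I_n.+1, e <= `|M (drop j0 (u ++ i :: s)) - c|] by [].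
have [jn|jn] := ltnP j n.+1; first by apply/existsP; exists (Ordinal jn).
(* The remaining index [n.+1] leads back to the start [s], which [gt1] excludes. *)
have jE : val j = n.+1 by apply/eqP; rewrite eqn_leq jn andbT -ltnS ltn_ord.
move: hj; rewrite jE -cat_rcons drop_size_cat ?size_rcons ?un//.
by rewrite leNgt gt1.
Qed.

End path_expectation.

(** * The law of the urn on paths of draws *)

Section urn_paths.
Context {R : realType} (c0 : 'rV[R]_3) (Rm : 'M[R]_3).

Definition composition (s : seq 'I_3) : 'rV[R]_3 := foldr (fun i c => c + row i Rm) c0 s.

Definition draw_prob (s : seq 'I_3) (i : 'I_3) : R :=
  composition s 0 i / (size s).+1%:R.

Hypothesis c0_gt0 : forall i, 0 < c0 0 i.
Hypothesis c0_sum : \sum_i c0 0 i = 1.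
Hypothesis Rm_ge0 : forall i j, 0 <= Rm i j.
Hypothesis Rm_sum : forall i, \sum_j Rm i j = 1.

Lemma composition_gt0 s i : 0 < composition s 0 i.
Proof. by elim: s => [|j s IH] //=; rewrite !mxE ltr_pwDl. Qed.

Lemma composition_sum s : \sum_i composition s 0 i = (size s).+1%:R.
Proof.
elim: s => [|j s IH] //=.
rewrite -[RHS]natr1 -IH -[in RHS](Rm_sum j) -big_split/=.
by apply: eq_bigr => i _; rewrite !mxE.
Qed.

Lemma draw_prob_ge0 s i : 0 <= draw_prob s i.
Proof. by rewrite divr_ge0// ltW// composition_gt0. Qed.

Lemma draw_prob_sum1 s : \sum_i draw_prob s i = 1.
Proof. by rewrite -mulr_suml composition_sum mulfV. Qed.

Context d (T : measurableType d) (P : probability T R).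
Variables (draw : nat -> T -> 'I_3) (C : nat -> T -> 'rV[R]_3).
Hypothesis HC : urn_process P c0 Rm draw C.

Fixpoint draws (n : nat) (w : T) : seq 'I_3 :=
  if n is m.+1 then draw m.+1 w :: draws m w else [::].

Lemma size_draws n w : size (draws n w) = n.
Proof. by elim: n => [//|n IH] /=; rewrite IH. Qed.

Lemma drop_draws n k w : drop k (draws (k + n) w) = draws n w.
Proof. by elim: k => [|k IH]; rewrite ?drop0. Qed.

Lemma compositionE n w : C n w = composition (draws n w).
Proof.
elim: n => [|n IH]; first by rewrite (urn_init HC).
by rewrite (urn_step HC) IH.
Qed.

(** The field [urn_draw_prob] applies to events of [past] only, a smaller sigma-algebra than that of
    [T]. *)
Lemma past_draws n s : past draw n [set w | draws n w = s].
Proof.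
elim: n s => [|n IH] [|i s] /=; rewrite /past.
- rewrite (_ : [set w : T | _] = setT); last by apply/seteqP; split => w.
  exact: (@measurableT _ (g_sigma_algebraType _)).
- rewrite (_ : [set w : T | _] = set0); last by apply/seteqP; split => w.
  exact: (@measurable0 _ (g_sigma_algebraType _)).
- rewrite (_ : [set w : T | _] = set0); last by apply/seteqP; split => w.
  exact: (@measurable0 _ (g_sigma_algebraType _)).
rewrite (_ : [set w : T | _] = [set w | draw n.+1 w = i] `&` [set w | draws n w = s]).
  apply: (@measurableI _ (g_sigma_algebraType _)).
    by apply: sub_gen_smallest; exists n.+1, i; rewrite /= leqnn.
  have := IH s; rewrite /past; apply: sub_sigma_algebra2 => A [k [j [/andP[k0 kn] ->]]].
  by exists k, j; rewrite k0 leqW.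
by apply/seteqP; split => w /= [-> ->].
Qed.

Lemma measurable_draws n s : measurable [set w | draws n w = s].
Proof.
elim: n s => [|n IH] [|i s] /=.
- by rewrite (_ : [set w : T | _] = setT)//; apply/seteqP; split => w.
- by rewrite (_ : [set w : T | _] = set0)//; apply/seteqP; split => w.
- by rewrite (_ : [set w : T | _] = set0)//; apply/seteqP; split => w.
rewrite (_ : [set w : T | _] = [set w | draw n.+1 w = i] `&` [set w | draws n w = s]).
  by apply: measurableI => //; exact: (urn_draw_measurable HC).
by apply/seteqP; split => w /= [-> ->].
Qed.

Fixpoint path_prob (s : seq 'I_3) : R :=
  if s is i :: s' then draw_prob s' i * path_prob s' else 1.

(** The chain rule: where the first draws are [s], the conditional probability of the next color is
    the constant [draw_prob s i]. *)
Lemma prob_draws n s : size s = n -> P [set w | draws n w = s] = (path_prob s)%:E.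
Proof.
elim: n s => [|n IH] [|i s] //=.
  move=> _; rewrite (_ : [set w : T | _] = setT); first exact: probability_setT.
  by apply/seteqP; split => w.
move=> [sn].
rewrite (_ : [set w : T | _] = [set w | draws n w = s] `&` [set w | draw n.+1 w = i]); last first.
  by apply/seteqP; split => w /= [-> ->].
rewrite (urn_draw_prob HC); last exact: past_draws.
transitivity (\int[P]_(w in [set w | draws n w = s]) (draw_prob s i)%:E)%E.
  apply: eq_integral => w; rewrite inE /= => ws.
  by rewrite compositionE ws /draw_prob sn.
rewrite integral_cst; last exact: measurable_draws.
by rewrite [RHS]EFinM; congr (_ * _)%E; exact: IH.
Qed.

Lemma path_exp_sum n g :
  path_exp draw_prob n [::] g = \sum_(s : n.-tuple 'I_3) path_prob s * g s.
Proof.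
elim: n g => [|n IH] g /=.
  rewrite (bigD1 [tuple])//= mul1r big1 ?addr0// => s.
  by case/negP; rewrite [s]tuple0.
rewrite IH.
rewrite (reindex (fun p : 'I_3 * n.-tuple 'I_3 => cons_tuple p.1 p.2))/=; last first.
  exists (fun s : n.+1.-tuple 'I_3 => (thead s, behead_tuple s)) => [[i s] _|s _].
    by congr (_, _); apply: val_inj.
  by apply: val_inj => /=; case: s => [[|x s] e].
rewrite -(pair_bigA _ (fun i (s : n.-tuple 'I_3) =>
   draw_prob s i * path_prob s * g (i :: s)))/= exchange_big/=.
apply: eq_bigr => s _; rewrite /step mulr_sumr; apply: eq_bigr => i _.
by rewrite mulrA [path_prob _ * _]mulrC.
Qed.

Lemma draws_indic n (g : seq 'I_3 -> R) w :
  g (draws n w) = \sum_(s : n.-tuple 'I_3) g s * \1_[set w | draws n w = s] w.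
Proof.
have dn : size (draws n w) == n by rewrite size_draws.
rewrite (bigD1 (Tuple dn))//= indicE mem_set// mulr1 big1 ?addr0// => s sn.
rewrite indicE memNset ?mulr0//= => e; case/negP: sn.
by apply/eqP/val_inj => /=.
Qed.

Lemma measurable_fun_draws n (g : seq 'I_3 -> R) :
  measurable_fun setT (fun w => g (draws n w)).
Proof.
under eq_fun do rewrite draws_indic.
apply: measurable_sum => s; apply: measurable_funM => //.
exact: measurable_indic (measurable_draws _ _).
Qed.

(** The bridge between [P] and finite sums: a function of the first [n] draws is a finite
    combination of indicators of path events. *)
Lemma integral_draws n (g : seq 'I_3 -> R) :
  (\int[P]_w (g (draws n w))%:E)%E = (path_exp draw_prob n [::] g)%:E.
Proof.
rewrite path_exp_sum.
transitivity (\int[P]_w (\sum_(s : n.-tuple 'I_3)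
    (g s)%:E * (\1_[set w | draws n w = s] w)%:E))%E.
  by apply: eq_integral => w _; rewrite draws_indic -sumEFin.
have intI (s : seq 'I_3) : P.-integrable setT (fun w => (\1_[set w | draws n w = s] w)%:E).
  by apply: integrable_indic => //; exact: measurable_draws.
rewrite integral_sum//; last by move=> s; exact: integrableZl.
rewrite -sumEFin; apply: eq_bigr => s _.
rewrite integralZl// integral_indic ?setIT//; last exact: measurable_draws.
rewrite [LHS]muleC [RHS]EFinM; congr (_ * _)%E.
exact: prob_draws (size_tuple s).
Qed.

End urn_paths.

(** * Taylor remainders of the cosine and the exponential *)

Section cosine_expansion.
Context {R : realType}.
Implicit Types (x h a : R).

(** Both sides come from 1 + y <= exp(y): directly at y = -x, and through exp(-x) <= 1/(1 + x) <= 1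
    - x + x^2. *)
Lemma expRN_taylor x : 0 <= x -> `|expR (- x) - (1 - x)| <= x ^+ 2.
Proof.
move=> x0; rewrite ger0_norm ?subr_ge0 ?expR_ge1Dx// lerBlDr expRN.
have x1 : 0 < 1 + x by lra.
apply: (@le_trans _ _ (1 + x)^-1).
  by rewrite lef_pV2 ?posrE ?expR_gt0// expR_ge1Dx.
rewrite -[leLHS]mul1r ler_pdivrMr//.
have -> : (x ^+ 2 + (1 - x)) * (1 + x) = 1 + x ^+ 3 by ring.
by rewrite lerDl exprn_ge0.
Qed.

Lemma derivative_bound (f f' : R -> R) (K h : R) : f 0 = 0 -> 0 <= h ->
  (forall x, is_derive x 1 f (f' x)) ->
  (forall x, 0 <= x <= h -> `|f' x| <= K) -> `|f h| <= K * h.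
Proof.
move=> f0 h0 df bf.
have cf : {within `[0, h], continuous f}.
  apply: continuous_subspaceT => x; apply: differentiable_continuous.
  by apply/derivable1_diffP; have := df x; case.
have [c] := MVT_segment h0 (fun x _ => df x) cf.
rewrite in_itv/= => ch; rewrite f0 !subr0 => ->.
by rewrite normrM (ger0_norm h0) ler_wpM2r// bf.
Qed.

Lemma sin_norm_le h : `|sin h| <= `|h|.
Proof.
wlog h0 : h / 0 <= h.
  move=> H; have [/H//|h0] := lerP 0 h.
  by have := H (- h); rewrite sinN !normrN oppr_ge0 ltW//; apply.
rewrite (ger0_norm h0) -[leRHS]mul1r.
apply: (@derivative_bound _ cos) => //; first exact: sin0.
by move=> x _; exact: cos_max.
Qed.

Lemma cos_norm_le h : `|cos h - 1| <= h ^+ 2.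
Proof.
wlog h0 : h / 0 <= h.
  move=> H; have [/H//|h0] := lerP 0 h.
  by have := H (- h); rewrite cosN sqrrN oppr_ge0 ltW//; apply.
rewrite expr2; apply: (@derivative_bound (fun x => cos x - 1) (fun x => - sin x)) => //.
- by rewrite cos0 subrr.
- by move=> x; apply: is_derive_eq; rewrite subr0.
- move=> x /andP[x0 xh]; rewrite normrN; apply: le_trans (sin_norm_le x) _.
  by rewrite ger0_norm.
Qed.

Lemma sin_taylor h : `|sin h - h| <= `|h| ^+ 3.
Proof.
wlog h0 : h / 0 <= h.
  move=> H; have [/H//|h0] := lerP 0 h.
  have e : sin (- h) - - h = - (sin h - h) by rewrite sinN; ring.
  by have := H (- h); rewrite e !normrN oppr_ge0 ltW//; apply.
rewrite (ger0_norm h0) exprSr.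
apply: (@derivative_bound (fun x => sin x - x) (fun x => cos x - 1)) => //.
- by rewrite sin0 subrr.
- move=> x /andP[x0 xh]; apply: le_trans (cos_norm_le x) _.
  by rewrite lerXn2r// nnegrE.
Qed.

(** A quadratic bound for all [h], so that one more integration gives a cubic remainder for the
    cosine on the whole line; integrating the cubic bound would give a fourth power, too large for
    large [h]. *)
Lemma sin_taylor2 h : `|sin h - h| <= 2 * h ^+ 2.
Proof.
rewrite -(real_normK (num_real h)); have [h2|h2] := lerP `|h| 2.
  apply: le_trans (sin_taylor h) _; rewrite exprS ler_wpM2r// sqr_ge0.
apply: le_trans (ler_normB _ _) _; have := sin_norm_le h; nra.
Qed.

Lemma cos_taylor0 h : `|cos h - 1 + h ^+ 2 / 2| <= 2 * `|h| ^+ 3.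
Proof.
wlog h0 : h / 0 <= h.
  move=> H; have [/H//|h0] := lerP 0 h.
  by have := H (- h); rewrite cosN sqrrN normrN oppr_ge0 ltW//; apply.
rewrite (ger0_norm h0) [h ^+ 3]exprSr mulrA.
apply: (@derivative_bound (fun x => cos x - 1 + x ^+ 2 / 2) (fun x => - (sin x - x))) => //.
- by rewrite cos0 expr0n/= mul0r addr0 subrr.
- by move=> x; apply: is_derive_eq; rewrite /GRing.scale/=; field.
- move=> x /andP[x0 xh]; rewrite normrN; apply: le_trans (sin_taylor2 x) _.
  by rewrite ler_pM2l// lerXn2r// nnegrE.
Qed.

Lemma cos_taylor a h :
  `|cos (a + h) - (cos a - h * sin a - h ^+ 2 / 2 * cos a)| <= 3 * `|h| ^+ 3.
Proof.
have -> : cos (a + h) - (cos a - h * sin a - h ^+ 2 / 2 * cos a) =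
    cos a * (cos h - 1 + h ^+ 2 / 2) - sin a * (sin h - h).
  by rewrite cosD; ring.
apply: le_trans (ler_normB _ _) _; rewrite !normrM.
have c1 := cos_max a; have s1 := sin_max a.
have := cos_taylor0 h; have := sin_taylor h.
have := normr_ge0 (cos h - 1 + h ^+ 2 / 2); have := normr_ge0 (sin h - h).
have := normr_ge0 (cos a); have := normr_ge0 (sin a).
nra.
Qed.

End cosine_expansion.

(* Gaussian replacement for a martingale with bounded increments: the weights [w k]
   are arbitrary guesses for the conditional variances. *)
Section martingale_cosine.
Context {R : realType} {I : finType}.
Variable q : seq I -> I -> R.
Hypothesis q_ge0 : forall s i, 0 <= q s i.
Hypothesis q_sum1 : forall s, \sum_i q s i = 1.
Variables (M : seq I -> R) (D : R).
Hypothesis martM : step q M =1 M.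
Hypothesis boundM : forall s i, `|M (i :: s) - M s| <= D.
Variables (a p : R).
Let phi s := cos (a * M s + p).
Let th := a ^+ 2 / 2.

(** The error of the guess [w], the Taylor remainder of the cosine with one of its three increments
    bounded by [D], and the remainder of the exponential. *)
Definition cos_error (w : R) (s : seq I) : R :=
  th * `|cond_var q M s - w| + 3 * `|a| ^+ 3 * D * cond_var q M s + (th * w) ^+ 2.

Lemma step_cos s (w : R) : 0 <= w ->
  `|step q phi s - phi s * expR (- (th * w))| <= cos_error w s.
Proof.
move=> w0; have th0 : 0 <= th by rewrite divr_ge0// sqr_ge0.
pose h i := a * (M (i :: s) - M s).
pose A := cos (a * M s + p); pose B := sin (a * M s + p).
have m1 : \sum_i q s i * h i = 0.
  transitivity (a * (step q M s - \sum_i q s i * M s)).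
    by rewrite /step -sumrB mulr_sumr; apply: eq_bigr => i _; rewrite /h; ring.
  by rewrite -mulr_suml q_sum1 mul1r martM subrr mulr0.
have m2 : \sum_i q s i * (h i ^+ 2 / 2) = th * cond_var q M s.
  by rewrite /cond_var mulr_sumr; apply: eq_bigr => i _; rewrite /h /th; field.
have m3 : \sum_i q s i * (3 * `|h i| ^+ 3) <= 3 * `|a| ^+ 3 * D * cond_var q M s.
  rewrite /cond_var mulr_sumr; apply: ler_sum => i _.
  rewrite [leRHS]mulrCA ler_wpM2l// /h normrM exprMn.
  set x := M (i :: s) - M s.
  have -> : 3 * `|a| ^+ 3 * D * x ^+ 2 = 3 * (`|a| ^+ 3 * (D * x ^+ 2)) by ring.
  rewrite ler_wpM2l// ler_wpM2l ?exprn_ge0// exprS (real_normK (num_real x)).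
  by rewrite ler_wpM2r ?sqr_ge0//; exact: boundM.

have e1 : `|step q phi s - A * (1 - th * cond_var q M s)| <= 3 * `|a| ^+ 3 * D * cond_var q M s.
  apply: le_trans m3.
  have -> : step q phi s - A * (1 - th * cond_var q M s) =
      \sum_i q s i * (cos (a * M s + p + h i) - (A - h i * B - h i ^+ 2 / 2 * A)).
    rewrite -m2.
    have -> : A * (1 - \sum_i q s i * (h i ^+ 2 / 2)) =
        (\sum_i q s i) * A - (\sum_i q s i * h i) * B -
        (\sum_i q s i * (h i ^+ 2 / 2)) * A.
      by rewrite q_sum1 m1; ring.
    rewrite !mulr_suml -!sumrB; apply: eq_bigr => i _.
    rewrite /phi (_ : a * M (i :: s) + p = a * M s + p + h i); last by rewrite /h; ring.
    by ring.
  apply: le_trans (ler_norm_sum _ _ _) _; apply: ler_sum => i _.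
  by rewrite normrM ger0_norm// ler_wpM2l// cos_taylor.
have A1 : `|A| <= 1 by exact: cos_max.
have e2 : `|A * (1 - th * cond_var q M s) - A * expR (- (th * w))| <=
    th * `|cond_var q M s - w| + (th * w) ^+ 2.
  rewrite -mulrBr normrM -[leRHS]mul1r; apply: ler_pM => //.
  have -> : 1 - th * cond_var q M s - expR (- (th * w)) =
     - (th * (cond_var q M s - w)) - (expR (- (th * w)) - (1 - th * w)) by ring.
  apply: le_trans (ler_normB _ _) _; rewrite normrN normrM (ger0_norm th0).
  by rewrite lerD2l expRN_taylor// mulr_ge0.
have := ler_distD (A * (1 - th * cond_var q M s)) (step q phi s) (phi s * expR (- (th * w))).
rewrite /cos_error /phi -/A => h3.
rewrite /phi -/A in e1.
lra.
Qed.

(** Draws are replaced from the last one backwards. Given [s] the weights are constants, so the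
    Gaussian factors leave the expectation; being at most 1, they do not amplify the earlier
    errors. *)
Lemma path_exp_cos n s (w : nat -> R) : (forall k, 0 <= w k) ->
  `|path_exp q n s phi - phi s * expR (- (th * \sum_(k < n) w k))| <=
  \sum_(k < n) path_exp q k s (cos_error (w k)).
Proof.
move=> w0; have th0 : 0 <= th by rewrite divr_ge0// sqr_ge0.
elim: n => [|n IH] /=.
  by rewrite !big_ord0 mulr0 oppr0 expR0 mulr1 subrr normr0.
rewrite !big_ord_recr/= mulrDr opprD expRD.
set X := expR (- (th * \sum_(k < n) w k)) in IH *.
set x := expR (- (th * w n)).
have x01 : 0 <= x <= 1.
  by rewrite expR_ge0 -expR0 ler_expR oppr_le0 mulr_ge0.
have h1 : `|path_exp q n s (step q phi) - path_exp q n s phi * x| <=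
    path_exp q n s (cos_error (w n)).
  rewrite mulrC -path_expZ// -path_expB//.
  apply: (le_trans (path_exp_norm q_ge0 _ _ _)).
  apply: path_exp_le => // u _; rewrite mulrC; exact: step_cos.
have h2 : `|path_exp q n s phi * x - phi s * (X * x)| <=
    \sum_(k < n) path_exp q k s (cos_error (w k)).
  rewrite mulrA -mulrBl normrM (ger0_norm (andP x01).1).
  apply: le_trans IH; rewrite ler_piMr//; exact: (andP x01).2.
have := ler_distD (path_exp q n s phi * x) (path_exp q n s (step q phi)) (phi s * (X * x)).
lra.
Qed.

End martingale_cosine.

(** * The three color urn *)

Section three_color_urn.
Context {R : realType} (r11 r12 r13 r22 r23 : R) (c0 : 'rV[R]_3).
Let Rm := replacement_matrix r11 r12 r13 r22 r23.
Hypothesis c0_gt0 : forall i, 0 < c0 0 i.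
Hypothesis c0_sum : \sum_i c0 0 i = 1.
Hypothesis R_ge0 : forall i j, 0 <= Rm i j.
Hypothesis R_row : forall i, \sum_j Rm i j = 1.
Hypothesis r22_gt0 : 0 < r22.
Hypothesis r22_lt : r22 < r11.
Hypothesis r12_gt0 : 0 < r12.

Let i1 : 'I_3 := lift ord0 ord0.
Let i2 : 'I_3 := lift ord0 (lift ord0 ord0).
Let q := draw_prob c0 Rm.
Let comp := composition c0 Rm.

Let q_ge0 : forall s i, 0 <= q s i.
Proof. exact: draw_prob_ge0. Qed.

Let q_sum1 : forall s, \sum_i q s i = 1.
Proof. exact: draw_prob_sum1. Qed.

Let sum3 (F : 'I_3 -> R) : \sum_i F i = F ord0 + F i1 + F i2.
Proof. by rewrite !big_ord_recl big_ord0 addr0 addrA. Qed.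

Lemma first_row_bounds : r11 + r12 <= 1 /\ r11 < 1.
Proof.
have := R_row ord0; rewrite sum3 !mxE/= => e.
have := R_ge0 ord0 i2; rewrite !mxE/= => r13_0.
have := r12_gt0; split; lra.
Qed.

Let r11_lt1 := first_row_bounds.2.
Let r11_12 := first_row_bounds.1.

Definition eig (s : seq 'I_3) : R := (comp s *m xi2 r11 r12 r22) 0 0.

Lemma eigE s : eig s = r12 * comp s 0 ord0 - (r11 - r22) * comp s 0 i1.
Proof. by rewrite /eig mxE sum3 !mxE/=; ring. Qed.

Let xi i : R := xi2 r11 r12 r22 i 0.

Lemma eig_cons i s : eig (i :: s) = eig s + r22 * xi i.
Proof.
have rE : (row i Rm *m xi2 r11 r12 r22) 0 0 = r22 * xi i.
  rewrite mxE sum3 /xi !mxE/=.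
  by case: i => -[|[|[|//]]] hi /=; ring.
by rewrite /eig /= mulmxDl mxE rE.
Qed.

Let comp_sum s : comp s 0 ord0 + comp s 0 i1 + comp s 0 i2 = (size s).+1%:R.
Proof. by rewrite -sum3; exact: composition_sum. Qed.

Let comp_gt0 s i : 0 < comp s 0 i.
Proof. exact: composition_gt0. Qed.

Lemma eig_norm s : `|eig s| <= (size s).+1%:R.
Proof.
rewrite eigE -(comp_sum s) ler_norml.
have := comp_gt0 s ord0; have := comp_gt0 s i1; have := comp_gt0 s i2.
have := r11_lt1; have := r11_12; have := r22_gt0; have := r22_lt; have := r12_gt0.
move=> *; apply/andP; split; nra.
Qed.

Lemma step_xi s : \sum_i q s i * xi i = eig s / (size s).+1%:R.
Proof. by rewrite sum3 eigE /q /draw_prob /xi !mxE/= -/comp; ring. Qed.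

(** The coefficient of the first color in [step_xi2], after the count of the second color has been
    eliminated through [eig]. *)
Definition gamma : R := r12 * (r12 + r11 - r22).

Lemma gamma_gt0 : 0 < gamma.
Proof. by rewrite mulr_gt0//; have := r22_lt; have := r12_gt0; lra. Qed.

Lemma step_xi2 s : \sum_i q s i * xi i ^+ 2 =
  (gamma * comp s 0 ord0 - (r11 - r22) * eig s) / (size s).+1%:R.
Proof. by rewrite sum3 eigE /q /draw_prob /xi /gamma !mxE/= -/comp; ring. Qed.

Let g1 n := growth r11 n.
Let g2 n := growth r22 n.

Let g1_gt0 n : 0 < g1 n. Proof. by apply: growth_gt0; have := r22_gt0; have := r22_lt; lra. Qed.
Let g2_gt0 n : 0 < g2 n. Proof. exact/growth_gt0/ltW. Qed.
Let g2_ge1 n : 1 <= g2 n. Proof. exact/growth_ge1/ltW. Qed.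

Definition red_mart (s : seq 'I_3) : R := comp s 0 ord0 / g1 (size s).
Definition eig_mart (s : seq 'I_3) : R := eig s / g2 (size s).

Let delta0 (i : 'I_3) : R := (i == ord0)%:R.

Let red_cons i s : comp (i :: s) 0 ord0 = comp s 0 ord0 + r11 * delta0 i.
Proof.
rewrite /comp /= !mxE/=; congr (_ + _); rewrite /delta0.
by case: i => -[|[|[|//]]] hi /=; ring.
Qed.

Let red_diff i s : red_mart (i :: s) - red_mart s =
  r11 / g1 (size s).+1 * (delta0 i - q s ord0).
Proof.
rewrite /red_mart red_cons /q /draw_prob -/comp /= /g1 growthS -/(g1 _).
have h1 := g1_gt0 (size s); field.
rewrite !gt_eqF//=; rewrite addr_gt0//; have := r22_gt0; have := r22_lt; lra.
Qed.

Let eig_diff i s : eig_mart (i :: s) - eig_mart s =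
  r22 / g2 (size s).+1 * (xi i - eig s / (size s).+1%:R).
Proof.
rewrite /eig_mart eig_cons /= /g2 growthS -/(g2 _).
have h1 := g2_gt0 (size s); field.
by rewrite !gt_eqF//= addr_gt0.
Qed.

Let step_delta0 s : \sum_i q s i * delta0 i = q s ord0.
Proof. by rewrite sum3 /delta0/=; ring. Qed.

Lemma red_martP : step q red_mart =1 red_mart.
Proof.
move=> s; apply/eqP; rewrite -subr_eq0; apply/eqP.
transitivity (\sum_i q s i * (red_mart (i :: s) - red_mart s)).
  by under eq_bigr do rewrite mulrBr; rewrite sumrB -mulr_suml q_sum1 mul1r.
under eq_bigr do rewrite red_diff mulrCA mulrBr.
by rewrite -mulr_sumr sumrB -mulr_suml q_sum1 step_delta0 mul1r subrr mulr0.
Qed.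

Lemma eig_martP : step q eig_mart =1 eig_mart.
Proof.
move=> s; apply/eqP; rewrite -subr_eq0; apply/eqP.
transitivity (\sum_i q s i * (eig_mart (i :: s) - eig_mart s)).
  by under eq_bigr do rewrite mulrBr; rewrite sumrB -mulr_suml q_sum1 mul1r.
under eq_bigr do rewrite eig_diff mulrCA mulrBr.
by rewrite -mulr_sumr sumrB -mulr_suml q_sum1 step_xi mul1r subrr mulr0.
Qed.

Lemma eig_mart_diff s i : `|eig_mart (i :: s) - eig_mart s| <= 2.
Proof.
rewrite eig_diff normrM -[leRHS]mul1r; apply: ler_pM => //.
  rewrite ger0_norm ?divr_ge0 ?(ltW (g2_gt0 _)) ?(ltW r22_gt0)//.
  rewrite ler_pdivrMr// mul1r; apply: le_trans (g2_ge1 _).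
  by have := r22_lt; have := r11_lt1; lra.
apply: le_trans (ler_normB _ _) _; apply: (@le_trans _ _ (1 + 1)); last by lra.
apply: lerD.
  rewrite /xi !mxE ler_norml.
  have := r11_lt1; have := r11_12; have := r22_gt0; have := r22_lt; have := r12_gt0.
  by case: i => -[|[|[|//]]] hi /=; lra.
rewrite normrM [`|_^-1|]ger0_norm ?invr_ge0// ler_pdivrMr// mul1r.
exact: eig_norm.
Qed.

(** The martingale times a telescoping difference, so that the sum over all later draws has
    expectation at most [red_mart s / g1 (size s)]. It starts from the variance of the indicator of
    the first color. *)
Lemma red_cond_var s : cond_var q red_mart s <=
  red_mart s * ((g1 (size s))^-1 - (g1 (size s).+1)^-1).
Proof.
have r11_gt0 : 0 < r11 by have := r22_gt0; have := r22_lt; lra.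
rewrite /cond_var.
under eq_bigr do rewrite red_diff exprMn mulrCA.
rewrite -mulr_sumr.
have -> : \sum_i q s i * (delta0 i - q s ord0) ^+ 2 = q s ord0 - q s ord0 ^+ 2.
  have := q_sum1 s; rewrite !sum3 /delta0/= => e.
  have -> : q s i2 = 1 - q s ord0 - q s i1 by lra.
  by ring.
set n := size s.
have n0 : (0 : R) < n.+1%:R by [].
have -> : (g1 n)^-1 - (g1 n.+1)^-1 = r11 / (n.+1%:R * g1 n.+1).
  rewrite /g1 growthS -/(g1 _); have h1 := g1_gt0 n; field.
  by rewrite !gt_eqF//= addr_gt0.
apply: (@le_trans _ _ ((r11 / g1 n.+1) ^+ 2 * q s ord0)).
  by rewrite ler_wpM2l ?sqr_ge0// lerBlDr lerDl sqr_ge0.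
have -> : (r11 / g1 n.+1) ^+ 2 * q s ord0 =
    red_mart s * (r11 / (n.+1%:R * g1 n.+1)) * (r11 * (g1 n / g1 n.+1)).
  rewrite /red_mart /q /draw_prob -/comp -/n.
  have h1 := g1_gt0 n; have h2 := g1_gt0 n.+1; field.
  by rewrite !gt_eqF.
rewrite ler_piMr//.
  rewrite mulr_ge0 ?divr_ge0 ?mulr_ge0//; try exact: ltW.
rewrite -[leRHS]mul1r; apply: ler_pM; try exact: ltW.
  by rewrite divr_ge0//; exact: ltW.
by rewrite ler_pdivrMr// mul1r; apply: growth_le; exact: ltW.
Qed.

(* By [eig_cond_var] the conditional variance of the next increment of [eig_mart]
   is [uvar n * red_mart] up to the correction [rho], negligible by [eig_ratio_le]. *)
Definition uvar (n : nat) : R :=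
  r22 ^+ 2 * gamma * g1 n / (n.+1%:R * g2 n.+1 ^+ 2).

Lemma uvar_gt0 n : 0 < uvar n.
Proof.
rewrite /uvar; have := gamma_gt0 => g0.
by do ?[exact: g0|exact: r22_gt0|exact: g1_gt0|exact: g2_gt0|apply: divr_gt0|apply: mulr_gt0|apply: exprn_gt0].

Qed.

Definition rho s : R := (r11 - r22) / gamma * (eig s / g1 (size s)) +
  eig s ^+ 2 / (gamma * (size s).+1%:R * g1 (size s)).

Lemma eig_cond_var s : cond_var q eig_mart s = uvar (size s) * (red_mart s - rho s).
Proof.
rewrite /cond_var.
under eq_bigr do rewrite eig_diff exprMn mulrCA.
rewrite -mulr_sumr.
set n := size s; set y := eig s / n.+1%:R.
have -> : \sum_i q s i * (xi i - y) ^+ 2 =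
    \sum_i q s i * xi i ^+ 2 - 2 * y * (\sum_i q s i * xi i) + y ^+ 2 * \sum_i q s i.
  by rewrite !sum3; ring.
rewrite q_sum1 step_xi step_xi2 -/n -/y.
rewrite /uvar /rho /red_mart -/n /y.
have h1 := g1_gt0 n; have h2 := g2_gt0 n.+1; have h3 := gamma_gt0; field.
by rewrite !gt_eqF.
Qed.

(** The quadratic term of [rho] becomes linear through [eig_norm], and a first moment of [eig] then
    suffices. *)
Lemma rho_norm s : `|rho s| <= 2 / gamma * (`|eig s| / g1 (size s)).
Proof.
have h1 := g1_gt0 (size s); have h3 := gamma_gt0.
have c0' : 0 <= `|eig s| / g1 (size s) by rewrite divr_ge0//; exact: ltW.
have gi : 0 < gamma^-1 by rewrite invr_gt0.
apply: le_trans (ler_normD _ _) _.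
have e1 : `|(r11 - r22) / gamma * (eig s / g1 (size s))| <= gamma^-1 * (`|eig s| / g1 (size s)).
  rewrite !normrM !normfV (gtr0_norm h1) (gtr0_norm h3) ler_wpM2r// ler_piMl//; first exact: ltW.
  by rewrite ger0_norm; have := r22_lt; have := r11_lt1; have := r22_gt0; lra.
have e2 : `|eig s ^+ 2 / (gamma * (size s).+1%:R * g1 (size s))| <= gamma^-1 * (`|eig s| / g1 (size s)).
  rewrite ger0_norm; last by apply: divr_ge0; [exact: sqr_ge0|apply: mulr_ge0 (ltW h1); apply: mulr_ge0 (ltW h3) _].
  rewrite -(real_normK (num_real (eig s))).
  have -> : `|eig s| ^+ 2 / (gamma * (size s).+1%:R * g1 (size s)) =
     (`|eig s| / (size s).+1%:R) * (gamma^-1 * (`|eig s| / g1 (size s))).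
    by field; rewrite !gt_eqF.
  rewrite ler_piMl//; first by rewrite mulr_ge0//; exact: ltW.
  by rewrite ler_pdivrMr// mul1r eig_norm.
have -> : 2 / gamma * (`|eig s| / g1 (size s)) = gamma^-1 * (`|eig s| / g1 (size s)) +
  gamma^-1 * (`|eig s| / g1 (size s)) by ring.
exact: lerD.
Qed.


Let E n (g : seq 'I_3 -> R) := path_exp q n [::] g.

Lemma red_mart_ge0 s : 0 <= red_mart s.
Proof. by rewrite divr_ge0 ?ltW. Qed.

Lemma red_mart_nil : red_mart [::] <= 1.
Proof.
rewrite /red_mart /g1 /= growth0 divr1.
have := comp_sum [::]; have := comp_gt0 [::] ord0; have := comp_gt0 [::] i1.
have := comp_gt0 [::] i2; rewrite /comp/=; lra.
Qed.

Lemma expect_red_mart n : E n red_mart <= 1.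
Proof. rewrite /E path_exp_martingale//; [exact: red_mart_nil|exact: red_martP]. Qed.

Lemma sum_red_cond_var n s : \sum_(k < n) path_exp q k s (cond_var q red_mart) <=
  red_mart s / g1 (size s).
Proof.
suff : \sum_(k < n) path_exp q k s (cond_var q red_mart) <=
    red_mart s * ((g1 (size s))^-1 - (g1 (n + size s))^-1).
  move=> /le_trans; apply; rewrite ler_wpM2l ?red_mart_ge0// lerBlDr lerDl.
  by rewrite invr_ge0 ltW.
elim: n => [|n IH]; first by rewrite big_ord0 subrr mulr0.
rewrite big_ord_recr/=.
have h : path_exp q n s (cond_var q red_mart) <=
    red_mart s * ((g1 (n + size s))^-1 - (g1 (n + size s).+1)^-1).
  rewrite -[red_mart s](path_exp_martingale q_ge0 n s red_martP) mulrC -path_expZ//.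
  apply: path_exp_le => // u un; rewrite mulrC.
  by have := red_cond_var (u ++ s); rewrite size_cat un.
apply: le_trans (lerD IH h) _; rewrite -mulrDr ler_wpM2l ?red_mart_ge0//.
by rewrite addSn addrA subrK.
Qed.

Lemma red_mart_dev n s :
  path_exp q n s (fun s' => (red_mart s' - red_mart s) ^+ 2) <= red_mart s / g1 (size s).
Proof.
rewrite path_exp_sqr//; last exact: red_martP.
by rewrite subrr expr0n/= add0r sum_red_cond_var.
Qed.

Lemma expect_red_mart_sqr n : E n (fun s => red_mart s ^+ 2) <= 2.
Proof.
have -> : E n (fun s => red_mart s ^+ 2) = E n (fun s => (red_mart s - 0) ^+ 2).
  by apply: eq_path_exp => // u _; rewrite subr0.
rewrite /E path_exp_sqr ?subr0//; last exact: red_martP.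
have := sum_red_cond_var n [::]; rewrite /= /g1 growth0 divr1.
have := red_mart_nil; have := red_mart_ge0 [::]; nra.
Qed.

Definition var_const : R := 1 + gamma^-1.

(** Discarding the nonnegative square in [rho] leaves a linear combination of the two martingales,
    whose expectation is read off the initial composition. Both start within [-1, 1] and [c] is at
    most 1/gamma, whence [var_const]. *)
Lemma expect_eig_cond_var k : E k (cond_var q eig_mart) <= var_const * uvar k.
Proof.
have gi : 0 < gamma^-1 by rewrite invr_gt0 gamma_gt0.
pose c := (r11 - r22) / gamma * (g2 k / g1 k).
have c0' : 0 <= c <= gamma^-1.
  rewrite /c; apply/andP; split.
    apply: mulr_ge0; apply: divr_ge0; rewrite ?subr_ge0; try exact: ltW.
    exact/ltW/gamma_gt0.
  have : g2 k / g1 k <= 1.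
    rewrite ler_pdivrMr// mul1r; apply: growth_le_param; rewrite !ltW//.
  have : 0 <= g2 k / g1 k by rewrite divr_ge0// ltW.
  have : r11 - r22 <= 1 by have := r11_lt1; have := r22_gt0; lra.
  have : 0 <= r11 - r22 by rewrite subr_ge0 ltW.
  move=> a0 a1 b0 b1; rewrite mulrAC ler_piMl ?(ltW gi)//; nra.
have -> : var_const * uvar k = E k (fun=> uvar k * var_const).
  by rewrite /E path_exp_cst// mulrC.
apply: (@le_trans _ _ (E k (fun s => uvar k * (red_mart s - c * eig_mart s)))).
  apply: path_exp_le => // u uk; rewrite cats0 eig_cond_var uk.
  rewrite ler_wpM2l ?(ltW (uvar_gt0 _))// lerD2l lerN2 /rho uk.
  rewrite /c /eig_mart uk.
  have -> : (r11 - r22) / gamma * (g2 k / g1 k) * (eig u / g2 k) =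
      (r11 - r22) / gamma * (eig u / g1 k).
    have h1 := g1_gt0 k; have h2 := g2_gt0 k; have h3 := gamma_gt0; field.
    by rewrite !gt_eqF.
  rewrite lerDl; apply: divr_ge0; first exact: sqr_ge0.
  by apply: mulr_ge0 (ltW (g1_gt0 _)); apply: mulr_ge0 (ltW gamma_gt0) _.
rewrite /E !path_expZ// path_expB// path_expZ// path_exp_cst//.
rewrite !path_exp_martingale//; [|exact: eig_martP|exact: red_martP].
rewrite ler_wpM2l ?(ltW (uvar_gt0 _))// /var_const; apply: lerD.
  exact: red_mart_nil.
have : `|eig_mart [::]| <= 1.
  by rewrite /eig_mart /g2 growth0 divr1; exact: eig_norm.
rewrite ler_norml => /andP[e1 e2]; nra.
Qed.

Lemma expect_eig_mart_sqr n :
  E n (fun s => eig_mart s ^+ 2) <= 1 + var_const * \sum_(k < n) uvar k.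
Proof.
have -> : E n (fun s => eig_mart s ^+ 2) = E n (fun s => (eig_mart s - 0) ^+ 2).
  by apply: eq_path_exp => // u _; rewrite subr0.
rewrite /E path_exp_sqr ?subr0//; last exact: eig_martP.
apply: lerD.
  have : `|eig_mart [::]| <= 1.
    by rewrite /eig_mart /g2 growth0 divr1; exact: eig_norm.
  by rewrite -(real_normK (num_real (eig_mart _))) expr_le1.
by rewrite mulr_sumr; apply: ler_sum => k _; exact: expect_eig_cond_var.
Qed.

Definition eig_ratio (k : nat) : R := E k (fun s => `|eig s / g1 k|).

Lemma eig_ratio_le k (c : R) : 0 < c ->
  (g2 k / g1 k) ^+ 2 * (1 + var_const * \sum_(j < k) uvar j) <= c ^+ 2 ->
  eig_ratio k <= c.
Proof.
move=> c0' hc; apply: path_exp_norm_le => //; apply: le_trans hc.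
have -> : path_exp q k [::] (fun s => (eig s / g1 k) ^+ 2) =
    (g2 k / g1 k) ^+ 2 * E k (fun s => eig_mart s ^+ 2).
  rewrite -path_expZ//; apply: eq_path_exp => // u uk; rewrite cats0 /eig_mart uk.
  have h1 := g1_gt0 k; have h2 := g2_gt0 k; field.
  by rewrite !gt_eqF.
by rewrite ler_wpM2l ?sqr_ge0// expect_eig_mart_sqr.
Qed.

Lemma eig_ratio_ge0 k : 0 <= eig_ratio k.
Proof. by apply: path_exp_ge0 => //. Qed.

Lemma red_mart_dev1 m j :
  E m (fun s => path_exp q j s (fun s' => `|red_mart s' - red_mart s|)) <=
  (Num.sqrt (g1 m))^-1.
Proof.
(* The nested expectation becomes a single one over [m + j] draws, in which [drop j] recovers the
   first [m]; the Cauchy-Schwarz bound is then applied once. *)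
have cut (f : R -> R) : E m (fun s => path_exp q j s (fun s' => f (red_mart s' - red_mart s))) =
    E (m + j) (fun s' => f (red_mart s' - red_mart (drop j s'))).
  rewrite /E path_exp_cat; apply: eq_path_exp => // u um.
  by apply: eq_path_exp => // v vj; rewrite drop_size_cat.
rewrite (cut Num.norm); apply: path_exp_norm_le => //.
  by rewrite invr_gt0 sqrtr_gt0.
rewrite -[leLHS]/(E (m + j) (fun s' => (red_mart s' - red_mart (drop j s')) ^+ 2)).
rewrite -(cut (fun x => x ^+ 2)) exprVn sqr_sqrtr; last exact: ltW.
apply: (@le_trans _ _ (E m (fun s => (g1 m)^-1 * red_mart s))).
  apply: path_exp_le => // u um; rewrite cats0 mulrC.
  by have := red_mart_dev j u; rewrite um.
rewrite /E path_expZ//; rewrite -[leRHS]mulr1 ler_wpM2l ?invr_ge0 ?(ltW (g1_gt0 _))//.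
exact: expect_red_mart.
Qed.

(** The cost of freezing the variance after [m] draws: the first term is the later fluctuation of
    [red_mart], uniform in [j], the second comes from [rho]. *)
Lemma expect_var_dev m j :
  E m (fun s => path_exp q j s (fun s' =>
    `|cond_var q eig_mart s' - uvar (m + j) * red_mart s|)) <=
  uvar (m + j) * ((Num.sqrt (g1 m))^-1 + 2 / gamma * eig_ratio (m + j)).
Proof.
apply: (@le_trans _ _ (E m (fun s => path_exp q j s (fun s' =>
   uvar (m + j) * (`|red_mart s' - red_mart s| + 2 / gamma * `|eig s' / g1 (m + j)|))))).
  apply: path_exp_le => // u um; apply: path_exp_le => // v vj.
  rewrite cats0 eig_cond_var !size_cat um vj addnC -mulrBr.
  rewrite normrM (gtr0_norm (uvar_gt0 _)) ler_wpM2l ?(ltW (uvar_gt0 _))//.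
  rewrite addrAC; apply: le_trans (ler_normD _ _) _; rewrite normrN lerD2l.
  have := rho_norm (v ++ u); rewrite size_cat um vj addnC => /le_trans; apply.
  by rewrite normrM normfV (gtr0_norm (g1_gt0 _)).
have -> : E m (fun s => path_exp q j s (fun s' =>
   uvar (m + j) * (`|red_mart s' - red_mart s| + 2 / gamma * `|eig s' / g1 (m + j)|))) =
  uvar (m + j) * (E m (fun s => path_exp q j s (fun s' => `|red_mart s' - red_mart s|)) +
    2 / gamma * eig_ratio (m + j)).
  rewrite /E /eig_ratio /E path_exp_cat -path_expZ// -path_expD// -path_expZ//.
  apply: eq_path_exp => // u um; rewrite path_expZ// path_expD//.
  by rewrite !path_expZ.
rewrite ler_wpM2l ?(ltW (uvar_gt0 _))// lerD2r; exact: red_mart_dev1.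
Qed.

(** This crude bound turns the square of [uvar] in the exponential remainder into a multiple of
    [uvar], so that all errors are proportional to it. *)
Lemma uvar_le n : uvar n <= gamma.
Proof.
rewrite /uvar ler_pdivrMr ?mulr_gt0 ?exprn_gt0//.
have g0 := gamma_gt0.
have -> : r22 ^+ 2 * gamma * g1 n = gamma * (r22 ^+ 2 * g1 n) by ring.
rewrite ler_wpM2l ?(ltW g0)//.
have h1 : g1 n <= n.+1%:R by apply: growth_le_nat; have := r11_lt1; have := r22_gt0; have := r22_lt; lra.
have h2 : r22 ^+ 2 <= 1 by rewrite expr_le1// ?ltW//; have := r11_lt1; have := r22_lt; lra.
have h3 : 1 <= g2 n.+1 ^+ 2 by rewrite exprn_ege1.
have h4 := ltW (g1_gt0 n); have h5 := sqr_ge0 r22; nra.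
Qed.

(** For [a] of order [b] and sums of [uvar] of order [b ^- 2], the cubic and quartic terms disappear
    as [b] tends to 0, and the quadratic one keeps its square root. The 6 is the Taylor constant 3
    times the bound 2 on the increments; in the last term a factor 2 bounds the second moment of
    [red_mart]. *)
Definition clt_error (a : R) (m k : nat) : R :=
  a ^+ 2 / 2 * ((Num.sqrt (g1 m))^-1 + 2 / gamma * eig_ratio k) +
  6 * var_const * `|a| ^+ 3 + a ^+ 4 / 2 * gamma.

Lemma expect_cos_error (a : R) m j :
  E m (fun s => path_exp q j s (cos_error q eig_mart 2 a (uvar (m + j) * red_mart s))) <=
  uvar (m + j) * clt_error a m (m + j).
Proof.
set u := uvar (m + j).
have u0 : 0 < u := uvar_gt0 _.
have -> : E m (fun s => path_exp q j s (cos_error q eig_mart 2 a (u * red_mart s))) =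
   a ^+ 2 / 2 * E m (fun s => path_exp q j s (fun s' => `|cond_var q eig_mart s' - u * red_mart s|))
   + 3 * `|a| ^+ 3 * 2 * E (m + j) (cond_var q eig_mart)
   + (a ^+ 2 / 2 * u) ^+ 2 * E m (fun s => red_mart s ^+ 2).
  rewrite /E path_exp_cat -!path_expZ// -!path_expD//.
  apply: eq_path_exp => // v _; rewrite /cos_error !path_expD// path_exp_cst// !path_expZ//.
  by move: (red_mart _) => r; ring.
have a2 : 0 <= a ^+ 2 by exact: sqr_ge0.
have h1 := expect_var_dev m j; rewrite -/u in h1.
have h2 := expect_eig_cond_var (m + j); rewrite -/u in h2.
have h3 := expect_red_mart_sqr m.
have k1 : a ^+ 2 / 2 * E m (fun s => path_exp q j s (fun s' => `|cond_var q eig_mart s' - u * red_mart s|))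
  <= u * (a ^+ 2 / 2 * ((Num.sqrt (g1 m))^-1 + 2 / gamma * eig_ratio (m + j))).
  by rewrite [leRHS]mulrCA ler_wpM2l// divr_ge0.
have k2 : 3 * `|a| ^+ 3 * 2 * E (m + j) (cond_var q eig_mart) <= u * (6 * var_const * `|a| ^+ 3).
  have -> : u * (6 * var_const * `|a| ^+ 3) = 3 * `|a| ^+ 3 * 2 * (var_const * u) by ring.
  by rewrite ler_wpM2l// mulr_ge0// mulr_ge0// exprn_ge0.
have k3 : (a ^+ 2 / 2 * u) ^+ 2 * E m (fun s => red_mart s ^+ 2) <= u * (a ^+ 4 / 2 * gamma).
  apply: (@le_trans _ _ ((a ^+ 2 / 2 * u) ^+ 2 * 2)); first by rewrite ler_wpM2l ?sqr_ge0.
  have -> : (a ^+ 2 / 2 * u) ^+ 2 * 2 = u * (a ^+ 4 / 2 * u) by field.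
  rewrite ler_pM2l// ler_wpM2l ?uvar_le// divr_ge0//.
  by rewrite (_ : a ^+ 4 = (a ^+ 2) ^+ 2) ?sqr_ge0// -exprM.
rewrite /clt_error; lra.
Qed.

Lemma expect_cos_approx (a p : R) m n :
  `|E (m + n) (fun s => cos (a * eig_mart s + p)) -
    E m (fun s => cos (a * eig_mart s + p) *
      expR (- (a ^+ 2 / 2 * \sum_(k < n) uvar (m + k) * red_mart s)))| <=
  \sum_(k < n) uvar (m + k) * clt_error a m (m + k).
Proof.
rewrite /E path_exp_cat -path_expB//; apply: (le_trans (path_exp_norm q_ge0 _ _ _)).
apply: (@le_trans _ _ (E m (fun s => \sum_(k < n)
    path_exp q k s (cos_error q eig_mart 2 a (uvar (m + k) * red_mart s))))).
  apply: path_exp_le => // u _.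
  apply: (@path_exp_cos _ _ _ q_ge0 q_sum1 _ _ eig_martP eig_mart_diff a p n (u ++ [::])
    (fun k => uvar (m + k) * red_mart (u ++ [::]))) => k.
  by rewrite mulr_ge0 ?red_mart_ge0// ltW// uvar_gt0.
rewrite /E path_exp_bigsum//.
by apply: ler_sum => k _; exact: expect_cos_error.
Qed.

Lemma expect_eig_dev m n :
  E m (fun s => path_exp q n s (fun s' => (eig_mart s' - eig_mart s) ^+ 2)) <=
  var_const * \sum_(k < n) uvar (m + k).
Proof.
have -> : E m (fun s => path_exp q n s (fun s' => (eig_mart s' - eig_mart s) ^+ 2)) =
    \sum_(k < n) E (m + k) (cond_var q eig_mart).
  under [RHS]eq_bigr do rewrite /E path_exp_cat.
  rewrite -path_exp_bigsum//; apply: eq_path_exp => // u _.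
  by rewrite path_exp_sqr ?subrr ?expr0n ?add0r//; exact: eig_martP.
by rewrite mulr_sumr; apply: ler_sum => k _; exact: expect_eig_cond_var.
Qed.

Lemma expect_eig_maximal m n (e : R) : 0 < e ->
  E (m + n) (fun s => [exists j : 'I_n.+1,
    e <= `|eig_mart (drop j s) - eig_mart (drop n s)|]%:R) <=
  var_const * \sum_(k < n) uvar (m + k) / e ^+ 2.
Proof.
move=> e0; rewrite /E path_exp_cat.
apply: (@le_trans _ _ (E m (fun s => (e ^+ 2)^-1 *
    path_exp q n s (fun s' => (eig_mart s' - eig_mart s) ^+ 2)))).
  apply: path_exp_le => // v vm; rewrite cats0 mulrC.
  apply: le_trans (maximal_inequality q_ge0 q_sum1 n v (eig_mart v) eig_martP e0).
  by apply: path_exp_le => // w wn; rewrite [drop n _]drop_size_cat.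
rewrite /E path_expZ// mulrC -mulr_suml mulrA ler_pM2r ?invr_gt0 ?exprn_gt0//.
exact: expect_eig_dev.
Qed.

(** All first draws have positive probability, and the first two colors change [eig] by different
    amounts, since r12 > 0 > r22 - r11. *)
Lemma eig_cond_var_nil : 0 < cond_var q eig_mart [::].
Proof.
have q_gt0 i : 0 < q [::] i by rewrite divr_gt0.
suff [i ne] : exists i, eig_mart [:: i] != eig_mart [::].
  have sq : 0 < (eig_mart [:: i] - eig_mart [::]) ^+ 2.
    by rewrite exprn_even_gt0//= subr_eq0.
  rewrite /cond_var (bigD1 i)//= ltr_pwDl//; first exact: mulr_gt0.
  by apply: sumr_ge0 => k _; rewrite mulr_ge0// sqr_ge0.
have [e0|ne0] := eqVneq (eig_mart [:: ord0]) (eig_mart [::]); last by exists ord0.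
have g0 : (g2 1)^-1 != 0 by rewrite invr_eq0 gt_eqF.
have r0 : r22 != 0 by rewrite gt_eqF.
exists i1; rewrite -e0 /eig_mart /= (inj_eq (mulIf g0)).
rewrite !eig_cons (inj_eq (addrI _)) (inj_eq (mulfI r0)) /xi !mxE/=.
by rewrite lt_eqF//; have := r12_gt0; have := r22_lt; lra.
Qed.

(** Each [A * uvar k] is at most [r22 ^+ 2 * gamma] times the decrement of D = g1 / g2^2, a sequence
    of order k^(r11 - 2 r22) with D 0 = 1; the decrements telescope. *)
Lemma uvar_sum_supercritical n : r11 / 2 < r22 ->
  \sum_(k < n) uvar k <= r22 ^+ 2 * gamma / (2 * r22 - r11).
Proof.
move=> sup; set A := 2 * r22 - r11.
have A0 : 0 < A by rewrite /A; lra.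
pose D k := g1 k / g2 k ^+ 2.
have D0 k : 0 < D k by rewrite divr_gt0 ?exprn_gt0.
suff : A * \sum_(k < n) uvar k <= r22 ^+ 2 * gamma * (1 - D n).
  rewrite ler_pdivlMr// mulrC => /le_trans; apply.
  have c0' : 0 <= r22 ^+ 2 * gamma := mulr_ge0 (sqr_ge0 _) (ltW gamma_gt0).
  rewrite ler_piMr//.
  by rewrite lerBlDr lerDl ltW.
elim: n => [|n IH].
  by rewrite big_ord0 mulr0 /D /g1 /g2 !growth0 expr1n divr1 subrr mulr0.
rewrite big_ord_recr/= mulrDr.
have dE : r22 ^+ 2 * gamma * (D n - D n.+1) = uvar n * (A + r22 ^+ 2 / n.+1%:R).
  rewrite /D /uvar /g1 /g2 !growthS -/(g1 n) -/(g2 n) /A.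
  have h1 := g1_gt0 n; have h2 := g2_gt0 n.
  have h3 : 0 < 1 + r22 / n.+1%:R by rewrite addr_gt0// divr_gt0.
  have h4 : 0 < n.+1%:R + r22 by rewrite addr_gt0.
  by field; rewrite [1 + _]addrC natr1 !gt_eqF.
have : uvar n * A <= uvar n * (A + r22 ^+ 2 / n.+1%:R).
  by rewrite ler_pM2l ?uvar_gt0// lerDl divr_ge0// sqr_ge0.
rewrite -dE; lra.
Qed.

End three_color_urn.

Lemma path_exp_cvg (R : realType) (I : finType) (q : seq I -> I -> R) n s
    (g : nat -> seq I -> R) (h : seq I -> R) :
  (forall s, g k s @[k --> \oo] --> h s) ->
  path_exp q n s (g k) @[k --> \oo] --> path_exp q n s h.
Proof.
elim: n g h => [|n IH] g h gh /=; first exact: gh.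
apply: (IH (fun k => step q (g k))) => s'; rewrite /step.
apply: cvg_big => [|i _]; first exact: add_continuous.
by apply: cvgM; [exact: cvg_cst|exact: gh].
Qed.

Lemma sqr_cvg0 (R : realType) (f : nat -> R) :
  f n @[n --> \oo] --> 0 -> f n ^+ 2 @[n --> \oo] --> 0.
Proof. by move=> f0; rewrite -(mulr0 0); under eq_fun do rewrite expr2; exact: cvgM. Qed.

(** * Convergence of characteristic functions for an abstract normalisation [sn] *)

Section urn_clt.
Context {R : realType} (r11 r12 r13 r22 r23 : R) (c0 : 'rV[R]_3).
Let Rm := replacement_matrix r11 r12 r13 r22 r23.
Hypothesis c0_gt0 : forall i, 0 < c0 0 i.
Hypothesis c0_sum : \sum_i c0 0 i = 1.
Hypothesis R_ge0 : forall i j, 0 <= Rm i j.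
Hypothesis R_row : forall i, \sum_j Rm i j = 1.
Hypothesis r22_gt0 : 0 < r22.
Hypothesis r22_lt : r22 < r11.
Hypothesis r12_gt0 : 0 < r12.

Let q := draw_prob c0 Rm.
Let E n (g : seq 'I_3 -> R) := path_exp q n [::] g.
Let eigm := eig_mart r11 r12 r13 r22 r23 c0.
Let redm := red_mart r11 r12 r13 r22 r23 c0.
Let eigv := eig r11 r12 r13 r22 r23 c0.
Let u := uvar r11 r12 r22.
Let U n := \sum_(k < n) u k.
Let er := eig_ratio r11 r12 r13 r22 r23 c0.
Let K := var_const r11 r12 r22.
Let gam := gamma r11 r12 r22.

Let r11_lt1 : r11 < 1.
Proof. by have [] := first_row_bounds R_ge0 R_row r12_gt0. Qed.

Let q_ge0 : forall s i, 0 <= q s i.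
Proof. exact: draw_prob_ge0. Qed.

Let q_sum1 : forall s, \sum_i q s i = 1.
Proof. exact: draw_prob_sum1. Qed.

Let u_gt0 n : 0 < u n.
Proof. exact: uvar_gt0. Qed.

Let gam_gt0 : 0 < gam.
Proof. exact: gamma_gt0. Qed.

Let g1_gt0 n : 0 < growth r11 n.
Proof. by apply: growth_gt0; exact: ltW (lt_trans r22_gt0 r22_lt). Qed.

Let g2_gt0 n : 0 < growth r22 n.
Proof. by apply: growth_gt0; exact: ltW. Qed.

Variables (sn : nat -> R) (sigma : R).
Hypothesis sn_ge0 : forall n, 0 <= sn n.
Hypothesis sn_gt0 : \forall n \near \oo, 0 < sn n.
Let b n := growth r22 n / sn n.
Hypothesis b_cvg : b n @[n --> \oo] --> 0.
Hypothesis sn_cvg : sn n / growth r11 n @[n --> \oo] --> 0.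
Hypothesis bU_cvg : b n ^+ 2 * U n @[n --> \oo] --> sigma.

(** By its second moment the eigenvector statistic has order at most [sn n], which is negligible
    with respect to [growth r11 n]. *)
Let er_cvg : er n @[n --> \oo] --> 0.
Proof.
pose e n := (growth r22 n / growth r11 n) ^+ 2 * (1 + K * U n).
have ec : e n @[n --> \oo] --> 0.
  have h : (sn n / growth r11 n) ^+ 2 * (b n ^+ 2 + K * (b n ^+ 2 * U n)) @[n --> \oo] --> 0.
    rewrite -[X in _ --> X](mul0r (0 + K * sigma)).
    apply: cvgM; first exact: sqr_cvg0 sn_cvg.
    by apply: cvgD; [exact: sqr_cvg0 b_cvg|apply: cvgM; [exact: cvg_cst|exact: bU_cvg]].
  apply: cvg_trans h; apply: near_eq_cvg; near=> n.
  have s0 : 0 < sn n by near: n.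
  have h1 := g1_gt0 n; rewrite /e /b; field.
  by rewrite !gt_eqF.
apply/cvgrPdist_le => /= eps eps0.
have eps2 : 0 < eps ^+ 2 by rewrite exprn_gt0.
have /cvgrPdist_le/(_ _ eps2) := ec.
apply: filterS => n; rewrite !sub0r !normrN => h.
rewrite ger0_norm; last exact: eig_ratio_ge0.
apply: eig_ratio_le => //; apply: le_trans h; exact: ler_norm.
Unshelve. all: by end_near. Qed.

Let er_sum_cvg : b n ^+ 2 * \sum_(k < n) u k * er k @[n --> \oo] --> 0.
Proof.
have [B HB] : exists B, forall n, b n ^+ 2 * U n <= B.
  have /cvg_seq_bounded[M [_ HM]] : cvgn (fun n => b n ^+ 2 * U n).
    by apply/cvg_ex; exists sigma.
  exists (M + 1) => n; apply: le_trans (ler_norm _) _.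
  by apply: HM => //; rewrite ltrDl.
apply: (@toeplitz _ u er (fun n => b n ^+ 2) B) => //.
- by move=> n; exact: ltW.
- by move=> n; exact: sqr_ge0.
- exact: sqr_cvg0 b_cvg.
Qed.

Let clt_error_sum_cvg t m :
  \sum_(k < n) u k * clt_error r11 r12 r13 r22 r23 c0 (t * b n) m k @[n --> \oo] -->
  t ^+ 2 / 2 * (Num.sqrt (growth r11 m))^-1 * sigma.
Proof.
set d := (Num.sqrt (growth r11 m))^-1.
have -> : (fun n => \sum_(k < n) u k * clt_error r11 r12 r13 r22 r23 c0 (t * b n) m k) =
  (fun n => t ^+ 2 / 2 * d * (b n ^+ 2 * U n) +
    t ^+ 2 / gam * (b n ^+ 2 * \sum_(k < n) u k * er k) +
    (6 * K * `|t| ^+ 3 * b n + t ^+ 4 / 2 * gam * b n ^+ 2) * (b n ^+ 2 * U n)).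
  apply/funext => n; have b0 : 0 <= b n by rewrite divr_ge0// ltW.
  transitivity (\sum_(k < n) ((t ^+ 2 / 2 * d * b n ^+ 2) * u k +
      t ^+ 2 / gam * b n ^+ 2 * (u k * er k) +
      ((6 * K * `|t| ^+ 3 * b n + t ^+ 4 / 2 * gam * b n ^+ 2) * b n ^+ 2) * u k)).
    apply: eq_bigr => k _; rewrite /clt_error -/K -/gam -/er -/d normrM (ger0_norm b0).
    by field; rewrite gt_eqF.
  by rewrite !big_split/= -!mulr_sumr -/(U n); ring.
rewrite -[X in _ --> X]addr0 -[X in _ --> X + _]addr0.
apply: cvgD; first apply: cvgD.
- by apply: cvgM; [exact: cvg_cst|exact: bU_cvg].
- rewrite -[X in _ --> X](mulr0 (t ^+ 2 / gam)).
  by apply: cvgM; [exact: cvg_cst|exact: er_sum_cvg].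
- rewrite -[X in _ --> X](mul0r sigma); apply: cvgM; last exact: bU_cvg.
  rewrite -[X in _ --> X]addr0; apply: cvgD.
    rewrite -[X in _ --> X](mulr0 (6 * K * `|t| ^+ 3)).
    by apply: cvgM; [exact: cvg_cst|exact: b_cvg].
  rewrite -[X in _ --> X](mulr0 (t ^+ 4 / 2 * gam)).
  by apply: cvgM; [exact: cvg_cst|exact: sqr_cvg0 b_cvg].
Qed.

Let clt_error_ge0 a m k : 0 <= clt_error r11 r12 r13 r22 r23 c0 a m k.
Proof.
have K0 : 0 <= K by rewrite addr_ge0// invr_ge0 ltW.
have er0 : 0 <= er k by exact: eig_ratio_ge0.
rewrite /clt_error -/K -/er -/gam; apply: addr_ge0; first apply: addr_ge0.
- apply: mulr_ge0; first by rewrite divr_ge0 ?sqr_ge0.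
  by rewrite addr_ge0 ?invr_ge0 ?sqrtr_ge0// mulr_ge0// divr_ge0// ltW.
- by rewrite mulr_ge0 ?exprn_ge0// mulr_ge0.
- rewrite mulr_ge0 ?(ltW gam_gt0)// divr_ge0//.
  by rewrite (_ : a ^+ 4 = (a ^+ 2) ^+ 2) ?sqr_ge0// -exprM.
Qed.

(** Adding the nonnegative terms of index below [m] gives sums that start at 0, whose limit is given
    by [clt_error_sum_cvg]. *)
Let clt_error_tail a m n :
  \sum_(k < n) u (m + k) * clt_error r11 r12 r13 r22 r23 c0 a m (m + k) <=
  \sum_(k < (m + n)%N) u k * clt_error r11 r12 r13 r22 r23 c0 a m k.
Proof.
rewrite big_split_ord/= lerDr sumr_ge0// => k _.
by rewrite mulr_ge0 ?clt_error_ge0// ltW.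
Qed.

Let main_cvg t p m :
  E m (fun s => cos (t * b n * eigm s + p) *
    expR (- ((t * b n) ^+ 2 / 2 * ((U n - U m) * redm s)))) @[n --> \oo] -->
  E m (fun s => cos p * expR (- (t ^+ 2 / 2 * sigma * redm s))).
Proof.
apply: path_exp_cvg => s; apply: cvgM.
  suff h : t * b n * eigm s + p @[n --> \oo] --> p.
    by apply: (cvg_comp (fun n => t * b n * eigm s + p) cos h); exact: continuous_cos.
  rewrite -[X in _ --> X]add0r; apply: cvgD; last exact: cvg_cst.
  rewrite -[X in _ --> X](mul0r (eigm s)); apply: cvgM; last exact: cvg_cst.
  rewrite -[X in _ --> X](mulr0 t); apply: cvgM; [exact: cvg_cst|exact: b_cvg].
suff h : - ((t * b n) ^+ 2 / 2 * ((U n - U m) * redm s)) @[n --> \oo] -->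
    - (t ^+ 2 / 2 * sigma * redm s).
  by apply: (cvg_comp _ expR h); exact: continuous_expR.
have -> : (fun n => - ((t * b n) ^+ 2 / 2 * ((U n - U m) * redm s))) =
  (fun n => - (t ^+ 2 / 2 * (b n ^+ 2 * U n - b n ^+ 2 * U m) * redm s)).
  by apply/funext => n; field.
apply: cvgN; apply: cvgM; last exact: cvg_cst.
apply: cvgM; first exact: cvg_cst.
rewrite -[X in _ --> X]subr0; apply: cvgB; first exact: bU_cvg.
rewrite -[X in _ --> X](mul0r (U m)).
by apply: cvgM; [exact: sqr_cvg0 b_cvg|exact: cvg_cst].
Qed.

Lemma expect_cos_cvg t p (L : R) :
  E m (fun s => cos p * expR (- (t ^+ 2 / 2 * sigma * redm s))) @[m --> \oo] --> L ->
  E n (fun s => cos (t * (eigv s / sn n) + p)) @[n --> \oo] --> L.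
Proof.
move=> HL.
have sqrt_cvg : (Num.sqrt (growth r11 m))^-1 @[m --> \oo] --> 0.
  apply/cvgrPdist_le => /= e e0.
  have r0 : 0 < r11 := lt_trans r22_gt0 r22_lt.
  (* From this index on [growth_lb] makes the growth factor at least [e ^- 2]. *)
  exists (Num.truncn ((e ^- 2) `^ r11^-1)) => // m /= mN.
  rewrite sub0r normrN ger0_norm ?invr_ge0 ?sqrtr_ge0//.
  rewrite -[leRHS]invrK lef_pV2 ?posrE ?invr_gt0 ?sqrtr_gt0//.
  rewrite -(ger0_norm (ltW (_ : 0 < e^-1))) ?invr_gt0// -sqrtr_sqr ler_wsqrtr//.
  apply: le_trans (growth_lb m _); last by rewrite r0.
  have -> : e^-1 ^+ 2 = ((e ^- 2) `^ r11^-1) `^ r11.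
    by rewrite -powRrM mulVf ?gt_eqF// powRr1 ?exprVn// invr_ge0 exprn_ge0// ltW.
  apply: ge0_ler_powR; rewrite ?nnegrE ?powR_ge0//; first exact: ltW.
  by apply: le_trans (ltW (truncnS_gt _)) _; rewrite ler_nat ltnS.
apply/cvgrPdist_le => /= eps eps0.
have e4 : 0 < eps / 4 by rewrite divr_gt0.
have h1 : t ^+ 2 / 2 * (Num.sqrt (growth r11 m))^-1 * sigma @[m --> \oo] --> 0.
  rewrite -[X in _ --> X](mul0r sigma); apply: cvgM; last exact: cvg_cst.
  rewrite -[X in _ --> X](mulr0 (t ^+ 2 / 2)); apply: cvgM; first exact: cvg_cst.
  exact: sqrt_cvg.
have /cvgrPdist_le/(_ _ e4) h1' := h1.
have /cvgrPdist_le/(_ _ e4) HL' := HL.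
have [m [hm1 hm2]] : exists m, `|0 - t ^+ 2 / 2 * (Num.sqrt (growth r11 m))^-1 * sigma| <= eps / 4
   /\ `|L - E m (fun s => cos p * expR (- (t ^+ 2 / 2 * sigma * redm s)))| <= eps / 4.
  by have [m []] := filter_ex (filterI h1' HL'); exists m.
have /cvgrPdist_le/(_ _ e4) h2 := @main_cvg t p m.
have /cvgrPdist_le/(_ _ e4) h3 := @clt_error_sum_cvg t m.
near=> n.
have mn : (m <= n)%N by near: n; exact: nbhs_infty_ge.
have h2' : `|E m (fun s => cos p * expR (- (t ^+ 2 / 2 * sigma * redm s))) -
   E m (fun s => cos (t * b n * eigm s + p) *
    expR (- ((t * b n) ^+ 2 / 2 * ((U n - U m) * redm s))))| <= eps / 4 by near: n.
have h3' : `|t ^+ 2 / 2 * (Num.sqrt (growth r11 m))^-1 * sigma -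
  \sum_(k < n) u k * clt_error r11 r12 r13 r22 r23 c0 (t * b n) m k| <= eps / 4 by near: n.
have -> : E n (fun s => cos (t * (eigv s / sn n) + p)) =
    E n (fun s => cos (t * b n * eigm s + p)).
  apply: eq_path_exp => // v vn; rewrite cats0 /eigm /eig_mart vn -/eigv; congr (cos (_ + p)).
  by rewrite -mulrA; congr (t * _); rewrite /b [RHS]mulrC mulrA divfK ?gt_eqF.
have h4 := expect_cos_approx c0_gt0 c0_sum R_ge0 R_row r22_gt0 r22_lt r12_gt0 (t * b n) p m (n - m).
rewrite subnKC// in h4.
have h5 := le_trans h4 (clt_error_tail (t * b n) m (n - m)).
rewrite subnKC// in h5.
have h6 : E m (fun s => cos (t * b n * eigm s + p) *
      expR (- ((t * b n) ^+ 2 / 2 * \sum_(k < (n - m)%N) u (m + k) * redm s))) =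
   E m (fun s => cos (t * b n * eigm s + p) *
    expR (- ((t * b n) ^+ 2 / 2 * ((U n - U m) * redm s)))).
  apply: eq_path_exp => // v _; rewrite -mulr_suml.
  by rewrite /U -[in X in X - _](subnKC mn) big_split_ord/= addrAC subrr add0r.
have {}h5 : `|E n (fun s => cos (t * b n * eigm s + p)) -
    E m (fun s => cos (t * b n * eigm s + p) *
      expR (- ((t * b n) ^+ 2 / 2 * ((U n - U m) * redm s))))| <=
    \sum_(k < n) u k * clt_error r11 r12 r13 r22 r23 c0 (t * b n) m k.
  by rewrite -h6; exact: h5.
set x3 := E m (fun s => cos p * _) in h2' hm2.
set x2 := E m (fun s => cos (t * b n * eigm s + p) * _) in h2' h5.
set x1 := E n (fun s => cos (t * b n * eigm s + p)) in h5 *.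
set y := \sum_(k < n) _ in h3' h5; set z := t ^+ 2 / 2 * _ * _ in h3' hm1.
have t1 := ler_distD x3 L x1; have t2 := ler_distD x2 x3 x1.
rewrite distrC in h5; move: hm1 h3'; rewrite sub0r normrN.
have := ler_norm z; have := ler_norm (y - z); rewrite (distrC y).
lra.
Unshelve. all: by end_near. Qed.

End urn_clt.

Lemma mixture_characteristic (R : realType) d (T : measurableType d)
    (P : probability T R) (c : R) (V : {RV P >-> R}) (t p : R) :
  (\int[(P \x normal_prob 0 1)%E]_wz (cos (t * mixture_rv c V wz + p))%:E =
   \int[P]_w (cos p * expR (- ((t * Num.sqrt (c * V w)) ^+ 2 / 2)))%:E)%E.
Proof.
have mm := @measurable_mixture_rv _ _ _ P c V.
have mf : measurable_fun setT (fun wz => cos (t * mixture_rv c V wz + p)).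
  apply: (measurableT_comp (f := cos)).
    by apply: continuous_measurable_fun; exact: continuous_cos.
  by apply: measurable_funD => //; apply: measurable_funM.
have intf : (P \x normal_prob 0 1)%E.-integrable setT
    (EFin \o (fun wz => cos (t * mixture_rv c V wz + p))).
  apply: (@bounded_integrable _ _ _ (P \x normal_prob 0 1)%E _ 1) => //.
  by move=> x; exact: cos_max.
rewrite -(integral12_prod_meas1 intf); apply: eq_integral => w _.
rewrite /fubini_F /= /mixture_rv /=.
under eq_integral do rewrite mulrA.
by rewrite normal_characteristic mulrC.
Qed.

(** * From characteristic functions on paths to convergence in distribution *)

Section urn_convergence_in_distribution.
Context {R : realType} (r11 r12 r13 r22 r23 : R) (c0 : 'rV[R]_3).
Let Rm := replacement_matrix r11 r12 r13 r22 r23.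
Hypothesis c0_gt0 : forall i, 0 < c0 0 i.
Hypothesis c0_sum : \sum_i c0 0 i = 1.
Hypothesis R_ge0 : forall i j, 0 <= Rm i j.
Hypothesis R_row : forall i, \sum_j Rm i j = 1.
Hypothesis r22_gt0 : 0 < r22.
Hypothesis r22_lt : r22 < r11.
Hypothesis r12_gt0 : 0 < r12.
Context d (T : measurableType d) (P : probability T R).
Variables (draw : nat -> T -> 'I_3) (C : nat -> T -> 'rV[R]_3).
Hypothesis HC : urn_process P c0 Rm draw C.
Variable V1 : {RV P >-> R}.
Hypothesis HV1 : as_cvg P (fun n w => C n w 0 0 / n%:R `^ r11) V1.

Let eigv := eig r11 r12 r13 r22 r23 c0.
Let redm := red_mart r11 r12 r13 r22 r23 c0.
Let dr := draws draw.

Lemma eig_draws n w : (C n w *m xi2 r11 r12 r22) 0 0 = eigv (dr n w).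
Proof. by rewrite (compositionE HC). Qed.

Lemma red_mart_cvg (k : R) : 0 < k ->
  growth r11 n / n%:R `^ r11 @[n --> \oo] --> k ->
  {ae P, forall w, redm (dr n w) @[n --> \oo] --> V1 w / k}.
Proof.
move=> k0 gk; apply: filterS HV1 => w Hw.
have h : (C n w 0 0 / n%:R `^ r11) / (growth r11 n / n%:R `^ r11) @[n --> \oo] --> V1 w / k.
  by apply: cvgM => //; apply: cvgV => //; rewrite gt_eqF.
apply: cvg_trans h; apply: near_eq_cvg; near=> n.
have n0 : (0 < n)%N by near: n; exact: nbhs_infty_gt.
rewrite /redm /red_mart size_draws (compositionE HC) -/dr -/Rm.
have g0 : 0 < growth r11 n by apply: growth_gt0; exact: ltW (lt_trans r22_gt0 r22_lt).
have p0 : 0 < n%:R `^ r11 by rewrite powR_gt0// ltr0n.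
by field; rewrite !gt_eqF.
Unshelve. all: by end_near. Qed.

(** [Num.sqrt] is 0 on negative numbers, so the sign of V1 enters when the square of sqrt(c V1) is
    simplified. *)
Lemma V1_ge0 : {ae P, forall w, 0 <= V1 w}.
Proof.
apply: filterS HV1 => w Hw; rewrite -(cvg_lim _ Hw)//.
apply: limr_ge; first by apply/cvg_ex; eexists; exact: Hw.
apply: nearW => n; rewrite divr_ge0 ?powR_ge0// (compositionE HC) ltW//.
exact: composition_gt0.
Qed.

Variables (sn : nat -> R) (c k : R).
Hypothesis k_gt0 : 0 < k.
Hypothesis growth_k : growth r11 n / n%:R `^ r11 @[n --> \oo] --> k.
Hypothesis c_ge0 : 0 <= c.
Hypothesis sn_ge0 : forall n, 0 <= sn n.
Hypothesis sn_gt0 : \forall n \near \oo, 0 < sn n.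
Hypothesis b_cvg : growth r22 n / sn n @[n --> \oo] --> 0.
Hypothesis sn_cvg : sn n / growth r11 n @[n --> \oo] --> 0.
Hypothesis bU_cvg : (growth r22 n / sn n) ^+ 2 *
  \sum_(j < n) uvar r11 r12 r22 j @[n --> \oo] --> c * k.

(** The normalised variance tends to [c * k] while [red_mart] tends to [V1 / k], so the exponent
    involves exactly [c * V1]. *)
Lemma urn_cvg_in_distribution : cvg_in_distribution P
  (fun n w => (C n w *m xi2 r11 r12 r22) 0 0 / sn n) (normal_mixture c V1).
Proof.
have -> : (fun n w => (C n w *m xi2 r11 r12 r22) 0 0 / sn n) =
          (fun n w => eigv (dr n w) / sn n).
  by apply/funext => n; apply/funext => w; rewrite eig_draws.
apply: (@cvg_in_distribution_cos R d T P _ _ (P \x normal_prob 0 1)%E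
  (fun n w => eigv (dr n w) / sn n) (mixture_rv c V1)
  (* The limit of the second moment bound for the normalised statistic, plus 1 so that it holds
     eventually. *)
  (var_const r11 r12 r22 * (c * k) + 1)).
- move=> n; exact: (measurable_fun_draws HC n (fun s => eigv s / sn n)).
- exact: (@measurable_mixture_rv _ _ _ P c V1).
- move=> t p.
  rewrite /Rintegral mixture_characteristic.
  have intE n : (\int[P]_w (cos (t * (eigv (dr n w) / sn n) + p))%:E)%E =
      (path_exp (draw_prob c0 Rm) n [::] (fun s => cos (t * (eigv s / sn n) + p)))%:E.
    exact: (integral_draws HC n (fun s => cos (t * (eigv s / sn n) + p))).
  rewrite (_ : (fun n => _) = (fun n => path_exp (draw_prob c0 Rm) n [::]
      (fun s => cos (t * (eigv s / sn n) + p)))); last first.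
    by apply/funext => n; rewrite intE.
  apply: (expect_cos_cvg c0_gt0 c0_sum R_ge0 R_row r22_gt0 r22_lt r12_gt0 sn_ge0 sn_gt0
    b_cvg sn_cvg bU_cvg).
  pose g m w := cos p * expR (- (t ^+ 2 / 2 * (c * k) * redm (dr m w))).
  have redE m : (\int[P]_w (g m w)%:E)%E = (path_exp (draw_prob c0 Rm) m [::]
      (fun s => cos p * expR (- (t ^+ 2 / 2 * (c * k) * redm s))))%:E.
    exact: (integral_draws HC m (fun s => cos p * expR (- (t ^+ 2 / 2 * (c * k) * redm s)))).
  rewrite (_ : (fun m => _) = (fun m => fine (\int[P]_w (g m w)%:E)%E)); last first.
    by apply/funext => m; rewrite redE.
  have mlim : measurable_fun setT (fun w => cos p * expR (- ((t * Num.sqrt (c * V1 w)) ^+ 2 / 2))).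
    apply: measurable_funM => //; apply: measurableT_comp => //.
    apply: measurableT_comp => //; apply: measurable_funM => //.
    apply: measurable_funX; apply: measurable_funM => //.
    apply: (@measurableT_comp _ _ _ _ _ _ (@Num.sqrt R)) => /=.
      by apply: continuous_measurable_fun; exact: sqrt_continuous.
    by apply: measurable_funM.
  have exp_bound (x : R) : 0 <= x -> `|cos p * expR (- x)| <= 1.
    move=> x0; rewrite normrM -[leRHS]mul1r; apply: ler_pM => //; first exact: cos_max.
    by rewrite ger0_norm ?expR_ge0// -expR0 ler_expR oppr_le0.
  apply: fine_cvg; rewrite fineK; last first.
    apply: integrable_fin_num => //.
    apply: (@bounded_integrable _ _ _ P _ 1) => // w; apply: exp_bound.
    by rewrite divr_ge0 ?sqr_ge0.
  have [] := @dominated_convergence _ _ _ P setT measurableT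
    (fun m w => (g m w)%:E)
    (fun w => (cos p * expR (- ((t * Num.sqrt (c * V1 w)) ^+ 2 / 2)))%:E) (cst 1%E) => //.
  + move=> m; apply/measurable_EFinP.
    exact: (measurable_fun_draws HC m (fun s => cos p * expR (- (t ^+ 2 / 2 * (c * k) * redm s)))).
  + exact/measurable_EFinP.
  + apply: filterS2 (red_mart_cvg k_gt0 growth_k) V1_ge0 => w Hw V0 _.
    apply: cvg_EFin; first exact: nearW.
    rewrite /g; apply: cvgM; first exact: cvg_cst.
    have h : - (t ^+ 2 / 2 * (c * k) * redm (dr m w)) @[m --> \oo] -->
        - ((t * Num.sqrt (c * V1 w)) ^+ 2 / 2).
      rewrite exprMn sqr_sqrtr; last exact: mulr_ge0.
      have -> : t ^+ 2 * (c * V1 w) / 2 = t ^+ 2 / 2 * (c * k) * (V1 w / k).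
        by field; rewrite gt_eqF.
      by apply: cvgN; apply: cvgM => //; exact: cvg_cst.
    by apply: (cvg_comp _ expR h); exact: continuous_expR.
  + exact: finite_measure_integrable_cst.
  + apply: aeW => w m _; rewrite lee_fin; apply: exp_bound.
    apply: mulr_ge0; last exact: red_mart_ge0.
    by apply: mulr_ge0; [rewrite divr_ge0 ?sqr_ge0|rewrite mulr_ge0// ltW].
- have intE n : (\int[P]_w ((eigv (dr n w) / sn n) ^+ 2)%:E)%E =
      (path_exp (draw_prob c0 Rm) n [::] (fun s => (eigv s / sn n) ^+ 2))%:E.
    exact: (integral_draws HC n (fun s => (eigv s / sn n) ^+ 2)).
  have lim : (growth r22 n / sn n) ^+ 2 + var_const r11 r12 r22 *
      ((growth r22 n / sn n) ^+ 2 * \sum_(j < n) uvar r11 r12 r22 j) @[n --> \oo] -->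
      0 + var_const r11 r12 r22 * (c * k).
    by apply: cvgD; [exact: sqr_cvg0|apply: cvgM => //; exact: cvg_cst].
  have /cvgrPdist_le/(_ _ ltr01) := lim.
  apply: filterS => n; rewrite add0r distrC => hn; rewrite intE lee_fin.
  have g0 : 0 < growth r22 n by apply: growth_gt0; exact: ltW.
  have -> : path_exp (draw_prob c0 Rm) n [::] (fun s => (eigv s / sn n) ^+ 2) =
      (growth r22 n / sn n) ^+ 2 * path_exp (draw_prob c0 Rm) n [::]
        (fun s => eig_mart r11 r12 r13 r22 r23 c0 s ^+ 2).
    have q0 := draw_prob_ge0 c0_gt0 R_ge0.
    rewrite -path_expZ//; apply: eq_path_exp => // v vn.
    rewrite cats0 /eig_mart vn -exprMn; congr (_ ^+ 2).
    by rewrite [RHS]mulrC mulrA divfK ?gt_eqF.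
  have h := expect_eig_mart_sqr c0_gt0 c0_sum R_ge0 R_row r22_gt0 r22_lt r12_gt0 n.
  apply: le_trans (ler_wpM2l (sqr_ge0 _) h) _.
  have := le_trans (ler_norm _) hn; lra.
Qed.

End urn_convergence_in_distribution.

(** * Powers, logarithms, harmonic sums and weighted averages *)

Section normalisations.
Context {R : realType}.
Implicit Types (x : R) (f l e b : nat -> R).

Lemma cvg_sqr f (a : R) : f n @[n --> \oo] --> a -> f n ^+ 2 @[n --> \oo] --> a ^+ 2.
Proof. by move=> fa; under eq_fun do rewrite expr2; rewrite expr2; exact: cvgM. Qed.

Lemma cvg0_sqr f : f n ^+ 2 @[n --> \oo] --> 0 -> f n @[n --> \oo] --> 0.
Proof.
move=> f2; apply/cvgrPdist_le => /= e e0.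
have e2 : 0 < e ^+ 2 by rewrite exprn_gt0.
have /cvgrPdist_le/(_ _ e2) := f2; apply: filterS => n.
rewrite !sub0r !normrN normrX => h.
by rewrite -(@ler_pXn2r _ 2) ?nnegrE// ltW.
Qed.

Lemma powRN_cvg0 x : 0 < x -> n%:R `^ (- x) @[n --> \oo] --> 0.
Proof.
move=> x0; apply/cvgrPdist_le => /= e e0.
exists (Num.truncn ((e^-1) `^ x^-1)).+1 => // n /= nN.
have n0 : (0 : R) < n%:R by rewrite ltr0n; case: n nN.
rewrite sub0r normrN ger0_norm ?powR_ge0// powRN.
rewrite -[leRHS]invrK lef_pV2 ?posrE ?invr_gt0 ?powR_gt0//.
have -> : e^-1 = ((e^-1) `^ x^-1) `^ x.
  by rewrite -powRrM mulVf ?gt_eqF// powRr1// invr_ge0 ltW.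
apply: ge0_ler_powR; rewrite ?nnegrE ?powR_ge0//; first exact: ltW.
by apply: le_trans (ltW (truncnS_gt _)) _; rewrite ler_nat.
Qed.

(** [toeplitz] applied to [e - rho]; [l] is meant as a comparison sequence with known sums, and [e]
    as the ratio to it. *)
Lemma weighted_sum_cvg l e b (tau rho : R) : (forall n, 0 <= l n) ->
  (forall n, 0 <= b n) -> b n @[n --> \oo] --> 0 ->
  b n * \sum_(k < n) l k @[n --> \oo] --> tau -> e n @[n --> \oo] --> rho ->
  b n * \sum_(k < n) l k * e k @[n --> \oo] --> tau * rho.
Proof.
move=> l0 b0 bc blc ec.
have [B HB] : exists B, forall n, b n * \sum_(k < n) l k <= B.
  have /cvg_seq_bounded[M [_ HM]] : cvgn (fun n => b n * \sum_(k < n) l k).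
    by apply/cvg_ex; exists tau.
  exists (M + 1) => n; apply: le_trans (ler_norm _) _.
  by apply: HM => //; rewrite ltrDl.
have e0 : e n - rho @[n --> \oo] --> 0.
  by rewrite -[X in _ --> X](subrr rho); apply: cvgB => //; exact: cvg_cst.
have h := @toeplitz _ l (fun n => e n - rho) b B l0 b0 bc HB e0.
rewrite -[X in _ --> X]add0r.
have -> : (fun n => b n * \sum_(k < n) l k * e k) =
  (fun n => b n * \sum_(k < n) l k * (e k - rho) + (b n * \sum_(k < n) l k) * rho).
  apply/funext => n; rewrite -mulrA -mulrDr mulr_suml -big_split/=.
  by congr (_ * _); apply: eq_bigr => k _; ring.
by apply: cvgD => //; apply: cvgM => //; exact: cvg_cst.
Qed.

Lemma ln_nat_cvg : (ln n%:R)^-1 @[n --> \oo] --> (0 : R).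
Proof.
apply/cvgrPdist_le => /= e e0.
exists (Num.truncn (expR e^-1)).+1 => // n /= nN.
have n0 : (0 : R) < n%:R by rewrite ltr0n; case: n nN.
have h : e^-1 <= ln n%:R.
  rewrite -ler_expR lnK ?posrE//.
  by apply: le_trans (ltW (truncnS_gt _)) _; rewrite ler_nat.
have h0 : 0 < e^-1 by rewrite invr_gt0.
rewrite sub0r normrN ger0_norm ?invr_ge0 ?(le_trans (ltW h0))//.
by rewrite -[leRHS]invrK lef_pV2 ?posrE// (lt_le_trans h0).
Qed.

Let H n : R := \sum_(k < n) k.+1%:R^-1.

Lemma ln_le_harmonic n : ln n.+1%:R <= H n.
Proof.
elim: n => [|n IH]; first by rewrite /H big_ord0 ln1.
rewrite /H big_ord_recr/= -/(H n).
have -> : n.+2%:R = n.+1%:R * (1 + n.+1%:R^-1) :> R.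
  by rewrite mulrDr mulr1 mulfV ?gt_eqF// natr1.
rewrite lnM ?posrE// ?addr_gt0 ?invr_gt0//; apply: lerD => //.
by apply: le_ln1Dx; rewrite (lt_trans (ltrN10 _))// invr_gt0.
Qed.

Lemma harmonic_le_ln n : H n.+1 <= 1 + ln n.+1%:R.
Proof.
elim: n => [|n IH]; first by rewrite /H big_ord_recl big_ord0 invr1 addr0 ln1 addr0.
rewrite /H big_ord_recr/= -/(H n.+1).
have n2 : (0 : R) < n.+2%:R by [].
have q1 : (n.+2%:R : R)^-1 < 1 by rewrite invf_lt1// ltr1n.
have e : n.+1%:R = n.+2%:R * (1 + - n.+2%:R^-1) :> R.
  by rewrite mulrBr mulr1 mulfV ?gt_eqF// -[n.+2%:R]natr1 addrK.
have : ln (n.+1%:R : R) <= ln n.+2%:R - n.+2%:R^-1.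
  rewrite e lnM ?posrE ?subr_gt0// lerD2l; apply: le_ln1Dx.
  by rewrite ltrN2.
by move=> h; apply: le_trans (lerD IH (lexx _)) _; rewrite -addrA lerD2l -lerBrDr.
Qed.

Lemma harmonic_div_ln_cvg : (ln n%:R)^-1 * H n @[n --> \oo] --> (1 : R).
Proof.
have ub : 1 + (ln n%:R)^-1 @[n --> \oo] --> (1 : R).
  rewrite -[X in _ --> X]addr0; apply: cvgD; [exact: cvg_cst|exact: ln_nat_cvg].
apply: (@squeeze_cvgr _ _ _ _ (cst 1) _ _ _ _ _ ub).
- exists 2%N => // n /= n2.
  have l0 : 0 < ln (n%:R : R) by rewrite ln_gt0// ltr1n.
  rewrite mulrC ler_pdivlMr// mul1r ler_pdivrMr// mulrDl mul1r mulVf ?gt_eqF//.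
  apply/andP; split.
    apply: le_trans (ln_le_harmonic n); rewrite ler_ln ?posrE ?ltr0n ?ler_nat//.
    by apply: ltn_trans n2.
  by case: n n2 l0 => // n _ _; rewrite addrC; exact: harmonic_le_ln.
- exact: cvg_cst.
Qed.

(** From ln y < y at y = n^(x/2) one gets ln n <= (2/x) n^(x/2). *)
Lemma ln_div_powR_cvg x : 0 < x -> ln n%:R / n%:R `^ x @[n --> \oo] --> 0.
Proof.
move=> x0; have x2 : 0 < x / 2 by rewrite divr_gt0.
have ub : 2 / x * n%:R `^ (- (x / 2)) @[n --> \oo] --> 0.
  rewrite -[X in _ --> X](mulr0 (2 / x)).
  by apply: cvgM; [exact: cvg_cst|exact: powRN_cvg0].
apply: (@squeeze_cvgr _ _ _ _ (cst 0) _ _ _ _ _ ub).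
- exists 1%N => // n /= n1.
  have n0 : (0 : R) < n%:R by rewrite ltr0n.
  have p0 : 0 < n%:R `^ (x / 2) by exact: powR_gt0.
  rewrite divr_ge0 ?powR_ge0 ?ln_ge0 ?ler1n//= ler_pdivrMr ?powR_gt0//.
  have -> : n%:R `^ x = n%:R `^ (x / 2) * n%:R `^ (x / 2).
    by rewrite -powRD ?gt_eqF ?implybT// -splitr.
  rewrite powRN -(mulrA (2 / x)) mulKf ?gt_eqF//.
  have := ln_sublinear p0; rewrite ln_powR => h.
  have -> : ln n%:R = 2 / x * (x / 2 * ln n%:R) :> R by field; rewrite gt_eqF.
  by rewrite ler_pM2l ?divr_gt0// ltW.
- exact: cvg_cst.
Qed.

(** The increments of [growth x] are [x] times the summands. This provides a comparison sequence of
    order n^(x-1) with an explicit sum. *)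
Lemma growth_sum x n : x != 0 ->
  \sum_(k < n) growth x k / k.+1%:R = (growth x n - 1) / x.
Proof.
move=> x0; elim: n => [|n IH]; first by rewrite big_ord0 growth0 subrr mul0r.
by rewrite big_ord_recr/= IH growthS; field; rewrite x0 addrC natr1 pnatr_eq0.
Qed.

End normalisations.

(** * Asymptotics of the sums of conditional variances *)

Section urn_normalisations.
Context {R : realType} (r11 r12 r22 : R).
Hypothesis r11_lt1 : r11 < 1.
Hypothesis r22_gt0 : 0 < r22.
Hypothesis r22_lt : r22 < r11.
Hypothesis r12_gt0 : 0 < r12.
Let u := uvar r11 r12 r22.
Let gam := gamma r11 r12 r22.
Let g1 := @growth R r11.
Let g2 := @growth R r22.
Variables (k1 k2 : R).
Hypothesis k1_gt0 : 0 < k1.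
Hypothesis k2_gt0 : 0 < k2.
Hypothesis g1_cvg : g1 n / n%:R `^ r11 @[n --> \oo] --> k1.
Hypothesis g2_cvg : g2 n / n%:R `^ r22 @[n --> \oo] --> k2.

Let r11_gt0 : 0 < r11. Proof. exact: lt_trans r22_lt. Qed.
Let g1_gt0 n : 0 < g1 n. Proof. exact/growth_gt0/ltW. Qed.
Let g2_gt0 n : 0 < g2 n. Proof. exact/growth_gt0/ltW. Qed.
Let p_gt0 n x : (0 < n)%N -> (0 : R) < n%:R `^ x.
Proof. by move=> n0; rewrite powR_gt0// ltr0n. Qed.

Let gamE : r12 * r22 ^+ 2 * (r12 + r11 - r22) = r22 ^+ 2 * gam.
Proof. by rewrite /gam /gamma; ring. Qed.

Let step_cvg : (1 + r22 / n.+1%:R) ^- 2 @[n --> \oo] --> (1 : R).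
Proof.
have h : 1 + r22 / n.+1%:R @[n --> \oo] --> (1 : R).
  rewrite -[X in _ --> X]addr0; apply: cvgD; first exact: cvg_cst.
  rewrite -[X in _ --> X](mulr0 r22); apply: cvgM; first exact: cvg_cst.
  exact: cvg_harmonic.
have h2 : (1 + r22 / n.+1%:R)^-1 @[n --> \oo] --> (1 : R).
  by rewrite -[X in _ --> X]invr1; apply: cvgV; rewrite ?oner_eq0.
rewrite (_ : (fun n => _) = (fun n : nat => (1 + r22 / n.+1%:R)^-1 ^+ 2)).
  by rewrite -[X in _ --> X](expr1n R 2); exact: cvg_sqr.
by apply/funext => n; rewrite exprVn.
Qed.

Lemma uvar_sum_subcritical : r22 < r11 / 2 ->
  (g2 n / Num.sqrt (n%:R `^ r11)) ^+ 2 * \sum_(j < n) u j @[n --> \oo] -->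
  r12 * r22 ^+ 2 * (r12 + r11 - r22) / (r11 - 2 * r22) * k1.
Proof.
move=> sub; set A := r11 - 2 * r22.
have A0 : 0 < A by rewrite /A; lra.
have A1 : A < 1 by rewrite /A; have := r11_lt1; have := r22_gt0; lra.
have [|kA kA0 gA] := @growth_cvg R A; first by rewrite A0.
have gA0 n : 0 < growth A n by apply: growth_gt0; exact: ltW.
(* Of the same order n^(A-1) as [u], but summed exactly by [growth_sum], which produces the
   denominator [A] of the limit variance. *)
pose l n := growth A n / n.+1%:R.
pose e n := u n / l n.
have -> : (fun n => (g2 n / Num.sqrt (n%:R `^ r11)) ^+ 2 * \sum_(j < n) u j) =
  (fun n => (g2 n / Num.sqrt (n%:R `^ r11)) ^+ 2 * \sum_(j < n) l j * e j).
  apply/funext => n; congr (_ * _); apply: eq_bigr => j _.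
  by rewrite /e mulrC divfK// gt_eqF// divr_gt0.
have bE n : (0 < n)%N -> (g2 n / Num.sqrt (n%:R `^ r11)) ^+ 2 =
    (g2 n / n%:R `^ r22) ^+ 2 * n%:R `^ (- A).
  move=> n0; have n1 : n%:R != 0 :> R by rewrite pnatr_eq0 -lt0n.
  have -> : - A = r22 + r22 - r11 by rewrite /A; ring.
  rewrite powRB ?n1 ?implybT// powRD ?n1 ?implybT// !exprMn exprVn sqr_sqrtr ?powR_ge0//.
  by field; rewrite !gt_eqF ?p_gt0.
have eE n : (0 < n)%N -> e n = r22 ^+ 2 * gam * (g1 n / n%:R `^ r11) *
    (g2 n / n%:R `^ r22) ^- 2 * (growth A n / n%:R `^ A)^-1 * (1 + r22 / n.+1%:R) ^- 2.
  move=> n0; have n1 : n%:R != 0 :> R by rewrite pnatr_eq0 -lt0n.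
  rewrite /e /l /u /uvar -/gam -/(g1 n) -/(g2 _) /g2 growthS -/(g2 n).
  have -> : r11 = (r22 + r22) + A by rewrite /A; ring.
  rewrite powRD ?n1 ?implybT// powRD ?n1 ?implybT//.
  have q0 : 0 < 1 + r22 / n.+1%:R by rewrite addr_gt0// divr_gt0.
  set Q := 1 + r22 / _ in q0 *; set N := n.+1%:R.
  have N0 : 0 < N :> R by [].
  have := gA0 n; have := g2_gt0 n; have := p_gt0 r22 n0; have := p_gt0 A n0.
  move=> a1 a2 a3 a4; rewrite -/(g1 _); field.
  by rewrite !gt_eqF.
(* The constants [k2] and [kA] cancel; [k1] stays, to be absorbed by the limit of [red_mart]. *)
have -> : r12 * r22 ^+ 2 * (r12 + r11 - r22) / A * k1 =
   k2 ^+ 2 * (kA / A) * (r22 ^+ 2 * gam * k1 * k2 ^- 2 * kA^-1 * 1).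
  by rewrite gamE; field; rewrite !gt_eqF.
apply: weighted_sum_cvg.
- by move=> n; rewrite divr_ge0// ltW.
- by move=> n; exact: sqr_ge0.
- have h : (g2 n / n%:R `^ r22) ^+ 2 * n%:R `^ (- A) @[n --> \oo] --> 0.
    rewrite -[X in _ --> X](mulr0 (k2 ^+ 2)).
    by apply: cvgM; [exact: cvg_sqr|exact: powRN_cvg0].
  apply: cvg_trans h; apply: near_eq_cvg; near=> n.
  by rewrite bE//; near: n; exact: nbhs_infty_gt.
- have h : (g2 n / n%:R `^ r22) ^+ 2 * ((growth A n / n%:R `^ A - n%:R `^ (- A)) / A) @[n --> \oo]
      --> k2 ^+ 2 * (kA / A).
    apply: cvgM; first exact: cvg_sqr.
    apply: cvgM; last exact: cvg_cst.
    by rewrite -[X in _ --> X]subr0; apply: cvgB => //; exact: powRN_cvg0.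
  apply: cvg_trans h; apply: near_eq_cvg; near=> n.
  have n0 : (0 < n)%N by near: n; exact: nbhs_infty_gt.
  rewrite bE// growth_sum ?gt_eqF// powRN.
  by field; rewrite !gt_eqF ?p_gt0.
- have h : r22 ^+ 2 * gam * (g1 n / n%:R `^ r11) *
    (g2 n / n%:R `^ r22) ^- 2 * (growth A n / n%:R `^ A)^-1 * (1 + r22 / n.+1%:R) ^- 2 @[n --> \oo]
      --> r22 ^+ 2 * gam * k1 * k2 ^- 2 * kA^-1 * 1.
    apply: cvgM; last exact: step_cvg.
    apply: cvgM; last by apply: cvgV; rewrite ?gt_eqF.
    apply: cvgM; last by apply: cvgV; [rewrite gt_eqF// exprn_gt0|exact: cvg_sqr].
    by apply: cvgM => //; exact: cvg_cst.
  apply: cvg_trans h; apply: near_eq_cvg; near=> n.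
  by rewrite eE//; near: n; exact: nbhs_infty_gt.
Unshelve. all: by end_near. Qed.

(** At the critical value [u] is comparable to 1/(n+1), whose sums grow like log n; hence the
    logarithm in the normalisation. *)
Lemma uvar_sum_critical : r22 = r11 / 2 ->
  (g2 n / Num.sqrt (n%:R `^ r11 * ln n%:R)) ^+ 2 * \sum_(j < n) u j @[n --> \oo] -->
  r12 * r22 ^+ 2 * (r12 + r11 - r22) * k1.
Proof.
move=> crit; pose l (n : nat) : R := n.+1%:R^-1.
pose e n := u n / l n.
have -> : (fun n => (g2 n / Num.sqrt (n%:R `^ r11 * ln n%:R)) ^+ 2 * \sum_(j < n) u j) =
  (fun n => (g2 n / Num.sqrt (n%:R `^ r11 * ln n%:R)) ^+ 2 * \sum_(j < n) l j * e j).
  apply/funext => n; congr (_ * _); apply: eq_bigr => j _.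
  by rewrite /e mulrC divfK// gt_eqF// invr_gt0.
have r11E : r11 = r22 + r22 by lra.
have bE n : (0 < n)%N -> (g2 n / Num.sqrt (n%:R `^ r11 * ln n%:R)) ^+ 2 =
    (g2 n / n%:R `^ r22) ^+ 2 * (ln n%:R)^-1.
  move=> n0; have n1 : n%:R != 0 :> R by rewrite pnatr_eq0 -lt0n.
  have ln0 : 0 <= ln (n%:R : R) by rewrite ln_ge0// ler1n.
  rewrite [LHS]exprMn exprVn sqr_sqrtr ?mulr_ge0 ?powR_ge0//.
  rewrite r11E powRD ?n1 ?implybT// -expr2 invfM mulrA -exprVn -exprMn.
  by [].
have eE n : (0 < n)%N -> e n = r22 ^+ 2 * gam * (g1 n / n%:R `^ r11) *
    (g2 n / n%:R `^ r22) ^- 2 * (1 + r22 / n.+1%:R) ^- 2.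
  move=> n0; have n1 : n%:R != 0 :> R by rewrite pnatr_eq0 -lt0n.
  rewrite /e /l /u /uvar -/gam -/(g1 n) -/(g2 _) /g2 growthS -/(g2 n).
  rewrite r11E powRD ?n1 ?implybT//.
  have q0 : 0 < 1 + r22 / n.+1%:R by rewrite addr_gt0// divr_gt0.
  set Q := 1 + r22 / _ in q0 *; set N := n.+1%:R.
  have N0 : 0 < N :> R by [].
  have := g2_gt0 n; have := p_gt0 r22 n0.
  move=> a2 a3; rewrite -/(g1 _); field.
  by rewrite !gt_eqF.
have -> : r12 * r22 ^+ 2 * (r12 + r11 - r22) * k1 =
   k2 ^+ 2 * 1 * (r22 ^+ 2 * gam * k1 * k2 ^- 2 * 1).
  by rewrite gamE; field; rewrite !gt_eqF.
apply: weighted_sum_cvg.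
- by move=> n; rewrite invr_ge0.
- by move=> n; exact: sqr_ge0.
- have h : (g2 n / n%:R `^ r22) ^+ 2 * (ln n%:R)^-1 @[n --> \oo] --> 0.
    rewrite -[X in _ --> X](mulr0 (k2 ^+ 2)).
    by apply: cvgM; [exact: cvg_sqr|exact: ln_nat_cvg].
  apply: cvg_trans h; apply: near_eq_cvg; near=> n.
  by rewrite bE//; near: n; exact: nbhs_infty_gt.
- have h : (g2 n / n%:R `^ r22) ^+ 2 * ((ln n%:R)^-1 * \sum_(k < n) l k) @[n --> \oo]
      --> k2 ^+ 2 * 1.
    by apply: cvgM; [exact: cvg_sqr|exact: harmonic_div_ln_cvg].
  apply: cvg_trans h; apply: near_eq_cvg; near=> n.
  by rewrite bE ?mulrA//; near: n; exact: nbhs_infty_gt.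
- have h : r22 ^+ 2 * gam * (g1 n / n%:R `^ r11) *
    (g2 n / n%:R `^ r22) ^- 2 * (1 + r22 / n.+1%:R) ^- 2 @[n --> \oo]
      --> r22 ^+ 2 * gam * k1 * k2 ^- 2 * 1.
    apply: cvgM; last exact: step_cvg.
    apply: cvgM; last by apply: cvgV; [rewrite gt_eqF// exprn_gt0|exact: cvg_sqr].
    by apply: cvgM => //; exact: cvg_cst.
  apply: cvg_trans h; apply: near_eq_cvg; near=> n.
  by rewrite eE//; near: n; exact: nbhs_infty_gt.
Unshelve. all: by end_near. Qed.

Lemma sqrt_powR_cvg0 : Num.sqrt (n%:R `^ r11) / g1 n @[n --> \oo] --> 0.
Proof.
apply: cvg0_sqr.
have h : (g1 n / n%:R `^ r11) ^- 2 * n%:R `^ (- r11) @[n --> \oo] --> 0.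
  rewrite -[X in _ --> X](mulr0 (k1 ^- 2)).
  apply: cvgM; last exact: powRN_cvg0.
  by apply: cvgV; [rewrite gt_eqF// exprn_gt0|exact: cvg_sqr].
apply: cvg_trans h; apply: near_eq_cvg; near=> n.
have n0 : (0 < n)%N by near: n; exact: nbhs_infty_gt.
rewrite !exprMn !exprVn sqr_sqrtr ?powR_ge0// powRN.
by field; rewrite !gt_eqF ?p_gt0.
Unshelve. all: by end_near. Qed.

Lemma sqrt_powR_ln_cvg0 : Num.sqrt (n%:R `^ r11 * ln n%:R) / g1 n @[n --> \oo] --> 0.
Proof.
apply: cvg0_sqr.
have h : (g1 n / n%:R `^ r11) ^- 2 * (ln n%:R / n%:R `^ r11) @[n --> \oo] --> 0.
  rewrite -[X in _ --> X](mulr0 (k1 ^- 2)).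
  apply: cvgM; last exact: ln_div_powR_cvg.
  by apply: cvgV; [rewrite gt_eqF// exprn_gt0|exact: cvg_sqr].
apply: cvg_trans h; apply: near_eq_cvg; near=> n.
have n0 : (0 < n)%N by near: n; exact: nbhs_infty_gt.
rewrite !exprMn !exprVn sqr_sqrtr ?mulr_ge0 ?powR_ge0 ?ln_ge0 ?ler1n//.
by field; rewrite !gt_eqF ?p_gt0.
Unshelve. all: by end_near. Qed.

Lemma growth_div_sqrt_cvg0 : r22 < r11 / 2 ->
  g2 n / Num.sqrt (n%:R `^ r11) @[n --> \oo] --> 0.
Proof.
move=> sub; apply: cvg0_sqr.
have h : (g2 n / n%:R `^ r22) ^+ 2 * n%:R `^ (- (r11 - 2 * r22)) @[n --> \oo] --> 0.
  rewrite -[X in _ --> X](mulr0 (k2 ^+ 2)).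
  by apply: cvgM; [exact: cvg_sqr|apply: powRN_cvg0; lra].
apply: cvg_trans h; apply: near_eq_cvg; near=> n.
have n0 : (0 < n)%N by near: n; exact: nbhs_infty_gt.
have n1 : n%:R != 0 :> R by rewrite pnatr_eq0 -lt0n.
have -> : - (r11 - 2 * r22) = r22 + r22 - r11 by ring.
rewrite powRB ?n1 ?implybT// powRD ?n1 ?implybT// !exprMn !exprVn sqr_sqrtr ?powR_ge0//.
by field; rewrite !gt_eqF ?p_gt0.
Unshelve. all: by end_near. Qed.

Lemma growth_div_sqrt_ln_cvg0 : r22 = r11 / 2 ->
  g2 n / Num.sqrt (n%:R `^ r11 * ln n%:R) @[n --> \oo] --> 0.
Proof.
move=> crit; apply: cvg0_sqr.
have h : (g2 n / n%:R `^ r22) ^+ 2 * (ln n%:R)^-1 @[n --> \oo] --> 0.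
  rewrite -[X in _ --> X](mulr0 (k2 ^+ 2)).
  by apply: cvgM; [exact: cvg_sqr|exact: ln_nat_cvg].
apply: cvg_trans h; apply: near_eq_cvg; near=> n.
have n1 : (1 < n)%N by near: n; exact: nbhs_infty_gt.
have n0 : (0 < n)%N by apply: ltn_trans n1.
have nn : n%:R != 0 :> R by rewrite pnatr_eq0 -lt0n.
have l0 : 0 < ln (n%:R : R) by rewrite ln_gt0// ltr1n.
have r11E : r11 = r22 + r22 by lra.
rewrite !exprMn !exprVn sqr_sqrtr ?mulr_ge0 ?powR_ge0 ?(ltW l0)//.
rewrite r11E powRD ?nn ?implybT//.
by field; rewrite !gt_eqF ?p_gt0.
Unshelve. all: by end_near. Qed.

End urn_normalisations.

(** [B e m] is the event of a deviation of at least [e] from time [m] at some later time; its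
    probability is at most c m / e^2, so the intersection over [m] is null. Outside the countable
    union over e = 1/(j+1) the sequence is Cauchy. *)
Lemma as_cvg_maximal d (T : measurableType d) (R : realType) (P : probability T R)
    (Z : nat -> T -> R) (c : nat -> R) :
  (forall n, measurable_fun setT (Z n)) ->
  (forall m n (e : R), 0 < e ->
    (P [set w | exists2 k, (k <= n)%N & (e <= `|Z (m + k)%N w - Z m w|)%R]
     <= (c m / e ^+ 2)%:E)%E) ->
  c n @[n --> \oo] --> 0 ->
  {ae P, forall w, cvgn (fun n => Z n w)}.
Proof.
move=> mZ bnd c0.
pose A (e : R) m n := [set w | exists2 k, (k <= n)%N & e <= `|Z (m + k)%N w - Z m w|].
have mA e m n : measurable (A e m n).
  rewrite (_ : A e m n = \bigcup_(k in `I_n.+1) [set w | e <= `|Z (m + k)%N w - Z m w|]).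
    apply: bigcup_measurable => k _.
    have mf : measurable_fun setT (fun w => `|Z (m + k)%N w - Z m w|).
      by apply: measurableT_comp => //; exact: measurable_funB.
    rewrite (_ : [set w | _] = setT `&` (fun w => `|Z (m + k)%N w - Z m w|) @^-1` `[e, +oo[).
      by apply: mf.
    by rewrite setTI; apply/seteqP; split => w /=; rewrite in_itv/= andbT.
  by apply/seteqP; split => w [k kn h]; exists k.
pose B e m := \bigcup_n A e m n.
have mB e m : measurable (B e m) by exact: bigcup_measurable.
have PB e m : 0 < e -> (P (B e m) <= (c m / e ^+ 2)%:E)%E.
  move=> e0; have ndA : nondecreasing_seq (A e m).
    move=> i j ij; apply/subsetPset => w [k ki h]; exists k => //.
    exact: leq_trans ij.
  have h := @nondecreasing_cvg_mu _ _ _ P _ (mA e m) (mB e m) ndA.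
  rewrite -(cvg_lim _ h)//; apply: lime_le; first by apply/cvg_ex; eexists; exact: h.
  by apply: nearW => n; exact: bnd.
pose N e := \bigcap_m B e m.
have mN e : measurable (N e) by exact: bigcap_measurable.
have PN e : 0 < e -> P (N e) = 0%E.
  move=> e0; apply/eqP; rewrite eq_le measure_ge0 andbT.
  apply/lee_addgt0Pr => eps eps0; rewrite add0e.
  have ee : 0 < eps * e ^+ 2 by rewrite mulr_gt0// exprn_gt0.
  have /cvgrPdist_le/(_ _ ee)[m _ /(_ m (leqnn _))] := c0.
  rewrite /= sub0r normrN => hm; apply: (@le_trans _ _ (P (B e m))).
    by apply: le_measure; rewrite ?inE//; exact: bigcap_inf.
  apply: le_trans (PB _ _ e0) _; rewrite lee_fin ler_pdivrMr ?exprn_gt0//.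
  exact: le_trans (ler_norm _) hm.
have neg : P.-negligible (\bigcup_j N j.+1%:R^-1).
  by apply: negligible_bigcup => j; exists (N j.+1%:R^-1); split => //; apply: PN; rewrite invr_gt0.
apply: negligibleS neg => w /= ncv; apply: contrapT => nN; apply: ncv.
apply/cauchy_cvgP/cauchy_exP => _/posnumP[e].
have [j je] : exists j, j.+1%:R^-1 <= e%:num.
  exists (Num.truncn e%:num^-1); rewrite -[leRHS]invrK lef_pV2 ?posrE//.
  exact/ltW/truncnS_gt.
have [m nB] : exists m, ~ B j.+1%:R^-1 m w.
  apply: contrapT => /forallNP h; apply: nN; exists j => // m _.
  by apply: contrapT => nb; exact: h nb.
exists (Z m w), m => // n /= mn; rewrite /ball/= distrC.
rewrite ltNge; apply/negP => h; apply: nB; exists (n - m)%N => //; exists (n - m)%N => //.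
by rewrite subnKC//; exact: le_trans h.
Qed.

(** * The supercritical case: convergence almost surely and in L^2 *)

Section supercritical.
Context {R : realType} (r11 r12 r13 r22 r23 : R) (c0 : 'rV[R]_3).
Let Rm := replacement_matrix r11 r12 r13 r22 r23.
Hypothesis c0_gt0 : forall i, 0 < c0 0 i.
Hypothesis c0_sum : \sum_i c0 0 i = 1.
Hypothesis R_ge0 : forall i j, 0 <= Rm i j.
Hypothesis R_row : forall i, \sum_j Rm i j = 1.
Hypothesis r22_gt0 : 0 < r22.
Hypothesis r22_lt : r22 < r11.
Hypothesis r12_gt0 : 0 < r12.
Hypothesis sup : r11 / 2 < r22.
Context d (T : measurableType d) (P : probability T R).
Variables (draw : nat -> T -> 'I_3) (C : nat -> T -> 'rV[R]_3).
Hypothesis HC : urn_process P c0 Rm draw C.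

Let q := draw_prob c0 Rm.
Let E n (g : seq 'I_3 -> R) := path_exp q n [::] g.
Let eigm := eig_mart r11 r12 r13 r22 r23 c0.
Let u := uvar r11 r12 r22.
Let K := var_const r11 r12 r22.
Let dr := draws draw.
Let M n w := eigm (dr n w).

Let q_ge0 : forall s i, 0 <= q s i.
Proof. exact: draw_prob_ge0. Qed.

Let q_sum1 : forall s, \sum_i q s i = 1.
Proof. exact: draw_prob_sum1. Qed.

Let K_ge0 : 0 <= K.
Proof. by rewrite addr_ge0// invr_ge0 ltW// gamma_gt0. Qed.

Let U n := \sum_(k < n) u k.
Let Uoo := limn U.

Let U_ndecr : nondecreasing_seq U.
Proof.
apply/nondecreasing_seqP => n; rewrite /U big_ord_recr/= lerDl.
by rewrite ltW// uvar_gt0.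
Qed.

Let U_cvg : U n @[n --> \oo] --> Uoo.
Proof.
apply: nondecreasing_is_cvgn => //.
exists (r22 ^+ 2 * gamma r11 r12 r22 / (2 * r22 - r11)) => _ [n _ <-].
exact: uvar_sum_supercritical.
Qed.

Let U_le n : U n <= Uoo.
Proof. by apply: nondecreasing_cvgn_le => //; apply/cvg_ex; exists Uoo. Qed.

(** A bound on the total expected variance of all increments after time [m]; it controls both the
    L^2 distances and the maximal inequality. *)
Let tail m := K * (Uoo - U m).

Let tail_cvg : tail m @[m --> \oo] --> 0.
Proof.
rewrite -[X in _ --> X](mulr0 K); apply: cvgM; first exact: cvg_cst.
by rewrite -(subrr Uoo); apply: cvgB => //; exact: cvg_cst.
Qed.

Let tail_sum m n : K * \sum_(k < n) u (m + k) <= tail m.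
Proof.
rewrite /tail ler_wpM2l// lerBrDr.
by have := U_le (m + n); rewrite /U big_split_ord/= addrC.
Qed.

Let mM n : measurable_fun setT (M n).
Proof. exact: (measurable_fun_draws HC n eigm). Qed.

Let M_sqr_dist m n : (m <= n)%N ->
  (\int[P]_w ((M n w - M m w) ^+ 2)%:E <= (tail m)%:E)%E.
Proof.
move=> mn.
have e : (\int[P]_w ((M n w - M m w) ^+ 2)%:E)%E =
    (E n (fun s => (eigm s - eigm (drop (n - m) s)) ^+ 2))%:E.
  rewrite -(integral_draws HC); apply: eq_integral => w _.
  have -> : drop (n - m) (dr n w) = dr m w by rewrite -{2}(subnK mn) drop_draws.
  by [].
rewrite e lee_fin; apply: le_trans (tail_sum m (n - m)).
apply: le_trans (expect_eig_dev c0_gt0 c0_sum R_ge0 R_row r22_gt0 r22_lt r12_gt0 m (n - m)).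
rewrite -{1}(subnKC mn) /E path_exp_cat; apply: path_exp_le => // v vm.
by apply: path_exp_le => // v' vn'; rewrite drop_size_cat.
Qed.

Let M_maximal m n (e : R) : 0 < e ->
  (P [set w | exists2 k, (k <= n)%N & (e <= `|M (m + k)%N w - M m w|)%R] <=
    (tail m / e ^+ 2)%:E)%E.
Proof.
move=> e0; pose G (s : seq 'I_3) : R := [exists j : 'I_n.+1,
    e <= `|eigm (drop j s) - eigm (drop n s)|]%:R.
have GE w : (G (dr (m + n) w))%:E =
    (\1_[set w | exists2 k, (k <= n)%N & (e <= `|M (m + k)%N w - M m w|)%R] w)%:E :> \bar R.
  congr (_%:E); rewrite indicE /G; congr ((nat_of_bool _)%:R).
  (* A time [m + k] is reached by removing the last [n - k] of the [m + n] draws, so the two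
     indexings are reversed. *)
  have dropE k : (k <= n)%N -> drop (n - k) (dr (m + n) w) = dr (m + k) w.
    by move=> kn; rewrite -{2}(subnKC kn) addnA [(m + k + _)%N]addnC drop_draws.
  apply/existsP/idP => [[j hj]|/set_mem [k kn hk]].
    rewrite inE /=; exists (n - j)%N; first exact: leq_subr.
    have jn : (j <= n)%N by rewrite -ltnS.
    rewrite /M -(dropE _ (leq_subr j n)) subKn//.
    by rewrite -(addn0 m) -(dropE _ (leq0n n)) subn0 addn0.
  have nk : (n - k < n.+1)%N by rewrite ltnS leq_subr.
  exists (Ordinal nk) => /=; rewrite dropE//.
  have := dropE _ (leq0n n); rewrite subn0 addn0 => ->; exact: hk.
have mA : measurable [set w | exists2 k, (k <= n)%N & (e <= `|M (m + k)%N w - M m w|)%R].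
  rewrite (_ : [set w : T | _] = (fun w => G (dr (m + n) w)) @^-1` [set 1]).
    rewrite -[X in measurable X]setTI; apply: (measurable_fun_draws HC (m + n) G) => //.
  apply/seteqP; split => w /= h.
    by have [] := GE w; rewrite indicE mem_set.
  have [] := GE w; rewrite h indicE => /eqP.
  by case: (boolP (w \in _)) => [/set_mem//|_]; rewrite oner_eq0.
rewrite -[X in P X]setIT -integral_indic//.
under eq_integral do rewrite -GE.
rewrite (integral_draws HC (m + n) G) lee_fin.
apply: le_trans (expect_eig_maximal c0_gt0 c0_sum R_ge0 R_row r22_gt0 r22_lt r12_gt0 m n e0) _.
by rewrite -mulr_suml mulrA ler_pM2r ?invr_gt0 ?exprn_gt0//; exact: tail_sum.
Qed.

Let M_ae : {ae P, forall w, cvgn (fun n => M n w)}.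
Proof. by apply: (@as_cvg_maximal _ _ _ _ _ tail) => //; exact: M_maximal. Qed.

Lemma eig_mart_limit : exists Y : T -> R, [/\ measurable_fun setT Y,
  {ae P, forall w, M n w @[n --> \oo] --> Y w} &
  forall m, (\int[P]_w ((M m w - Y w) ^+ 2)%:E <= (tail m)%:E)%E].
Proof.
have [N [mN PN sN]] := M_ae.
(* Put to 0 on a negligible set, the sequence converges everywhere, and its pointwise limit is
   measurable. *)
pose h n w := M n w * \1_(~` N) w.
have mh n : measurable_fun setT (h n).
  by apply: measurable_funM => //; apply: measurable_indic; exact: measurableC.
have ch w : cvgn (fun n => h n w).
  have [wN|wN] := pselect (N w).
    rewrite /h indicE memNset; last by move=> /(_ wN).
    by under eq_fun do rewrite mulr0; exact: is_cvg_cst.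
  rewrite /h indicE mem_set//; under eq_fun do rewrite mulr1.
  by apply: contrapT => ncv; apply: wN; apply: sN.
pose Y w := limn (fun n => h n w).
have Mh w n : ~ N w -> h n w = M n w.
  by move=> wN; rewrite /h indicE mem_set// mulr1.
have aeY : {ae P, forall w, M n w @[n --> \oo] --> Y w}.
  exists N; split => // w /= hw; apply: contrapT => wN; apply: hw.
  rewrite (_ : (fun n => M n w) = (fun n => h n w)); first exact: ch.
  by apply/funext => n; rewrite Mh.
have mY : measurable_fun setT Y.
  by apply: (@measurable_fun_cvg _ _ _ _ h) => // w _; exact: ch.
exists Y; split => // m.
pose F n w := ((h (n + m)%N w - M m w) ^+ 2)%:E.
have mF n : measurable_fun setT (F n).
  by apply/measurable_EFinP; apply: measurable_funX; exact: measurable_funB.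
have F0 n w : setT w -> (0 <= F n w)%E by rewrite lee_fin sqr_ge0.
have intF n : (\int[P]_w F n w <= (tail m)%:E)%E.
  apply: le_trans (M_sqr_dist (leq_addl n m)).
  rewrite le_eqVlt; apply/orP; left; apply/eqP; apply: ae_eq_integral => //.
    by apply/measurable_EFinP; apply: measurable_funX; exact: measurable_funB.
  exists N; split => // w /= hw; apply: contrapT => wN; apply: hw => _.
  by rewrite /F Mh.
(* The bound on the second moment of [M n - M m] is uniform in n, so it passes to the limit [Y]. *)
have fat := fatou P measurableT mF F0.
apply: (@le_trans _ _ (\int[P]_w limn_einf (F ^~ w))%E).
  rewrite le_eqVlt; apply/orP; left; apply/eqP; apply: eq_integral => w _.
  have hF : F n w @[n --> \oo] --> ((M m w - Y w) ^+ 2)%:E.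
    apply: cvg_EFin; first exact: nearW.
    rewrite -sqrrN opprB; apply: cvg_sqr; apply: cvgB; last exact: cvg_cst.
    rewrite (cvg_shiftn m (fun n => h n w)); exact: ch.
  rewrite is_cvg_limn_einfE; first exact/esym/cvg_lim.
  by apply/cvg_ex; eexists; exact: hF.
apply: le_trans fat _; rewrite limn_einf_lim.
apply: lime_le; first exact: is_cvg_einfs.
apply: nearW => n; apply: le_trans (intF n).
by apply: ereal_inf_lbound; exists n => //=.
Qed.

Lemma eig_cvg_supercritical (k : R) : 0 < k ->
  growth r22 n / n%:R `^ r22 @[n --> \oo] --> k ->
  exists W : {RV P >-> R},
    [/\ as_cvg P (fun n w => (C n w *m xi2 r11 r12 r22) 0 0 / n%:R `^ r22) W,
        L2_cvg P (fun n w => (C n w *m xi2 r11 r12 r22) 0 0 / n%:R `^ r22) W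
      & nondegenerate_rv P W].
Proof.
move=> k0 gk; have [Y [mY aeY L2Y]] := eig_mart_limit.
have mW : measurable_fun setT (fun w => k * Y w) by exact: measurable_funM.
pose W : {RV P >-> R} := HB.pack (fun w => k * Y w) (isMeasurableFun.Build _ _ _ _ _ mW).
have g0 n : 0 < growth r22 n by apply: growth_gt0; exact: ltW.
pose r n := growth r22 n / n%:R `^ r22.
have XE n w : (C n w *m xi2 r11 r12 r22) 0 0 / n%:R `^ r22 = r n * M n w.
  rewrite (compositionE HC) /r /M /eigm /eig_mart size_draws -/(eig _ _ _ _ _ _ _).
  by rewrite [RHS]mulrC mulrA divfK ?gt_eqF.
have -> : (fun n w => (C n w *m xi2 r11 r12 r22) 0 0 / n%:R `^ r22) = (fun n w => r n * M n w).
  by apply/funext => n; apply/funext => w; exact: XE.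
exists W; split.
- by apply: filterS aeY => w hw; rewrite /W/=; apply: cvgM.
(* From r M - k Y = (r - k) M + k (M - Y) and (x + y)^2 <= 2 x^2 + 2 y^2; the factor 1 + K Uoo
   bounds the second moment of all [M n]. *)
- pose b n := 2 * (r n - k) ^+ 2 * (1 + K * Uoo) + 2 * k ^+ 2 * tail n.
  have b_cvg : b n @[n --> \oo] --> 0.
    have -> : 0 = 2 * (k - k) ^+ 2 * (1 + K * Uoo) + 2 * k ^+ 2 * 0 :> R.
      by rewrite subrr expr0n/= !mulr0 mul0r addr0.
    apply: cvgD; last by apply: cvgM; [exact: cvg_cst|exact: tail_cvg].
    apply: cvgM; last exact: cvg_cst.
    apply: cvgM; first exact: cvg_cst.
    by apply: cvg_sqr; apply: cvgB => //; exact: cvg_cst.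
  have b0 n : 0 <= b n.
    have t0 : 0 <= tail n by rewrite mulr_ge0// subr_ge0 U_le.
    have U0 : 0 <= Uoo by apply: le_trans (U_le 0); rewrite /U big_ord0.
    have KU0 : 0 <= 1 + K * Uoo by rewrite addr_ge0// mulr_ge0.
    apply: addr_ge0; first by apply: mulr_ge0 KU0; rewrite mulr_ge0// sqr_ge0.
    by apply: mulr_ge0 t0; rewrite mulr_ge0// sqr_ge0.
  have bound n : (\int[P]_w ((r n * M n w - W w) ^+ 2)%:E <= (b n)%:E)%E.
    apply: (@le_trans _ _ (\int[P]_w ((2 * (r n - k) ^+ 2)%:E * ((M n w) ^+ 2)%:E +
        (2 * k ^+ 2)%:E * ((M n w - Y w) ^+ 2)%:E))%E).
      apply: ge0_le_integral => //.
      + by move=> w _; rewrite lee_fin sqr_ge0.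
      + apply/measurable_EFinP; apply: measurable_funX; apply: measurable_funB => //.
        exact: measurable_funM.
      + apply/measurable_EFinP; apply: measurable_funD; apply: measurable_funM => //.
          exact: measurable_funX.
        by apply: measurable_funX; exact: measurable_funB.
      + move=> w _; rewrite -!EFinM -EFinD lee_fin /W/=.
        have := sqr_ge0 ((r n - k) * M n w - k * (M n w - Y w)); nra.
    rewrite ge0_integralD//; last 4 first.
    + by move=> w _; rewrite -EFinM lee_fin mulr_ge0 ?sqr_ge0// mulr_ge0// sqr_ge0.
    + apply/measurable_EFinP; apply: measurable_funM => //; exact: measurable_funX.
    + by move=> w _; rewrite -EFinM lee_fin mulr_ge0 ?sqr_ge0// mulr_ge0// sqr_ge0.
    + apply/measurable_EFinP; apply: measurable_funM => //.
      by apply: measurable_funX; exact: measurable_funB.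
    rewrite ge0_integralZl//; last 3 first.
    + by apply/measurable_EFinP; exact: measurable_funX.
    + by move=> w _; rewrite lee_fin sqr_ge0.
    + by rewrite lee_fin mulr_ge0// sqr_ge0.
    rewrite ge0_integralZl//; last 3 first.
    + by apply/measurable_EFinP; apply: measurable_funX; exact: measurable_funB.
    + by move=> w _; rewrite lee_fin sqr_ge0.
    + by rewrite lee_fin mulr_ge0// sqr_ge0.
    rewrite /b EFinD; apply: leeD.
      rewrite [leRHS]EFinM; apply: lee_wpmul2l; first by rewrite lee_fin mulr_ge0// sqr_ge0.
      rewrite (integral_draws HC n (fun s => eigm s ^+ 2)) lee_fin.
      apply: le_trans (expect_eig_mart_sqr c0_gt0 c0_sum R_ge0 R_row r22_gt0 r22_lt r12_gt0 n) _.
      by rewrite lerD2l ler_wpM2l//; exact: U_le.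
    rewrite [leRHS]EFinM; apply: lee_wpmul2l; first by rewrite lee_fin mulr_ge0// sqr_ge0.
    exact: L2Y.
  rewrite /L2_cvg.
  pose a n := fine (\int[P]_w ((r n * M n w - W w) ^+ 2)%:E)%E.
  have aE n : (\int[P]_w ((r n * M n w - W w) ^+ 2)%:E)%E = (a n)%:E.
    rewrite fineK// ge0_fin_numE; last by apply: integral_ge0 => w _; rewrite lee_fin sqr_ge0.
    by apply: le_lt_trans (bound n) _; rewrite ltry.
  have a0 n : 0 <= a n by rewrite -lee_fin -aE; apply: integral_ge0 => w _; rewrite lee_fin sqr_ge0.
  have a_cvg : a n @[n --> \oo] --> 0.
    apply: (@squeeze_cvgr _ _ _ _ (cst 0) _ _ _ _ _ b_cvg); last exact: cvg_cst.
    by apply: nearW => n; rewrite a0/= -lee_fin -aE.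
  have LE n : ('N[P]_2%:E[(fun w => (r n * M n w - W w)%:E)])%E = (Num.sqrt (a n))%:E.
    rewrite unlock /Lnorm.
    under eq_integral do rewrite abse_EFin poweR_EFin powR_mulrn// real_normK ?num_real//.
    by rewrite aE poweR_EFin powR12_sqrt.
  rewrite (_ : (fun n => _) = (fun n => (Num.sqrt (a n))%:E)); last by apply/funext => n; exact: LE.
  apply: cvg_EFin; first exact: nearW.
  rewrite -(sqrtr0 R); apply: (cvg_comp a Num.sqrt a_cvg); exact: sqrt_continuous.
- move=> [c Wc].
  (* If [W] were the constant [c], then E (M_n - c/k)^2 would be at most [tail n], which tends to 0.
     For n > 0 it is at least the variance of the first increment, which is positive. *)
  have [n [n1 ntail]] : exists n, (0 < n)%N /\ tail n < cond_var q eigm [::].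
    have cv0 : 0 < cond_var q eigm [::] by apply: eig_cond_var_nil.
    have /cvgrPdist_lt/(_ _ cv0) h := tail_cvg.
    have [n [h1 h2]] := filter_ex (filterI h (nbhs_infty_gt 0)).
    by exists n; split => //; move: h1; rewrite sub0r normrN; apply: le_lt_trans; exact: ler_norm.
  have intc : (\int[P]_w ((M n w - Y w) ^+ 2)%:E = \int[P]_w ((M n w - c / k) ^+ 2)%:E)%E.
    apply: ae_eq_integral => //.
    + by apply/measurable_EFinP; apply: measurable_funX; exact: measurable_funB.
    + by apply/measurable_EFinP; apply: measurable_funX; exact: measurable_funB.
    + apply: filterS Wc => w hw _; rewrite -hw /W/=.
      by rewrite mulrC mulKf// gt_eqF.
  have := L2Y n; rewrite intc (integral_draws HC n (fun s => (eigm s - c / k) ^+ 2)) lee_fin.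
  rewrite path_exp_sqr//; last exact: eig_martP.
  case: n n1 ntail {intc} => // n _ ntail; apply/negP; rewrite -ltNge.
  apply: lt_le_trans ntail _; rewrite big_ord_recl/= addrCA lerDl.
  rewrite addr_ge0 ?sqr_ge0// sumr_ge0// => i _.
  apply: path_exp_ge0 => // v _; apply: sumr_ge0 => j _; apply: mulr_ge0 => //.
  exact: (cond_var_ge0 q_ge0).
Qed.

End supercritical.

Theorem proposition4p2 (R : realType) (d : measure_display)
    (T : measurableType d) (P : probability T R)
    (r11 r12 r13 r22 r23 : R) (c0 : 'rV[R]_3)
    (draw : nat -> T -> 'I_3) (C : nat -> T -> 'rV[R]_3)
    (V1 : {RV P >-> R})
    (c0_gt0 : forall i, 0 < c0 0 i)
    (c0_sum : \sum_i c0 0 i = 1)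
    (R_ge0 : forall i j, 0 <= replacement_matrix r11 r12 r13 r22 r23 i j)
    (R_row : forall i, \sum_j replacement_matrix r11 r12 r13 r22 r23 i j = 1)
    (HC : urn_process P c0 (replacement_matrix r11 r12 r13 r22 r23) draw C)
    (r22_gt0 : 0 < r22) (r22_lt : r22 < r11) (r12_gt0 : 0 < r12)
    (HV1 : as_cvg P (fun n w => C n w 0 0 / n%:R `^ r11) V1) :
  [/\ r22 < r11 / 2 ->
      cvg_in_distribution P
        (fun n w => (C n w *m xi2 r11 r12 r22) 0 0 / Num.sqrt (n%:R `^ r11))
        (normal_mixture
          (r12 * r22 ^+ 2 * (r12 + r11 - r22) / (r11 - 2 * r22)) V1),
      r22 = r11 / 2 ->
      cvg_in_distribution P
        (fun n w =>
          (C n w *m xi2 r11 r12 r22) 0 0 / Num.sqrt (n%:R `^ r11 * ln n%:R))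
        (normal_mixture (r12 * r22 ^+ 2 * (r12 + r11 - r22)) V1)
    & r11 / 2 < r22 ->
      exists W : {RV P >-> R},
        [/\ as_cvg P
              (fun n w => (C n w *m xi2 r11 r12 r22) 0 0 / n%:R `^ r22) W,
            L2_cvg P
              (fun n w => (C n w *m xi2 r11 r12 r22) 0 0 / n%:R `^ r22) W
          & nondegenerate_rv P W]].
Proof.
have [_ r11_lt1] := first_row_bounds R_ge0 R_row r12_gt0.
have r11_gt0 : 0 < r11 := lt_trans r22_gt0 r22_lt.
have [|k1 k1_gt0 g1_cvg] := @growth_cvg R r11; first by rewrite r11_gt0.
have [|k2 k2_gt0 g2_cvg] := @growth_cvg R r22.
  by rewrite r22_gt0 (lt_trans r22_lt).
have gam0 : 0 <= r12 * r22 ^+ 2 * (r12 + r11 - r22).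
  by rewrite mulr_ge0 ?(mulr_ge0 (ltW r12_gt0) (sqr_ge0 _))//; lra.
split => [sub|crit|sup].
- apply: (urn_cvg_in_distribution c0_gt0 c0_sum R_ge0 R_row r22_gt0 r22_lt r12_gt0
    HC HV1 k1_gt0 g1_cvg).
  + by apply: divr_ge0 => //; lra.
  + by move=> n; exact: sqrtr_ge0.
  + exists 1%N => // n /= n1; rewrite sqrtr_gt0 powR_gt0//.
    by rewrite ltr0n.
  + exact: growth_div_sqrt_cvg0 g2_cvg sub.
  + exact: (sqrt_powR_cvg0 r22_gt0 r22_lt k1_gt0 g1_cvg).
  + exact: (uvar_sum_subcritical r11_lt1 r22_gt0 k2_gt0 g1_cvg g2_cvg sub).
- apply: (urn_cvg_in_distribution c0_gt0 c0_sum R_ge0 R_row r22_gt0 r22_lt r12_gt0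
    HC HV1 k1_gt0 g1_cvg gam0).
  + by move=> n; exact: sqrtr_ge0.
  (* The logarithm vanishes at 1, so positivity starts at 2. *)
  + exists 2%N => // n /= n2; rewrite sqrtr_gt0; apply: mulr_gt0.
      by rewrite powR_gt0// ltr0n; exact: ltn_trans n2.
    by rewrite ln_gt0// ltr1n.
  + exact: growth_div_sqrt_ln_cvg0 g2_cvg crit.
  + exact: (sqrt_powR_ln_cvg0 r22_gt0 r22_lt k1_gt0 g1_cvg).
  + exact: (uvar_sum_critical r22_gt0 k2_gt0 g1_cvg g2_cvg crit).
- exact: (eig_cvg_supercritical c0_gt0 c0_sum R_ge0 R_row r22_gt0 r22_lt r12_gt0 sup HC k2_gt0 g2_cvg).
Qed.
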